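(* Let $n\ge 1$ be an integer and let $P_1,P_2,Q_1,Q_2,I_1,I_2,J_1,J_2\subseteq[n]$ be nonempty with $|P_k|=|Q_k|$ and $|I_k|=|J_k|$ for $k=1,2$, and $|P_1|+|P_2|=|I_1|+|I_2|=n$. Define $$R_1:=P_1\cup(2n+1-Q_2),\quad R_2:=P_2\cup(2n+1-Q_1),\quad K_1:=I_1\cup(2n+1-J_2),\quad K_2:=I_2\cup(2n+1-J_1),$$ and $M:=(R_1\setminus R_2)\cup(R_2\setminus R_1)$. Then statement (5) below is equivalent to each of (1), (2), (3): (1) For all $n\times n$ totally nonnegative matrices $A$, $\det A(P_1|Q_1)\det A(P_2|Q_2)\le\det A(I_1|J_1)\det A(I_2|J_2)$. (2) For all $2n\times 2n$ totally nonnegative matrices $B$, $\det B(R_1|R_1)\det B(R_2|R_2)\le\det B(K_1|K_1)\det B(K_2|K_2)$. (3) The multisets $R_1\cup R_2$ and $K_1\cup K_2$ are equal, and for all even contiguous $S\subseteq M$, $\max\{|S\cap R_1|,|S\cap R_2|\}\ge\max\{|S\cap K_1|,|S\cap K_2|\}$. (5) The multisets $R_1\cup R_2$ and $K_1\cup K_2$ are equal, and for all integers $k\ge 1$ and all consecutive integer pairs $(u_1,v_1),\dots,(u_k,v_k)$ in $[2n]$, the composite index-row operation $$\mathrm R_{(u_k,v_k)}\circ\cdots\circ\mathrm R_{(u_1,v_1)}$$ applied to the determinantal expression $$\det B(R_1|R_1)\det B(R_2|R_2)\le\det B(K_1|K_1)\det B(K_2|K_2)$$ returns an expression which is a valid inequality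 for all $2n\times 2n$ totally nonnegative matrices $B$. The same result holds for the mixed row/column variant of (5), in which any of the index-row operations $\mathrm R_{(u_t,v_t)}$ in the composition may be replaced by the index-column operation $\mathrm C_{(u_t,v_t)}$.
   Context: $[m]=\{1,\dots,m\}$. For an integer $l$ and a set $X$ of integers, $l-X:=\{l-x:x\in X\}$. Equality of the multisets $R_1\cup R_2$ and $K_1\cup K_2$ means that every integer lies in the same number of the sets $R_1,R_2$ as of the sets $K_1,K_2$. For $M=\{m_1<\cdots<m_t\}$, a subset $S\subseteq M$ is contiguous in $M$ if $S=\{m_s:s\in L\}$ for some interval of integers $L\subseteq[t]$; it is even if $|S|$ is even. A consecutive integer pair in $[2n]$ is a pair $(u,v)$ with $u,v\in[2n]$ and $|u-v|=1$. $B(X|Y)$ is the submatrix with row indices in $X$ and column indices in $Y$ (increasing order); the empty determinant is $1$. A real matrix is totally nonnegative (TN) if the determinant of each of its square submatrices is $\ge 0$. For a set $X$ of indices, $X(u,v):=(X\setminus\{u\})\cup\{v\}$ if $u\in X$ and $v\notin X$, and $X(u,v):=X$ otherwise. The index-row operation $\mathrm R_{(u,v)}$ acts on a formal determinantal expression (built from products of minors $\det B(X|Y)$, signs and relation symbols) as follows: in every minor the row index set $X$ is replaced by $X(u,v)$; for each product of minors occurring in the expression (on either side) count the number of its minors for which $u\in X$ and $v\notin X$; the products for which this count equals its maximum over all products in the expression are kept (with the new row sets), and the products with a smaller count are replaced by $0$; all other symbols are unchanged. Products already replaced by $0$ are not taken into account in later operations. The index-column operation $\mathrm C_{(u,v)}$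 is defined in the same way, acting on the column index sets $Y$ instead of the row index sets. *)

(* Defs.v *)
From mathcomp Require Import all_boot all_order all_algebra.
From mathcomp Require Import reals.

Set Implicit Arguments.
Unset Strict Implicit.
Unset Printing Implicit Defensive.

Import Order.TTheory GRing.Theory Num.Theory.

Local Open Scope ring_scope.

(* Indices are 0-based throughout: the integer i of [m] = {1, .., m} is the    *)
(* ordinal of value i - 1 in 'I_m.                                             *)

(* [enum_val] lists a set of ordinals increasingly.  [conform_mx] is only a    *)
(* type adjustment, since #|X| and #|Y| are not convertible; the value is      *)
(* meaningful only for #|X| = #|Y|.                                            *)
Definition minor (R : comNzRingType) (m : nat) (B : 'M[R]_m)
    (X Y : {set 'I_m}) : R :=
  \det (conform_mx (0 : 'M[R]_#|X|)
          (mxsub (@enum_val _ (mem X)) (@enum_val _ (mem Y)) B)).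

Definition totally_nonnegative (R : realType) (m : nat) (B : 'M[R]_m) : Prop :=
  forall X Y : {set 'I_m}, #|X| = #|Y| -> 0 <= minor B X Y.

(* X \cup (2n + 1 - Y) for X, Y \subseteq [n]; in 0-based terms, 2n + 1 - y is *)
(* [rev_ord] on 'I_(n + n).                                                    *)
Definition fold_index (n : nat) (X Y : {set 'I_n}) : {set 'I_(n + n)} :=
  [set lshift n x | x in X] :|: [set rev_ord (lshift n y) | y in Y].

Definition eq_multiset_union (m : nat) (R1 R2 K1 K2 : {set 'I_m}) : Prop :=
  forall x : 'I_m,
    ((x \in R1) + (x \in R2) = (x \in K1) + (x \in K2))%N.

Definition contiguous (m : nat) (M S : {set 'I_m}) : Prop :=
  exists a b : nat, S = [set @enum_val _ (mem M) s | s : 'I_#|M| & (a <= s < b)%N].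

Definition consecutive (m : nat) (u v : 'I_m) : bool :=
  (u.+1 == v :> nat) || (v.+1 == u :> nat).

Section FormalExpressions.
Variable m : nat.

(* (X, Y) stands for det B(X|Y); a product is the list of its factors. *)
Definition minor_symbol : Type := {set 'I_m} * {set 'I_m}.
Definition minor_product : Type := seq minor_symbol.

Inductive det_sum : Type :=
  | Zero
  | Product of minor_product
  | Opp of det_sum
  | Add of det_sum & det_sum.

Inductive det_expr : Type :=
  | Le of det_sum & det_sum
  | Eq of det_sum & det_sum.

Definition eval_product (R : comNzRingType) (B : 'M[R]_m) (p : minor_product) : R :=
  \prod_(s <- p) minor B s.1 s.2.

Fixpoint eval_sum (R : comNzRingType) (B : 'M[R]_m) (e : det_sum) : R :=
  match e with
  | Zero => 0
  | Product p => eval_product B p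
  | Opp e1 => - eval_sum B e1
  | Add e1 e2 => eval_sum B e1 + eval_sum B e2
  end.

Definition holds (R : realType) (B : 'M[R]_m) (E : det_expr) : Prop :=
  match E with
  | Le e1 e2 => eval_sum B e1 <= eval_sum B e2
  | Eq e1 e2 => eval_sum B e1 = eval_sum B e2
  end.

Definition valid_TN (R : realType) (E : det_expr) : Prop :=
  forall B : 'M[R]_m, totally_nonnegative B -> holds B E.

Fixpoint products_sum (e : det_sum) : seq minor_product :=
  match e with
  | Zero => [::]
  | Product p => [:: p]
  | Opp e1 => products_sum e1
  | Add e1 e2 => products_sum e1 ++ products_sum e2
  end.

Definition products_expr (E : det_expr) : seq minor_product :=
  match E with Le e1 e2 | Eq e1 e2 => products_sum e1 ++ products_sum e2 end.

Fixpoint subst_sum (f : minor_product -> det_sum) (e : det_sum) : det_sum :=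
  match e with
  | Zero => Zero
  | Product p => f p
  | Opp e1 => Opp (subst_sum f e1)
  | Add e1 e2 => Add (subst_sum f e1) (subst_sum f e2)
  end.

Definition subst_expr (f : minor_product -> det_sum) (E : det_expr) : det_expr :=
  match E with
  | Le e1 e2 => Le (subst_sum f e1) (subst_sum f e2)
  | Eq e1 e2 => Eq (subst_sum f e1) (subst_sum f e2)
  end.

Definition replaceable (u v : 'I_m) (X : {set 'I_m}) : bool :=
  (u \in X) && (v \notin X).

Definition replace (u v : 'I_m) (X : {set 'I_m}) : {set 'I_m} :=
  if replaceable u v X then v |: (X :\ u) else X.

Inductive index_op : Type :=
  | RowOp of 'I_m & 'I_m
  | ColOp of 'I_m & 'I_m.

Definition consecutive_op (o : index_op) : bool :=
  match o with RowOp u v | ColOp u v => consecutive u v end.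

Definition op_active (o : index_op) (s : minor_symbol) : bool :=
  match o with
  | RowOp u v => replaceable u v s.1
  | ColOp u v => replaceable u v s.2
  end.

Definition op_symbol (o : index_op) (s : minor_symbol) : minor_symbol :=
  match o with
  | RowOp u v => (replace u v s.1, s.2)
  | ColOp u v => (s.1, replace u v s.2)
  end.

Definition apply_op (o : index_op) (E : det_expr) : det_expr :=
  let d := (\max_(p <- products_expr E) count (op_active o) p)%N in
  subst_expr (fun p => if count (op_active o) p == d
                       then Product (map (op_symbol o) p) else Zero) E.

(* The head of the list is applied first. *)
Definition apply_ops (os : seq index_op) (E : det_expr) : det_expr :=
  foldl (fun E' o => apply_op o E') E os.

Definition principal_ineq (R1 R2 K1 K2 : {set 'I_m}) : det_expr :=
  Le (Product [:: (R1, R1); (R2, R2)]) (Product [:: (K1, K1); (K2, K2)]).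

End FormalExpressions.

Arguments Zero {m}.

Definition ineq_TN (R : realType) (n : nat)
    (P1 P2 Q1 Q2 I1 I2 J1 J2 : {set 'I_n}) : Prop :=
  forall A : 'M[R]_n, totally_nonnegative A ->
    minor A P1 Q1 * minor A P2 Q2 <= minor A I1 J1 * minor A I2 J2.

Definition contiguous_max_cond (m : nat) (R1 R2 K1 K2 : {set 'I_m}) : Prop :=
  eq_multiset_union R1 R2 K1 K2 /\
  forall S : {set 'I_m},
    contiguous ((R1 :\: R2) :|: (R2 :\: R1)) S -> ~~ odd #|S| ->
    (maxn #|S :&: K1| #|S :&: K2| <= maxn #|S :&: R1| #|S :&: R2|)%N.

Definition row_ops_cond (R : realType) (m : nat)
    (R1 R2 K1 K2 : {set 'I_m}) : Prop :=
  eq_multiset_union R1 R2 K1 K2 /\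
  forall s : seq ('I_m * 'I_m),
    (1 <= size s)%N -> all (fun uv => consecutive uv.1 uv.2) s ->
    valid_TN R (apply_ops [seq RowOp uv.1 uv.2 | uv <- s]
                          (principal_ineq R1 R2 K1 K2)).

Definition mixed_ops_cond (R : realType) (m : nat)
    (R1 R2 K1 K2 : {set 'I_m}) : Prop :=
  eq_multiset_union R1 R2 K1 K2 /\
  forall os : seq (index_op m),
    (1 <= size os)%N -> all (@consecutive_op m) os ->
    valid_TN R (apply_ops os (principal_ineq R1 R2 K1 K2)).

(* Main.v *)
(* Write a pair of index sets as a two-colouring of the sites lying in exactly
   one of the two sets.

   Condition (3) implies the inequalities.  An n x n matrix A stacked over signed
   unit rows turns minors of A into maximal minors of a 2n x n matrix whose
   maximal minors are all nonnegative.  Such a matrix is reduced, one bridge (a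
   row operation on neighbouring rows) at a time, to a matrix with a single
   nonzero maximal minor.  Undoing a bridge maps the indicator of "compatible
   with a given noncrossing matching of the sites" to a nonnegative combination
   of such indicators, so a product of two minors is a nonnegative combination of
   these indicators.  Condition (3) says that every matching compatible with the
   left-hand colouring is compatible with the right-hand one.

   The inequalities imply (5).  Replacing B by (1 + t E_uv) B makes every product
   of minors a polynomial in t >= 0, and the index operation keeps exactly the
   top coefficients.

   (5) and (1) imply (3).  If two oppositely coloured sites of the left-hand side
   have no coloured site between them, operations bring them together and
   annihilate them; if the right-hand colouring agreed on these sites its product
   would be killed, leaving a positive product <= 0.  Annihilating all such pairs
   inside an interval leaves |imbalance| sites of a single colour, which bounds
   the imbalance of the right-hand colouring.  For (1) the pairs on either side of
   the fold are annihilated by adding t to the last diagonal entry of A. *)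

Require Import Defs.
From mathcomp Require Import all_boot all_order all_algebra.
From mathcomp Require Import perm reals zify ring.

Set Implicit Arguments.
Unset Strict Implicit.
Unset Printing Implicit Defensive.

Import Order.TTheory GRing.Theory Num.Theory.

Local Open Scope ring_scope.

(** * Maximal minors as functions of lists of rows *)

(** Total nonnegativity allows vanishing minors, and the bridge argument treats them directly
    instead of approximating by matrices with positive minors. The coefficient of a bridge is the
    smallest ratio of two maximal minors that it relates, so no maximal minor turns negative, at
    least one vanishes, and the number of nonzero ones drops. Rows lying in all or in none of the
    bases are transparent, so the two rows of a bridge may have such rows between them.

    The minor of [A] on rows [P] and columns [Q] lives on [P] and the reflected complement of [Q],
    whereas [R1] combines [P1] with [Q2]. Both pairs of sets have the same difference of indicators,
    hence the same imbalance on every interval; the crossed indices come from there.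

    Matchings see only intervals in which the two colours balance: an arc with its interior is
    balanced, and so is the interior alone. A balanced interval has evenly many coloured sites,
    which is why (3) speaks of even [S]. In the other direction the collapse bounds the imbalance on
    every interval. *)

Section RowDet.
Variables (R : comNzRingType) (k : nat).
Implicit Types (s : seq 'rV[R]_k) (v w : 'rV[R]_k).

Definition row_det s : R := \det (\matrix_(i < k) nth 0 s i).

Lemma row_det_linear s1 s2 a v w : size (s1 ++ v :: s2) = k ->
  row_det (s1 ++ (a *: v + w) :: s2) =
  a * row_det (s1 ++ v :: s2) + row_det (s1 ++ w :: s2).
Proof.
rewrite size_cat /= => sz; have lt1 : (size s1 < k)%N by lia.
rewrite -[row_det (s1 ++ w :: s2)]mul1r.
apply: (determinant_multilinear (i0 := Ordinal lt1)).
- rewrite !rowK /= !nth_cat !ltnn !subnn /=; by rewrite scale1r.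
- apply/matrixP => i j0; rewrite !mxE; congr (fun_of_matrix _ _ _).
  have : lift (Ordinal lt1) i != size s1 :> nat.
    by rewrite eq_sym; exact: (neq_lift (Ordinal lt1) i).
  rewrite !nth_cat; case: ltngtP => // lt _.
  by case E : (_ - _)%N => [|j] //; lia.
- apply/matrixP => i j0; rewrite !mxE; congr (fun_of_matrix _ _ _).
  have : lift (Ordinal lt1) i != size s1 :> nat.
    by rewrite eq_sym; exact: (neq_lift (Ordinal lt1) i).
  rewrite !nth_cat; case: ltngtP => // lt _.
  by case E : (_ - _)%N => [|j] //; lia.
Qed.

Lemma row_det_swap s1 s2 v w : size (s1 ++ v :: w :: s2) = k ->
  row_det (s1 ++ v :: w :: s2) = - row_det (s1 ++ w :: v :: s2).
Proof.
rewrite size_cat /= => sz.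
have lt1 : (size s1 < k)%N by lia.
have lt2 : ((size s1).+1 < k)%N by lia.
rewrite /row_det.
set A := (X in \det X = _); set B := (X in _ = - \det X).
have -> : A = xrow (Ordinal lt1) (Ordinal lt2) B.
  apply/row_matrixP => i; rewrite xrowEsub row_rowsub !rowK !nth_cat.
  case: tpermP => [->|->|/eqP n1 /eqP n2] /=.
  - by rewrite ltnn subnn ltnNge leqnSn subSnn.
  - by rewrite ltnn subnn ltnNge leqnSn subSnn.
  case: ltnP => // ge1.
  have: i != size s1 :> nat by [].
  have: i != (size s1).+1 :> nat by [].
  by case E : (i - _)%N => [|[|j]] //=; lia.
rewrite xrowE det_mulmx det_perm odd_tperm.
have -> : Ordinal lt1 != Ordinal lt2 by rewrite -val_eqE /=; lia.
by rewrite mulN1r.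
Qed.

Lemma row_det_move s1 s2 s3 v : size (s1 ++ v :: s2 ++ s3) = k ->
  row_det (s1 ++ v :: s2 ++ s3) =
  (-1) ^+ size s2 * row_det (s1 ++ s2 ++ v :: s3).
Proof.
elim: s2 s1 => [|w s2 IH] s1 sz /=; first by rewrite mul1r.
rewrite row_det_swap // -cat_rcons IH.
  by rewrite cat_rcons exprS mulN1r mulNr.
by move: sz; rewrite !size_cat size_rcons /=; lia.
Qed.

Lemma row_det_dup s i j : (i < j < k)%N -> nth 0 s i = nth 0 s j ->
  row_det s = 0.
Proof.
move=> /andP[lt1 lt2] eq_ij.
have lti : (i < k)%N by lia.
apply: (@determinant_alternate _ _ _ (Ordinal lti) (Ordinal lt2)).
  by rewrite -val_eqE /=; lia.
by move=> l; rewrite !mxE /= eq_ij.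
Qed.

End RowDet.

(** * Increasing enumerations and the exchange of one element *)

Section OrdSets.
Variable N : nat.
Implicit Types (J : {set 'I_N}) (s : seq 'I_N).

Definition ord_lt (x y : 'I_N) : bool := (x < y)%N.

Lemma ord_lt_trans : transitive ord_lt.
Proof. by move=> y x z; apply: ltn_trans. Qed.

Lemma ord_lt_irr : irreflexive ord_lt.
Proof. by move=> x; rewrite /ord_lt ltnn. Qed.

Lemma sorted_filter_enum (P : pred 'I_N) : sorted ord_lt [seq x <- enum 'I_N | P x].
Proof.
apply: sorted_filter; first exact: ord_lt_trans.
have := iota_ltn_sorted 0 N; rewrite -val_enum_ord sorted_map; exact.
Qed.

Lemma sorted_enum_set J : sorted ord_lt (enum J).
Proof. by rewrite /enum_mem -enumT; exact: sorted_filter_enum. Qed.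

Lemma eq_sorted_enum J s : sorted ord_lt s -> s =i J -> enum J = s.
Proof.
move=> srt eqi; apply: irr_sorted_eq ord_lt_trans ord_lt_irr _ _ _ srt _.
  exact: sorted_enum_set.
by move=> x; rewrite mem_enum eqi.
Qed.

Definition btw (c e : 'I_N) : pred 'I_N :=
  fun x => (minn c e < x < maxn c e)%N.

Lemma sorted_cat_lt s1 s2 : sorted ord_lt s1 -> sorted ord_lt s2 ->
  (forall x y, x \in s1 -> y \in s2 -> (x < y)%N) -> sorted ord_lt (s1 ++ s2).
Proof.
rewrite !sorted_pairwise; try exact: ord_lt_trans.
move=> h1 h2 h; rewrite pairwise_cat h1 h2 !andbT.
by apply/allrelP => x y; apply: h.
Qed.

Let flt (P : pred 'I_N) := [seq x <- enum 'I_N | P x].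

(** When [e] takes the place of [c] in the list, it must cross the block [s2] of elements strictly
    between them to reach its sorted position. The length of [s2] gives the sign of the exchange. *)
Lemma enum_exchange J c e : c \in J -> e \notin J ->
  exists s1 s2 s3, size s2 = #|[set x in J | btw c e x]| /\
    ((enum J = s1 ++ c :: s2 ++ s3 /\ enum (e |: J :\ c) = s1 ++ s2 ++ e :: s3) \/
     (enum J = s1 ++ s2 ++ c :: s3 /\ enum (e |: J :\ c) = s1 ++ e :: s2 ++ s3)).
Proof.
move=> cJ eJ; have ne : c != e by apply: contraNneq eJ => <-.
pose lo := minn c e; pose hi := maxn c e.
pose s1 := flt (fun x => (x \in J) && (x < lo)%N).
pose s2 := flt (fun x => (x \in J) && btw c e x).
pose s3 := flt (fun x => (x \in J) && (hi < x)%N).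
have in1 x : (x \in s1) = (x \in J) && (x < lo)%N by rewrite mem_filter mem_enum andbT.
have in2 x : (x \in s2) = (x \in J) && (lo < x < hi)%N by rewrite mem_filter mem_enum andbT.
have in3 x : (x \in s3) = (x \in J) && (hi < x)%N by rewrite mem_filter mem_enum andbT.
have so1 : sorted ord_lt s1 by exact: sorted_filter_enum.
have so2 : sorted ord_lt s2 by exact: sorted_filter_enum.
have so3 : sorted ord_lt s3 by exact: sorted_filter_enum.
have neN : (c : nat) <> e by move=> h; case/eqP: ne; apply: val_inj.
have eqI (x y : 'I_N) : (x == y) = (x == y :> nat) by [].
have srt1 (x : 'I_N) : sorted ord_lt [:: x] by [].
have cE (x : 'I_N) : x = c :> nat -> x \in J by move/val_inj ->.
have eE (x : 'I_N) : x = e :> nat -> x \notin J by move/val_inj ->.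
exists s1, s2, s3; split.
  rewrite cardE /s2 /flt; congr size; apply: irr_sorted_eq ord_lt_trans ord_lt_irr _ _ _ _ _.
  - exact: sorted_filter_enum.
  - exact: sorted_enum_set.
  by move=> x; rewrite mem_filter !mem_enum !inE andbT.
have [ltH|ltH|//] := ltngtP c e; [left | right].
- have [loE hiE] : lo = c /\ hi = e by rewrite /lo /hi; lia.
  rewrite {}loE {}hiE in in1 in2 in3 *.
  split; apply: eq_sorted_enum.
  + rewrite -cat1s; repeat first [done | apply: sorted_cat_lt];
      move=> x y; rewrite ?(mem_cat, inE) ?in1 ?in2 ?in3 ?eqI; clear - ltH; lia.
  + move=> x; rewrite !(mem_cat, inE) in1 in2 in3 !eqI.
    move: (cE x) (eE x); case: (x \in J) => /= hc he; clear - ltH neN hc he; lia.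
  + rewrite -cat1s; repeat first [done | apply: sorted_cat_lt];
      move=> x y; rewrite ?(mem_cat, inE) ?in1 ?in2 ?in3 ?eqI; clear - ltH; lia.
  + move=> x; rewrite !(mem_cat, inE) in1 in2 in3 !eqI.
    move: (cE x) (eE x); case: (x \in J) => /= hc he; clear - ltH neN hc he; lia.
- have [loE hiE] : lo = e /\ hi = c by rewrite /lo /hi; lia.
  rewrite {}loE {}hiE in in1 in2 in3 *.
  split; apply: eq_sorted_enum.
  + rewrite -cat1s; repeat first [done | apply: sorted_cat_lt];
      move=> x y; rewrite ?(mem_cat, inE) ?in1 ?in2 ?in3 ?eqI; clear - ltH; lia.
  + move=> x; rewrite !(mem_cat, inE) in1 in2 in3 !eqI.
    move: (cE x) (eE x); case: (x \in J) => /= hc he; clear - ltH neN hc he; lia.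
  + rewrite -cat1s; repeat first [done | apply: sorted_cat_lt];
      move=> x y; rewrite ?(mem_cat, inE) ?in1 ?in2 ?in3 ?eqI; clear - ltH; lia.
  + move=> x; rewrite !(mem_cat, inE) in1 in2 in3 !eqI.
    move: (cE x) (eE x); case: (x \in J) => /= hc he; clear - ltH neN hc he; lia.
Qed.

End OrdSets.

(** * Maximal minors, multilinearity and basis exchange *)

Section Plucker.
Variables (N k : nat).

Section Ring.
Variable R : comNzRingType.
Implicit Types (f : 'I_N -> 'rV[R]_k) (J : {set 'I_N}) (c e : 'I_N).

(** A maximal minor when [#|J| = k]; for other sizes the list is cut off or padded by zero rows and
    the value has no meaning. *)
Definition plucker f J : R := row_det [seq f x | x <- enum J].

Definition upd f c (w : 'rV[R]_k) : 'I_N -> 'rV[R]_k :=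
  fun x => if x == c then w else f x.

Lemma eq_plucker f f' J : {in J, f =1 f'} -> plucker f J = plucker f' J.
Proof.
move=> eqf; congr row_det; apply/eq_in_map => x.
by rewrite mem_enum; apply: eqf.
Qed.

Lemma plucker_upd_notin f c w J : c \notin J -> plucker (upd f c w) J = plucker f J.
Proof.
by move=> cJ; apply: eq_plucker => x xJ; rewrite /upd; case: eqP xJ cJ => // -> ->.
Qed.

Lemma plucker_upd_id f c J : plucker (upd f c (f c)) J = plucker f J.
Proof. by apply: eq_plucker => x _; rewrite /upd; case: eqP => // ->. Qed.


Lemma plucker_updE f J c : c \in J -> exists s1 s2,
  (forall w, plucker (upd f c w) J = row_det (s1 ++ w :: s2)) /\
  (forall w, size (s1 ++ w :: s2) = #|J|).
Proof.
move=> cJ; move: (cJ) (enum_uniq J) (cardE J); rewrite -mem_enum /plucker.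
move: (enum J) => s cs uniqs szs.
case/splitPr: cs uniqs szs => s1 s2.
rewrite cat_uniq /= negb_or => /and3P[_ /andP[c1 _] /andP[c2 _]] sz.
have upd_map w (t : seq 'I_N) : c \notin t -> [seq upd f c w x | x <- t] = map f t.
  move=> ct; apply/eq_in_map => x xt; rewrite /upd.
  by case: eqP xt ct => // -> ->.
exists (map f s1), (map f s2); split => w.
  by rewrite map_cat /= !upd_map // {1}/upd eqxx.
by rewrite sz !size_cat /= !size_map.
Qed.

Section Basis.
Variables (f : 'I_N -> 'rV[R]_k) (J : {set 'I_N}) (c : 'I_N).
Hypotheses (cardJ : #|J| = k) (cJ : c \in J).

Lemma plucker_upd_linear a v w :
  plucker (upd f c (a *: v + w)) J = a * plucker (upd f c v) J + plucker (upd f c w) J.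
Proof.
have [s1 [s2 [E sz]]] := plucker_updE f cJ.
by rewrite !E row_det_linear // sz.
Qed.

Lemma plucker_upd0 : plucker (upd f c 0) J = 0.
Proof.
have := plucker_upd_linear 1 0 0; rewrite scaler0 addr0 mul1r.
by move/(congr1 (fun x => x - plucker (upd f c 0) J)); rewrite subrr addrK.
Qed.

Lemma plucker_updZ a v : plucker (upd f c (a *: v)) J = a * plucker (upd f c v) J.
Proof. by rewrite -[a *: v]addr0 plucker_upd_linear plucker_upd0 addr0. Qed.

Lemma plucker_updD v w :
  plucker (upd f c (v + w)) J = plucker (upd f c v) J + plucker (upd f c w) J.
Proof. by rewrite -{1}[v]scale1r plucker_upd_linear mul1r. Qed.

Lemma plucker_upd_sum (P : pred 'I_N) (g : 'I_N -> R) :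
  plucker (upd f c (\sum_(y | P y) g y *: f y)) J =
  \sum_(y | P y) g y * plucker (upd f c (f y)) J.
Proof.
elim/big_ind2: _ => [|v a w b <- <-|y _]; [exact: plucker_upd0 | exact: plucker_updD |].
exact: plucker_updZ.
Qed.

Lemma plucker_upd_dup b : b \in J -> b != c -> plucker (upd f c (f b)) J = 0.
Proof.
move=> bJ bc; rewrite /plucker; set g := upd _ _ _.
have gE : g b = g c by rewrite /g /upd eqxx (negPf bc).
have [bE cE] : b \in enum J /\ c \in enum J by rewrite !mem_enum.
have nthE x : x \in enum J -> nth 0 (map g (enum J)) (index x (enum J)) = g x.
  by move=> xE; rewrite (nth_map c) ?index_mem // nth_index.
have lti x : x \in enum J -> (index x (enum J) < k)%N.
  by move=> xE; rewrite -[X in (_ < X)%N]cardJ cardE index_mem.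
have : index b (enum J) != index c (enum J).
  by apply: contraNneq bc => eqi; rewrite -(nth_index c bE) eqi nth_index.
rewrite neq_ltn => /orP[lt|lt].
  by apply: (@row_det_dup _ _ _ (index b (enum J)) (index c (enum J))); rewrite ?lt ?lti ?nthE //.
by apply: (@row_det_dup _ _ _ (index c (enum J)) (index b (enum J))); rewrite ?lt ?lti ?nthE //.
Qed.

Lemma plucker_exchange e : e \notin J ->
  plucker (upd f c (f e)) J =
  (-1) ^+ #|[set x in J | btw c e x]| * plucker f (e |: J :\ c).
Proof.
move=> eJ; have [s1 [s2 [s3 [<- cases]]]] := enum_exchange cJ eJ.
have szJ := cardE J; rewrite cardJ in szJ.
have uq := enum_uniq J; rewrite /plucker.
have upd_map w (t : seq 'I_N) : c \notin t -> [seq upd f c w x | x <- t] = map f t.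
  move=> ct; apply/eq_in_map => x xt; rewrite /upd.
  by case: eqP xt ct => // -> ->.
case: cases => [[E1 E2]|[E1 E2]]; move: uq szJ; rewrite E1 E2 !map_cat /= !map_cat.
  rewrite cat_uniq /= mem_cat !negb_or => /and3P[_ /andP[c1 _] /andP[/andP[c2 c3] _]] sz.
  rewrite !upd_map // {1}/upd eqxx row_det_move ?size_map //.
  by move: sz; rewrite !size_cat /= !size_cat !size_map.
rewrite catA cat_uniq /= mem_cat !negb_or => /and3P[_ /andP[/andP[c1 c2] _] /andP[c3 _]] sz.
rewrite !upd_map // {1}/upd eqxx row_det_move ?size_map //.
  by rewrite mulrA -exprD addnn -mul2n exprM sqrrN !expr1n mul1r.
by move: sz; rewrite !size_cat /= !size_cat !size_map; lia.
Qed.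

End Basis.
End Ring.

Section Field.
Variable R : fieldType.
Implicit Types (f : 'I_N -> 'rV[R]_k) (J : {set 'I_N}).

Lemma basis_coef f J w : #|J| = k -> plucker f J != 0 ->
  exists g : 'I_N -> R, w = \sum_(c in J) g c *: f c.
Proof.
move=> cardJ; rewrite /plucker /row_det; set A := \matrix_(i < k) _ => detA.
have unitA : A \in unitmx by rewrite unitmxE unitfE.
have szE : size (enum J) = k by rewrite -cardE.
pose u := w *m invmx A.
(* The sum has a single term, the coordinate of [u] at the position of [c] in [enum J]; for [c]
   outside [J] it is empty. *)
exists (fun c => \sum_(i < k | i == index c (enum J) :> nat) u 0 i).
have -> : w = \sum_(i < k) u 0 i *: row i A by rewrite -mulmx_sum_row mulmxKV.
rewrite -[RHS]big_enum /=.
have idx_ltn c : c \in enum J -> (index c (enum J) < k)%N.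
  by rewrite -index_mem szE.
rewrite [RHS](eq_bigr (fun c => \sum_(i < k | i == index c (enum J) :> nat) u 0 i *: f c)); last first.
  by move=> c _; rewrite scaler_suml.
rewrite (exchange_big_dep predT) //=; apply: eq_bigr => i _.
have lti : (i < size (enum J))%N by rewrite szE.
pose c0 := nth (enum_val (cast_ord (esym cardJ) i)) (enum J) i.
have c0in : c0 \in enum J by rewrite mem_nth.
rewrite big_mkcond (bigD1_seq c0) ?enum_uniq //= big1_seq ?addr0.
  by rewrite index_uniq ?enum_uniq // eqxx rowK (nth_map (enum_val (cast_ord (esym cardJ) i))).
move=> c /andP[ne cin]; case: eqP => // iE.
by rewrite /c0 iE nth_index // eqxx in ne.
Qed.
End Field.
End Plucker.

(** * Bridge decomposition of matrices with nonnegative maximal minors *)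

Section Bridge.
Variables (R : realFieldType) (N k : nat).
Implicit Types (f : 'I_N -> 'rV[R]_k) (J : {set 'I_N}) (x y u v c : 'I_N).

Lemma card_exchange u v J : u \in J -> v \notin J -> #|v |: J :\ u| = #|J|.
Proof.
move=> uJ vJ; rewrite cardsU1 (cardsD1 u J) uJ.
by rewrite !inE (negPf vJ) andbF.
Qed.

Definition basis f J : bool := (#|J| == k) && (plucker f J != 0).

Definition plucker_ge0 f : Prop := forall J, #|J| = k -> 0 <= plucker f J.

(** In the matroid of the bases of [f], a frozen [x] is a loop or a coloop. *)
Definition frozen f x : bool :=
  [forall J1, forall J2, basis f J1 ==> basis f J2 ==> ((x \in J1) == (x \in J2))].

Lemma frozenP f x J1 J2 : frozen f x -> basis f J1 -> basis f J2 ->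
  (x \in J1) = (x \in J2).
Proof. by move=> /forallP/(_ J1)/forallP/(_ J2)/implyP h /h/implyP h' /h'/eqP. Qed.

Lemma not_frozen f x J1 J2 : basis f J1 -> basis f J2 -> x \in J1 -> x \notin J2 ->
  ~~ frozen f x.
Proof. by move=> b1 b2 x1; apply: contra => fr; rewrite -(frozenP fr b1 b2). Qed.

Lemma not_frozenP f x : ~~ frozen f x ->
  (exists2 J, basis f J & x \in J) /\ (exists2 J, basis f J & x \notin J).
Proof.
rewrite negb_forall => /existsP[J1]; rewrite negb_forall => /existsP[J2].
rewrite !negb_imply => /and3P[b1 b2].
by case: (boolP (x \in J1)) (boolP (x \in J2)) => x1 [] x2 //= _; split;
  [exists J1 | exists J2 | exists J2 | exists J1].
Qed.

(** Cramer's rule: replacing row [c] by the expansion of [f e] leaves only the term of [c], since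
    every other term repeats a row of [J]. *)
Lemma plucker_exchange_coef f J e (g : 'I_N -> R) c : #|J| = k -> e \notin J ->
  f e = \sum_(y in J) g y *: f y -> c \in J ->
  plucker f (e |: J :\ c) = (-1) ^+ #|[set x in J | btw c e x]| * (g c * plucker f J).
Proof.
move=> cardJ eJ fe cJ; have := plucker_exchange f cardJ cJ eJ.
rewrite fe plucker_upd_sum // (bigD1 c) //= plucker_upd_id big1 ?addr0 => [->|y /andP[yJ yc]].
  by rewrite mulrA -exprD addnn -mul2n exprM sqrrN !expr1n mul1r.
by rewrite plucker_upd_dup ?mulr0.
Qed.

Lemma coef_not_frozen f J e (g : 'I_N -> R) c : basis f J -> e \notin J ->
  f e = \sum_(y in J) g y *: f y -> c \in J -> g c != 0 ->
  basis f (e |: J :\ c) /\ ~~ frozen f c.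
Proof.
move=> bJ eJ fe cJ gc; case/andP: (bJ) => /eqP cardJ plJ.
have b' : basis f (e |: J :\ c).
  rewrite /basis card_exchange // cardJ eqxx (plucker_exchange_coef cardJ eJ fe cJ).
  by rewrite !mulf_neq0 // signr_eq0.
split=> //; apply: (not_frozen bJ b' cJ).
by rewrite !inE eqxx orbF; apply: contraNneq eJ => <-.
Qed.

Let dep f (i : 'I_N) (j : nat) : Prop :=
  exists g : 'I_N -> R, f i = \sum_(y : 'I_N | (i < y <= j)%N) g y *: f y.

(** Take the smallest row [u] that is not frozen and a basis avoiding it. The basis rows with
    nonzero coefficient in [f u] can be exchanged, so they are not frozen and come after [u]. *)
Lemma dep_exists f u0 : ~~ frozen f u0 -> exists2 u, ~~ frozen f u & dep f u N.
Proof.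
move=> nf0; pose u := [arg min_(x < u0 | ~~ frozen f x) (x : nat)].
have [nfu minu] : ~~ frozen f u /\ forall x, ~~ frozen f x -> (u <= x)%N.
  by rewrite /u; case: arg_minnP.
exists u => //; have [_ [J bJ uJ]] := not_frozenP nfu.
case/andP: (bJ) => /eqP cardJ plJ.
have [g fu] := basis_coef (f u) cardJ plJ.
exists (fun y => if y \in J then g y else 0); rewrite fu.
rewrite big_mkcond [RHS]big_mkcond /=; apply: eq_bigr => y _.
case: ifP => yJ; last by rewrite scale0r; case: ifP.
have [->|gy] := eqVneq (g y) 0; first by rewrite scale0r; case: ifP.
have [_ nfy] := coef_not_frozen bJ uJ fu yJ gy.
have lt : (u < y <= N)%N.
  rewrite (ltnW (ltn_ord y)) andbT ltn_neqAle minu // andbT.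
  by apply: contraNneq uJ => /val_inj ->.
by rewrite lt.
Qed.

(* Some row in the dependency of [u] leaves the hyperplane spanned by [J :\ u]. *)
Lemma dep_exchange f u j J : dep f u j -> basis f J -> u \in J ->
  exists l : 'I_N, [/\ (u < l <= j)%N, l \notin J & basis f (l |: J :\ u)].
Proof.
move=> [g fu] bJ uJ; case/andP: (bJ) => /eqP cardJ plJ.
have := plucker_upd_id f u J; rewrite {1}fu plucker_upd_sum // => sumE.
have [y ytst ynz] : exists2 y : 'I_N, (u < y <= j)%N & plucker (upd f u (f y)) J != 0.
  apply/exists_inP; apply: contraNT plJ; rewrite negb_exists_in => /forall_inP h.
  rewrite -sumE big1 // => y /h; rewrite negbK => /eqP ->; exact: mulr0.
have yJ : y \notin J.
  apply: contraNN ynz => yJ; rewrite plucker_upd_dup //.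
  by apply: contraTneq ytst => ->; rewrite ltnn.
exists y; split=> //; rewrite /basis card_exchange // cardJ eqxx /=.
by apply: contraNneq ynz => pl0; rewrite plucker_exchange // pl0 mulr0.
Qed.

(** Serves to compare the signs of exchanging [c] for [v] in two bases that differ by one exchange.
    It is stated with sums to avoid truncated subtraction. *)
Lemma btw_parity J u l c v : u \in J -> l \notin J ->
  (#|[set x in J | btw c v x]| + btw c v l =
  #|[set x in l |: J :\ u | btw c v x]| + btw c v u)%N.
Proof.
move=> uJ lJ; have ne : l != u by apply: contraNneq lJ => ->.
have -> : [set x in J | btw c v x] =
   [set x in J :\ u | btw c v x] :|: (if btw c v u then [set u] else set0).
  apply/setP => x; rewrite !inE; have [->|] := eqVneq x u.
    by rewrite uJ; case: ifP => h; rewrite !inE // eqxx.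
  by case: ifP => h n; rewrite !inE ?(negPf n) orbF.
have -> : [set x in l |: J :\ u | btw c v x] =
   [set x in J :\ u | btw c v x] :|: (if btw c v l then [set l] else set0).
  apply/setP => x; rewrite !inE; have [->|] := eqVneq x l.
    by rewrite (negPf lJ) andbF; case: ifP => h; rewrite !inE // eqxx.
  by case: ifP => h n; rewrite !inE ?(negPf n) orbF.
have cardU1 (P : bool) (z : 'I_N) (A : {set 'I_N}) : z \notin A ->
    #|A :|: (if P then [set z] else set0)| = (#|A| + P)%N.
  by case: P => zA; rewrite ?setU0 ?addn0 // setUC cardsU1 zA addnC.
rewrite !cardU1; first by rewrite addnAC.
  by rewrite !inE (negPf lJ) andbF.
by rewrite !inE eqxx.
Qed.

(* [u] starts a shortest dependency among consecutive rows and [v] is the next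
   row that is not frozen.  If the exchange failed for [J], row [v] would be a
   combination of rows of [J :\ u]; comparing the signs of the exchanges of [v]
   into [J] and into [l |: J :\ u] confines these rows to ]v, l[, which is a
   shorter dependency. *)
Lemma bridge_exists f u0 : plucker_ge0 f -> ~~ frozen f u0 -> exists u v,
  [/\ (u < v)%N, ~~ frozen f u /\ ~~ frozen f v,
      forall x, (u < x < v)%N -> frozen f x &
      forall J, basis f J -> u \in J -> v \notin J -> basis f (v |: J :\ u)].
Proof.
move=> f_ge0 /dep_exists[u nfu depu].
have : exists d (i : 'I_N) j, [/\ (j - i <= d)%N, ~~ frozen f i & dep f i j].
  by exists N, u, N; rewrite leq_subr.
case=> d; elim/ltn_ind: d {u nfu depu} => d IH [u [j [dle nfu depu]]].
have [[J0 bJ0 uJ0] _] := not_frozenP nfu.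
have [y0 [lty0 y0J bJ0']] := dep_exchange depu bJ0 uJ0.
have nfy0 : ~~ frozen f y0 by apply: not_frozen bJ0' bJ0 _ y0J; rewrite !inE eqxx.
pose v := [arg min_(x < y0 | ~~ frozen f x && (u < x)%N) (x : nat)].
have [nfv ltuv minv] : [/\ ~~ frozen f v, (u < v)%N &
    forall x, ~~ frozen f x -> (u < x)%N -> (v <= x)%N].
  rewrite /v; case: arg_minnP => [|i /andP[nfi lti] h]; first by rewrite nfy0; case/andP: lty0.
  by split=> // x nfx ltx; apply: h; rewrite nfx.
have btw_frozen x : (u < x < v)%N -> frozen f x.
  by case/andP=> ux; apply: contraLR => nfx; rewrite -leqNgt; exact: minv.
case: (pickP [pred J | [&& basis f J, u \in J, v \notin J & ~~ basis f (v |: J :\ u)]]);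
  last first.
  move=> none; exists u, v; split=> // J bJ uJ vJ.
  by have /= := none J; rewrite bJ uJ vJ /= => /negbT; rewrite negbK.
move=> J /and4P[bJ uJ vJ nb]; case/andP: (bJ) => /eqP cardJ plJ.
have [l [/andP[ltul lelj] lJ bJl]] := dep_exchange depu bJ uJ.
have nfl : ~~ frozen f l by apply: not_frozen bJl bJ _ lJ; rewrite !inE eqxx.
have ltvl : (v < l)%N.
  by rewrite ltn_neqAle minv // andbT; apply: contraNneq nb => /val_inj ->.
have [g fv] := basis_coef (f v) cardJ plJ.
have gu : g u = 0.
  by apply/eqP; apply: contraNT nb => gu; case: (coef_not_frozen bJ vJ fv uJ gu).
have [cardJl plJl] : #|l |: J :\ u| = k /\ plucker f (l |: J :\ u) != 0.
  by case/andP: bJl => /eqP.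
have vJl : v \notin l |: J :\ u.
  by rewrite !inE (negPf vJ) andbF orbF; apply: contraTneq ltvl => ->; rewrite ltnn.
pose g' c := if c == l then 0 else g c.
have fv' : f v = \sum_(y in l |: J :\ u) g' y *: f y.
  rewrite fv big_setU1 /=; last by rewrite !inE (negPf lJ) andbF.
  rewrite (big_setD1 u) //= gu /g' eqxx !scale0r; congr (_ + _).
  apply: eq_bigr => y; rewrite !inE => /andP[_ yJ].
  by case: eqP yJ lJ => // -> ->.
have supp c : c \in J -> g c != 0 -> (v < c < l)%N.
  move=> cJ gc; have cu : c != u by apply: contraNneq gc => ->; rewrite gu.
  have cl : c != l by apply: contraNneq lJ => <-.
  have [bJc nfc] := coef_not_frozen bJ vJ fv cJ gc.
  have cv : c != v by apply: contraNneq vJ => <-.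
  have cJl : c \in l |: J :\ u by rewrite !inE cu cJ orbT.
  have E1 := plucker_exchange_coef cardJ vJ fv cJ.
  have E2 := plucker_exchange_coef cardJl vJl fv' cJl.
  rewrite /g' (negPf cl) in E2.
  have p1 : 0 < plucker f J by rewrite lt_neqAle eq_sym plJ f_ge0.
  have p2 : 0 < plucker f (l |: J :\ u) by rewrite lt_neqAle eq_sym plJl f_ge0.
  have : 0 <= (-1) ^+ #|[set x in J | btw c v x]| * g c.
    by rewrite -(pmulr_lge0 _ p1) -mulrA -E1 f_ge0 // card_exchange.
  have : 0 <= (-1) ^+ #|[set x in l |: J :\ u | btw c v x]| * g c.
    by rewrite -(pmulr_lge0 _ p2) -mulrA -E2 f_ge0 // card_exchange.
  have := btw_parity c v uJ lJ.
  set n1 := #|[set x in J | _]|; set n2 := #|[set x in _ | btw c v x]|.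
  move: n1 n2 => n1 n2 par s2 s1.
  (* As [u < v < l], the left side says that [c] is beyond [l] and the right side that [c] is before
     [u]. Equality makes both fail, so [c] lies between [u] and [l], and it cannot lie between [u]
     and [v] because those rows are frozen. *)
  have : btw c v l = btw c v u.
    have odds : odd n1 = odd n2.
      apply/eqP; apply: contraNT gc => ne.
      move: s1 s2; rewrite -signr_odd -[(-1) ^+ n2]signr_odd.
      case: (odd n1) (odd n2) ne => [] [] //= _; rewrite /= ?expr0 ?expr1 ?mulN1r ?mul1r ?oppr_ge0 => h1 h2;
        by rewrite eq_le h1 h2.
    by move/(congr1 odd): par; rewrite !oddD odds => /addbI; rewrite !oddb.
  have cuN : (c != u :> nat) by [].
  have clN : (c != l :> nat) by [].
  have cvN : (c != v :> nat) by [].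
  have nuv : ~~ (u < c < v)%N by apply: contraNN nfc; exact: btw_frozen.
  rewrite /btw; clear - cuN clN cvN nuv ltuv ltvl ltul; lia.
apply: (IH (l.-1 - v)%N); first by clear - ltuv ltvl lelj dle; lia.
exists v, l.-1; split=> //; exists (fun y => if y \in J then g y else 0); rewrite fv.
rewrite big_mkcond [RHS]big_mkcond /=; apply: eq_bigr => y _.
case: ifP => yJ; last by rewrite scale0r; case: ifP.
have [->|gy] := eqVneq (g y) 0; first by rewrite scale0r; case: ifP.
have := supp _ yJ gy; case: ifP => //; clear; lia.
Qed.

Lemma exchange_back u v J : u \notin J -> v \in J -> v |: (u |: J :\ v) :\ u = J.
Proof.
move=> uJ vJ; apply/setP => x; rewrite !inE.
have [->|xv] /= := eqVneq x v; first by rewrite vJ.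
by have [->|xu] := eqVneq x u; rewrite //= (negPf uJ).
Qed.

(** If a basis avoiding [v] also misses [u], then [u] can be exchanged in: [f u] is nonzero because
    [u] lies in some basis, so it has a nonzero coefficient. *)
Lemma bridge_basis_exists f u v : u != v -> ~~ frozen f u -> ~~ frozen f v ->
  exists J, [/\ basis f J, u \in J & v \notin J].
Proof.
move=> nuv /not_frozenP[[J1 bJ1 uJ1] _] /not_frozenP[_ [J bJ vJ]].
have [uJ|uJ] := boolP (u \in J); first by exists J.
case/andP: (bJ) => /eqP cardJ plJ; case/andP: bJ1 => /eqP cardJ1 plJ1.
have [g fu] := basis_coef (f u) cardJ plJ.
have [c cJ gc] : exists2 c, c \in J & g c != 0.
  apply/exists_inP; apply: contraNT plJ1; rewrite negb_exists_in => /forall_inP h.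
  rewrite -(plucker_upd_id f u) fu big1 ?plucker_upd0 // => y /h.
  by rewrite negbK => /eqP ->; rewrite scale0r.
have [bJc _] := coef_not_frozen bJ uJ fu cJ gc.
exists (u |: J :\ c); split=> //; rewrite !inE ?eqxx //.
by rewrite (negPf vJ) andbF orbF eq_sym.
Qed.

(** The bridge subtracts a signed multiple of row [u] from row [v]. The conclusion recovers [f] from
    [f'] with a coefficient [a >= 0], the direction in which nonnegative combinations of matching
    indicators are preserved. *)
Lemma bridge_step f u0 : plucker_ge0 f -> ~~ frozen f u0 ->
  exists f' u v a,
  [/\ (u < v)%N /\ 0 <= a, ~~ frozen f u /\ ~~ frozen f v,
      forall x, (u < x < v)%N -> frozen f x,
      plucker_ge0 f' /\ (forall x, frozen f x -> frozen f' x) &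
      (#|[set J | basis f' J]| < #|[set J | basis f J]|)%N /\
      forall J, #|J| = k -> plucker f J =
       plucker f' J + a * ((replaceable v u J)%:R * plucker f' (replace v u J))].
Proof.
move=> f_ge0 nfu0.
have [u [v [ltuv [nfu nfv] frz unstuck]]] := bridge_exists f_ge0 nfu0.
have nuv : u != v by apply: contraTneq ltuv => ->; rewrite ltnn.
have [K0 [bK0 uK0 vK0]] := bridge_basis_exists nuv nfu nfv.
(* The exchange of [v] for [u] crosses only frozen rows, so its sign is the same for all bases and
   may be read off [K0]. *)
pose sg : R := (-1) ^+ #|[set x in K0 | btw v u x]|.
pose cand J := [&& v \in J, u \notin J & basis f (u |: J :\ v)].
pose ratio J := plucker f J / plucker f (u |: J :\ v).
have candK0 : cand (v |: K0 :\ u).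
  by rewrite /cand !inE !eqxx (negPf nuv) /= exchange_back.
pose Jm := [arg min_(J < v |: K0 :\ u | cand J) ratio J]%O.
have [candm minm] : cand Jm /\ forall J, cand J -> ratio Jm <= ratio J.
  by rewrite /Jm; case: arg_minP.
(* Here [unstuck] is used: the numerator of each ratio is nonzero, so the minimizing set is a basis
   of [f], and [f'] loses it. *)
have cand_basis J : cand J -> basis f J.
  case/and3P=> vJ uJ bK; rewrite -(exchange_back uJ vJ); apply: unstuck => //.
    by rewrite !inE eqxx.
  by rewrite !inE eqxx orbF eq_sym.
have basis_gt0 J : basis f J -> 0 < plucker f J.
  by case/andP=> /eqP cJ pJ; rewrite lt_neqAle eq_sym pJ f_ge0.
pose a := ratio Jm.
have a_ge0 : 0 <= a.
  apply: divr_ge0; apply/ltW/basis_gt0; first exact: cand_basis.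
  by case/and3P: candm.
pose f' := upd f v (- (sg * a) *: f u + f v).
have f'E J : #|J| = k -> plucker f' J = plucker f J -
    a * ((replaceable v u J)%:R * plucker f (u |: J :\ v)).
  move=> cardJ; rewrite /replaceable.
  have [vJ|vJ] /= := boolP (v \in J); last first.
    by rewrite mul0r mulr0 subr0 plucker_upd_notin.
  rewrite plucker_upd_linear // plucker_upd_id addrC; congr (_ + _).
  have [uJ|uJ] /= := boolP (u \in J).
    by rewrite plucker_upd_dup // mul0r !mulr0 oppr0.
  rewrite mul1r plucker_exchange // mulNr; congr (- _).
  have [->|plK] := eqVneq (plucker f (u |: J :\ v)) 0; first by rewrite !mulr0.
  have bK : basis f (u |: J :\ v) by rewrite /basis card_exchange // cardJ eqxx.
  have -> : [set x in J | btw v u x] = [set x in K0 | btw v u x].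
    apply/setP => x; rewrite !inE; case bx: (btw v u x); rewrite ?andbF ?andbT //.
    have lt : (u < x < v)%N by move: bx; rewrite /btw; clear - ltuv; lia.
    rewrite -(frozenP (frz x lt) bK bK0) !inE.
    have -> : x == u = false by apply: contraTF lt => /eqP ->; rewrite ltnn.
    by have -> : x == v = false by apply: contraTF lt => /eqP ->; rewrite ltnn andbF.
  by rewrite -/sg mulrACA mulrA -expr2 /sg -exprM mulnC exprM sqrrN !expr1n mul1r.
have f'_ge0 : plucker_ge0 f'.
  move=> J cardJ; rewrite f'E //.
  have [/andP[vJ uJ]|_] := boolP (replaceable v u J); last first.
    by rewrite mul0r mulr0 subr0 f_ge0.
  rewrite mul1r; have [->|plK] := eqVneq (plucker f (u |: J :\ v)) 0.
    by rewrite mulr0 subr0 f_ge0.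
  have bK : basis f (u |: J :\ v) by rewrite /basis card_exchange // cardJ eqxx.
  rewrite subr_ge0 -ler_pdivlMr ?basis_gt0 //; apply: minm.
  by rewrite /cand vJ uJ.
have stepE J : #|J| = k -> plucker f J =
    plucker f' J + a * ((replaceable v u J)%:R * plucker f' (replace v u J)).
  move=> cardJ; rewrite f'E // /replace.
  have [/andP[vJ uJ]|_] := boolP (replaceable v u J); last first.
    by rewrite !mul0r mulr0 subr0 addr0.
  rewrite [plucker f' _]plucker_upd_notin ?subrK //.
  by rewrite !inE eqxx orbF eq_sym.
have sub J : basis f' J -> basis f J.
  case/andP=> /eqP cardJ pJ; rewrite /basis cardJ eqxx /= stepE //.
  have p1 : 0 < plucker f' J by rewrite lt_neqAle eq_sym pJ f'_ge0.
  rewrite gt_eqF // ltr_wpDr // mulr_ge0 // mulr_ge0 // /replace.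
  case: ifP => [/andP[vJ uJ]|_]; last by rewrite f'_ge0.
  by rewrite f'_ge0 // card_exchange.
exists f', u, v, a; split=> //; split=> //.
  move=> x fr; apply/forallP => J1; apply/forallP => J2; apply/implyP => /sub b1.
  by apply/implyP => /sub b2; rewrite (frozenP fr b1 b2).
apply: proper_card; apply/properP; split.
  by apply/subsetP => J; rewrite !inE; exact: sub.
exists Jm; rewrite !inE; first exact: cand_basis.
have bm := cand_basis _ candm; case/andP: bm => /eqP cm _.
case/and3P: (candm) => vm um bKm.
rewrite /basis cm eqxx negbK f'E // /replaceable vm um mul1r /a /ratio divfK ?subrr //.
by case/andP: bKm.
Qed.

End Bridge.

(** * Noncrossing matchings *)

Section Matchings.
Variable N : nat.
Implicit Types (p : 'I_N -> 'I_N) (S G H : {set 'I_N}) (x y u v w : 'I_N).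

(* The sites matched by [p] are those with [p x != x]; a fixed site lies in both
   sets of a compatible pair if it is in [S], and in neither otherwise. *)
Definition local_compat p S G1 G2 x : bool :=
  if p x == x then ((x \in G1) == (x \in S)) && ((x \in G2) == (x \in S))
  else ((x \in G2) == (x \notin G1)) && ((p x \in G1) == (x \notin G1)).

Definition compat p S G1 G2 : bool := [forall x, local_compat p S G1 G2 x].

Definition noncrossing p : Prop := forall x y,
  (x < y < p x)%N -> (p y != y :> nat) -> (x < p y < p x)%N.

(** [Z] will be the set of frozen rows, which carry no arc. *)
Definition matching (Z : pred 'I_N) p : Prop :=
  [/\ involutive p, forall z, Z z -> p z = z & noncrossing p].

Section Step.
Variables (Z : pred 'I_N) (p : 'I_N -> 'I_N) (u v : 'I_N).
Hypotheses (ltuv : (u < v)%N) (Zuv : forall x, (u < x < v)%N -> Z x).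
Hypotheses (nZu : ~~ Z u) (nZv : ~~ Z v) (mp : matching Z p).

Let pK : involutive p. Proof. by case: mp. Qed.
Let pZ z : Z z -> p z = z. Proof. by case: mp => _ h _; apply: h. Qed.
Let pN : noncrossing p. Proof. by case: mp. Qed.

Let between x : (u < x < v)%N -> p x = x :> nat.
Proof. by move=> /Zuv/pZ ->. Qed.

Lemma involutive_update (D : pred 'I_N) p' : (forall x, D x -> D (p x)) ->
  (forall x, D x -> p' (p' x) = x) -> (forall x, ~~ D x -> p' x = p x) -> involutive p'.
Proof.
move=> Dp p'K p'E x; have [/p'K//|nDx] := boolP (D x).
have nDpx : ~~ D (p x) by apply: contraNN nDx => /Dp; rewrite pK.
by rewrite (p'E x) // p'E // pK.
Qed.

Let neN x y : (x != y) = (x != y :> nat). Proof. by []. Qed.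

(** This and the next four lemmas describe the planar surgeries that occur when a bridge on [u] and
    [v] is undone, one for each way in which [p] meets these two sites. The arcs stay noncrossing
    because all sites strictly between [u] and [v] are fixed by [p]. *)
Lemma matching_cup : p u = u -> p v = v ->
  matching Z (fun x => if x == u then v else if x == v then u else p x).
Proof.
move=> pu pv; set p' := fun _ => _.
have neuv : u != v by rewrite neN; clear - ltuv; lia.
have p'u : p' u = v by rewrite /p' eqxx.
have p'v : p' v = u by rewrite /p' eq_sym (negPf neuv) eqxx.
have p'E x : ~~ pred2 u v x -> p' x = p x.
  by rewrite /p' /= negb_or => /andP[/negPf-> /negPf->].
split.
- apply: (@involutive_update (pred2 u v)) => // x.
  + by case/orP=> /eqP ->; rewrite /= ?pu ?pv eqxx ?orbT.
  + by case/orP=> /eqP ->; rewrite ?(p'u, p'v).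
- move=> z Zz; rewrite p'E ?pZ //=; apply/norP; split.
    by apply: contraTneq Zz => ->.
  by apply: contraTneq Zz => ->.
move=> x y.
have [xuv|/[dup] nx /p'E ->] := boolP (pred2 u v x).
  have [yuv|/[dup] ny /p'E ->] := boolP (pred2 u v y).
    by case/orP: xuv yuv => /eqP -> /orP[] /eqP ->; rewrite ?(p'u, p'v); clear - ltuv; lia.
  case/orP: xuv => /eqP ->; rewrite ?(p'u, p'v); last by clear - ltuv; lia.
  by move=> h; rewrite (between h) eqxx.
have [yuv|/[dup] ny /p'E ->] := boolP (pred2 u v y); last exact: pN.
have := @pN x u; have := @pN x v; have := @between x; have := @between (p x).
case/norP: nx => nx1 nx2; have {}nx1 : (x != u :> nat) := nx1.
have {}nx2 : (x != v :> nat) := nx2; rewrite pK.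
have px1 : (p x != u :> nat) by apply: contraNneq nx1 => /val_inj/(congr1 p); rewrite pK pu => ->.
have px2 : (p x != v :> nat) by apply: contraNneq nx2 => /val_inj/(congr1 p); rewrite pK pv => ->.
by case/orP: yuv => /eqP ->; rewrite ?(p'u, p'v); clear - ltuv nx1 nx2 px1 px2; lia.
Qed.

Let p_eq x a b : p a = b -> (p x == b) = (x == a).
Proof. by move <-; rewrite (inj_eq (inv_inj pK)). Qed.

Lemma matching_right w : p u = u -> p v = w -> w != v ->
  matching Z (fun x => if x == u then w else if x == w then u else if x == v then v else p x).
Proof.
move=> pu pv wv; set p' := fun _ => _; pose D : pred 'I_N := pred3 u v w.
have pw : p w = v by rewrite -pv pK.
have neuv : u != v by rewrite neN; clear - ltuv; lia.
have newu : w != u by apply: contra_neq neuv => wu; rewrite -pu -{1}wu.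
have p'u : p' u = w by rewrite /p' eqxx.
have p'w : p' w = u by rewrite /p' (negPf newu) eqxx.
have p'v : p' v = v by rewrite /p' ![v == _]eq_sym (negPf neuv) (negPf wv) eqxx.
have p'E x : ~~ D x -> p' x = p x.
  by rewrite /p' /= !negb_or => /and3P[/negPf-> /negPf-> /negPf->].
have pD x : D (p x) = D x.
  by rewrite /D /= (p_eq _ pu) (p_eq _ pw) (p_eq _ pv); case: (x == u); case: (x == v); case: (x == w).
have DN x : ~~ D x -> [/\ x != u :> nat, x != v :> nat & x != w :> nat].
  by rewrite /D /= !negb_or => /and3P[].
split.
- apply: (@involutive_update D) => // x; first by rewrite pD.
  by case/or3P=> /eqP ->; rewrite ?(p'u, p'v, p'w).
- move=> z Zz; rewrite p'E ?pZ //=; apply/norP; split; first by apply: contraTneq Zz => ->.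
  apply/norP; split; apply: contraTneq Zz => -> //.
  by apply: contra wv => /pZ; rewrite pw => ->.
have bw := @between w; rewrite pw in bw; have wvN : (w != v :> nat) := wv.
have wuN : (w != u :> nat) := newu.
move=> x y; have [xD|nx] := boolP (D x); have [yD|ny] := boolP (D y).
- by case/or3P: xD yD => /eqP -> /or3P[] /eqP ->; rewrite ?(p'u, p'v, p'w);
    clear - ltuv bw wvN wuN; lia.
- have := @between y; have := @between (p y); have := @pN v y; have := @pN w y.
  have [y1 y2 y3] := DN _ ny; rewrite (p'E y) // pK pv pw.
  have [] := DN (p y); first by rewrite pD.
  by case/or3P: xD => /eqP -> py1 py2 py3; rewrite ?(p'u, p'v, p'w);
    clear - ltuv bw wvN wuN y1 y2 y3 py1 py2 py3; lia.
- have := @between x; have := @between (p x); have := @pN x v; have := @pN x w.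
  have [x1 x2 x3] := DN _ nx; rewrite (p'E x) // pK pv pw.
  have [] := DN (p x); first by rewrite pD.
  by case/or3P: yD => /eqP -> px1 px2 px3; rewrite ?(p'u, p'v, p'w);
    clear - ltuv bw wvN wuN x1 x2 x3 px1 px2 px3; lia.
- by rewrite !p'E //; exact: pN.
Qed.

Lemma matching_left w : p v = v -> p u = w -> w != u ->
  matching Z (fun x => if x == v then w else if x == w then v else if x == u then u else p x).
Proof.
move=> pv pu wu; set p' := fun _ => _; pose D : pred 'I_N := pred3 u v w.
have pw : p w = u by rewrite -pu pK.
have neuv : u != v by rewrite neN; clear - ltuv; lia.
have newv : w != v by apply: contra_neq neuv => wv; rewrite -pw wv pv.
have p'v : p' v = w by rewrite /p' eqxx.
have p'w : p' w = v by rewrite /p' (negPf newv) eqxx.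
have p'u : p' u = u by rewrite /p' (negPf neuv) [u == w]eq_sym (negPf wu) eqxx.
have p'E x : ~~ D x -> p' x = p x.
  by rewrite /p' /= !negb_or => /and3P[/negPf-> /negPf-> /negPf->].
have pD x : D (p x) = D x.
  by rewrite /D /= (p_eq _ pu) (p_eq _ pw) (p_eq _ pv); case: (x == u); case: (x == v); case: (x == w).
have DN x : ~~ D x -> [/\ x != u :> nat, x != v :> nat & x != w :> nat].
  by rewrite /D /= !negb_or => /and3P[].
split.
- apply: (@involutive_update D) => // x; first by rewrite pD.
  by case/or3P=> /eqP ->; rewrite ?(p'u, p'v, p'w).
- move=> z Zz; rewrite p'E ?pZ //=; apply/norP; split; first by apply: contraTneq Zz => ->.
  apply/norP; split; apply: contraTneq Zz => -> //.
  by apply: contra wu => /pZ; rewrite pw => ->.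
have bw := @between w; rewrite pw in bw; have wvN : (w != v :> nat) := newv.
have wuN : (w != u :> nat) := wu.
move=> x y; have [xD|nx] := boolP (D x); have [yD|ny] := boolP (D y).
- by case/or3P: xD yD => /eqP -> /or3P[] /eqP ->; rewrite ?(p'u, p'v, p'w);
    clear - ltuv bw wvN wuN; lia.
- have := @between y; have := @between (p y); have := @pN u y; have := @pN w y.
  have [y1 y2 y3] := DN _ ny; rewrite (p'E y) // pK pu pw.
  have [] := DN (p y); first by rewrite pD.
  by case/or3P: xD => /eqP -> py1 py2 py3; rewrite ?(p'u, p'v, p'w);
    clear - ltuv bw wvN wuN y1 y2 y3 py1 py2 py3; lia.
- have := @between x; have := @between (p x); have := @pN x u; have := @pN x w.
  have [x1 x2 x3] := DN _ nx; rewrite (p'E x) // pK pu pw.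
  have [] := DN (p x); first by rewrite pD.
  by case/or3P: yD => /eqP -> px1 px2 px3; rewrite ?(p'u, p'v, p'w);
    clear - ltuv bw wvN wuN x1 x2 x3 px1 px2 px3; lia.
- by rewrite !p'E //; exact: pN.
Qed.

Lemma matching_cap : p u = v ->
  matching Z (fun x => if x == u then u else if x == v then v else p x).
Proof.
move=> pu; have pv : p v = u by rewrite -pu pK.
set p' := fun _ => _; pose D : pred 'I_N := pred2 u v.
have neuv : u != v by rewrite neN; clear - ltuv; lia.
have p'u : p' u = u by rewrite /p' eqxx.
have p'v : p' v = v by rewrite /p' eq_sym (negPf neuv) eqxx.
have p'E x : ~~ D x -> p' x = p x.
  by rewrite /p' /= negb_or => /andP[/negPf-> /negPf->].
have p'D x : D x -> p' x = x by case/orP=> /eqP ->.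
have pD x : D (p x) = D x.
  by rewrite /D /= (p_eq _ pu) (p_eq _ pv) orbC.
split.
- apply: (@involutive_update D) => // x; first by rewrite pD.
  by move=> Dx; rewrite !p'D.
- move=> z Zz; rewrite p'E ?pZ //=; apply/norP.
  by split; apply: contraTneq Zz => ->.
move=> x y; have [xD|nx] := boolP (D x); first by rewrite (p'D x) //; clear; lia.
have [yD|ny] := boolP (D y); first by rewrite (p'D y) // eqxx.
by rewrite !p'E //; exact: pN.
Qed.

Lemma matching_join w1 w2 : p u = w1 -> p v = w2 -> w1 != u -> w2 != v -> w1 != v ->
  matching Z (fun x => if x == u then u else if x == v then v else
                       if x == w1 then w2 else if x == w2 then w1 else p x).
Proof.
move=> pu pv w1u w2v w1v; set p' := fun _ => _.
pose D : pred 'I_N := fun x => [|| x == u, x == v, x == w1 | x == w2].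
have pw1 : p w1 = u by rewrite -pu pK.
have pw2 : p w2 = v by rewrite -pv pK.
have neuv : u != v by rewrite neN; clear - ltuv; lia.
have w2u : w2 != u by apply: contra_neq w1v => w2u; rewrite -pw2 w2u.
have w12 : w1 != w2 by apply: contra_neq neuv => w12; rewrite -pw2 -w12.
have p'u : p' u = u by rewrite /p' eqxx.
have p'v : p' v = v by rewrite /p' eq_sym (negPf neuv) eqxx.
have p'w1 : p' w1 = w2 by rewrite /p' (negPf w1u) (negPf w1v) eqxx.
have p'w2 : p' w2 = w1.
  by rewrite /p' (negPf w2u) (negPf w2v) eq_sym (negPf w12) eqxx.
have p'E x : ~~ D x -> p' x = p x.
  by rewrite /p' /D !negb_or => /and4P[/negPf-> /negPf-> /negPf-> /negPf->].
have pD x : D (p x) = D x.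
  rewrite /D (p_eq _ pu) (p_eq _ pv) (p_eq _ pw1) (p_eq _ pw2).
  by case: (x == u); case: (x == v); case: (x == w1); case: (x == w2).
have DN x : ~~ D x -> [/\ x != u :> nat, x != v :> nat, x != w1 :> nat & x != w2 :> nat].
  by rewrite /D /= !negb_or => /and4P[].
split.
- apply: (@involutive_update D) => // x; first by rewrite pD.
  by case/or4P=> /eqP ->; rewrite ?(p'u, p'v, p'w1, p'w2).
- move=> z Zz; rewrite p'E ?pZ //; rewrite /D !negb_or; apply/and4P.
  split; apply: contraTneq Zz => -> //.
    by apply: contra w1u => /pZ; rewrite pw1 => ->.
  by apply: contra w2v => /pZ; rewrite pw2 => ->.
have bw1 := @between w1; rewrite pw1 in bw1; have w1vN : (w1 != v :> nat) := w1v.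
have w1uN : (w1 != u :> nat) := w1u.
have bw2 := @between w2; rewrite pw2 in bw2; have w2vN : (w2 != v :> nat) := w2v.
have w2uN : (w2 != u :> nat) := w2u. have w12N : (w1 != w2 :> nat) := w12.
(* The possible positions of the arcs at [u] and [v]: side by side, both leftwards and nested, or
   both rightwards and nested. In any other order they would cross. *)
have config : [|| (w1 < u)%N && (v < w2)%N, (w2 < w1)%N && (w1 < u)%N |
                  (v < w2)%N && (w2 < w1)%N].
  have c1 := @pN u v; have c2 := @pN w1 v; have c3 := @pN v u; have c4 := @pN w2 u.
  rewrite pu pv pw1 pw2 in c1 c2 c3 c4.
  by clear - ltuv w1uN w1vN w2uN w2vN w12N bw1 bw2 c1 c2 c3 c4; lia.
move=> x y; have [yD|ny] := boolP (D y).
  have [xD|nx] := boolP (D x).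
    by case/or4P: xD yD => /eqP -> /or4P[] /eqP ->; rewrite ?(p'u, p'v, p'w1, p'w2);
      clear; lia.
  have [x1 x2 x3 x4] := DN _ nx; rewrite (p'E x) //.
  have [|px1 px2 px3 px4] := DN (p x); first by rewrite pD.
  have b1 := @between x; have b2 := @between (p x); rewrite pK in b2.
  have n1 := @pN x u; have n2 := @pN x v; rewrite pu pv in n1 n2.
  case/or4P: yD => /eqP ->; rewrite ?(p'u, p'v, p'w1, p'w2) ?eqxx // => xy _.
    have := @pN x w1 xy; rewrite pw1; clear - w1uN n2 b2 px2 ltuv w2vN; lia.
  have := @pN x w2 xy; rewrite pw2; clear - w2vN n1 b1 x1 ltuv w1uN; lia.
have [y1 y2 y3 y4] := DN _ ny; rewrite (p'E y) //.
have [|py1 py2 py3 py4] := DN (p y); first by rewrite pD.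
have b1 := @between y; have b2 := @between (p y); rewrite pK in b2.
have [xD|nx] := boolP (D x); last by rewrite p'E //; exact: pN.
case/or4P: xD => /eqP ->; rewrite ?(p'u, p'v, p'w1, p'w2).
- by clear; lia.
- by clear; lia.
- move=> lty nfy; have n1 := @pN w1 y; have n2 := @pN v y; rewrite pv pw1 in n1 n2.
  have {config} config : (w1 < u)%N && (v < w2)%N by move: config lty; clear; lia.
  have [lt|ge] := ltnP y u; first by move: n1 nfy; clear - lt lty config ltuv; lia.
  have lt : (v < y)%N by clear - b1 y1 y2 ge nfy; lia.
  by move: n2 nfy; clear - lt lty config ltuv; lia.
- move=> lty nfy; have [lt|ge] := ltnP w1 u.
    have {config} config : (w2 < w1)%N by move: config lty; clear; lia.
    have n1 := @pN w2 y; have n2 := @pN w1 (p y); rewrite pw1 pw2 pK in n1 n2.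
    by clear - lt lty n1 n2 b2 py1 py2 py3 nfy ltuv; lia.
  have {config} config : (v < w2)%N && (w2 < w1)%N by move: config lty ge; clear; lia.
  have n1 := @pN u y; have n2 := @pN v (p y); rewrite pu pv pK in n1 n2.
  by clear - lty config n1 n2 b2 py1 py2 py3 py4 nfy ltuv; lia.
Qed.

End Step.
End Matchings.

(** * Effect of undoing a bridge on the indicator of a matching *)

Section Indicators.
Variable N : nat.
Implicit Types (p : 'I_N -> 'I_N) (S G H : {set 'I_N}) (x y u v w : 'I_N) (D : seq 'I_N).

(** A uniform description, whether or not the replacement is active: [v] receives the disjunction of
    the two memberships and [u] their conjunction. *)
Lemma in_replace u v G x : u != v ->
  (x \in replace u v G) =
  if x == v then (u \in G) || (v \in G) else
  if x == u then (u \in G) && (v \in G) else x \in G.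
Proof.
move=> uv; rewrite /replace /replaceable.
have [->|xv] := eqVneq x v.
  by case uG: (u \in G); case vG: (v \in G); rewrite /= ?inE ?eqxx ?uG ?vG.
have [->|xu] := eqVneq x u.
  by case uG: (u \in G); case vG: (v \in G); rewrite /= ?inE ?eqxx ?(negPf uv) ?uG ?vG.
by case: ifP => _; rewrite ?inE ?(negPf xv) ?(negPf xu).
Qed.

(** Away from the sites [u], [v] and their partners a bridge changes nothing. Splitting off this
    common factor turns the identities below into finite truth tables on the list [D]. *)
Definition compat_off D p S G1 G2 : bool :=
  [forall x, (x \notin D) ==> local_compat p S G1 G2 x].

Lemma compat_split D p S G1 G2 :
  compat p S G1 G2 = compat_off D p S G1 G2 && all (local_compat p S G1 G2) D.
Proof.
apply/forallP/andP => [h|[/forallP h1 /allP h2] x].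
  by split; [apply/forallP => x; apply/implyP | apply/allP].
by have [/h2//|nx] := boolP (x \in D); exact: implyP (h1 x) nx.
Qed.

Lemma eq_compat_off D p p' S S' G1 G2 G1' G2' :
  (forall x, x \notin D -> p x \notin D) ->
  (forall x, x \notin D -> [/\ p x = p' x, (x \in S) = (x \in S'),
    (x \in G1) = (x \in G1') & (x \in G2) = (x \in G2')]) ->
  compat_off D p S G1 G2 = compat_off D p' S' G1' G2'.
Proof.
move=> Dp h; apply: eq_forallb => x; have [//|nx] /= := boolP (x \in D).
have [px Sx G1x G2x] := h x nx; have [_ _ G1p _] := h _ (Dp _ nx).
by rewrite /local_compat -px G1p Sx G1x G2x.
Qed.

Section Step.
Variables (Z : pred 'I_N) (p : 'I_N -> 'I_N) (S : {set 'I_N}) (u v : 'I_N).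
Hypotheses (ltuv : (u < v)%N) (Zuv : forall x, (u < x < v)%N -> Z x).
Hypotheses (nZu : ~~ Z u) (nZv : ~~ Z v) (mp : matching Z p).

Let S' := v |: S :\ u.
Let mv := replace v u.
Let act := replaceable v u.

Let neuv : u != v.
Proof. by apply: contraTneq ltuv => ->; rewrite ltnn. Qed.
Let nevu : v == u = false. Proof. by rewrite eq_sym (negPf neuv). Qed.

Let D := [:: u; v; p u; p v].

Let pK : involutive p. Proof. by case: mp. Qed.

Let Dp x : x \notin D -> p x \notin D.
Proof.
rewrite !inE !negb_or => /and4P[xu xv xpu xpv].
rewrite -{1}(pK u) -{1}(pK v) !(inj_eq (inv_inj pK)) xu xv andbT /=.
by rewrite xpu xpv.
Qed.

Let offE p' G1 G2 G1' G2' :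
  (forall x, x \notin D -> p' x = p x) ->
  (G1' = G1 \/ G1' = mv G1) -> (G2' = G2 \/ G2' = mv G2) ->
  compat_off D p S G1' G2' = compat_off D p' S' G1 G2.
Proof.
move=> p'E e1 e2; apply: eq_compat_off => // x nx; rewrite p'E //.
have mvE G : (x \in mv G) = (x \in G).
  rewrite in_replace ?nevu //; move: nx; rewrite !inE !negb_or => /and4P[/negPf-> /negPf-> _ _] //.
split=> //.
- move: nx; rewrite !inE !negb_or => /and4P[-> /negPf-> _ _] //.
- by case: e1 => ->.
- by case: e2 => ->.
Qed.

(* Coefficients of [a] and [a ^+ 2] in the product over the pair after the row
   operation [f v <- f v + a *: f u] is applied to the indicator of [p, S]. *)
Definition move1 G1 G2 : nat :=
  (act G1 * compat p S (mv G1) G2 + act G2 * compat p S G1 (mv G2))%N.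

Definition move2 G1 G2 : nat := (act G1 * act G2 * compat p S (mv G1) (mv G2))%N.

(** Moving [v] to [u] in both sets leaves [u] in both and [v] in neither, which is compatible only
    if both sites are fixed, [u] inside [S] and [v] outside. *)
Lemma move2_compat : exists (c : nat) p' S', matching Z p' /\
  forall G1 G2, move2 G1 G2 = (c * compat p' S' G1 G2)%N.
Proof.
exists ([&& p u == u, p v == v, u \in S & v \notin S] : nat), p, S'; split=> // G1 G2.
rewrite /move2 !(compat_split D) (@offE p G1 G2) //; try by right.
move: (compat_off _ _ _ _ _) => off.
rewrite /= /local_compat /act /replaceable !in_replace ?nevu // /S' !inE.
rewrite !pK ?eqxx ?nevu ?(negPf neuv).
have [pu|pu] := eqVneq (p u) u; last first.
  by case: (u \in G1); case: (v \in G1); case: (u \in G2); case: (v \in G2); rewrite ?andbF.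
have [pv|pv] := eqVneq (p v) v; last first.
  by case: (u \in G1); case: (v \in G1); case: (u \in G2); case: (v \in G2); rewrite ?andbF.
rewrite ?(pu, pv, eqxx, nevu) ?(negPf neuv) /=.
by case: (u \in G1); case: (v \in G1); case: (u \in G2); case: (v \in G2);
 case: (u \in S); case: (v \in S); case: off.
Qed.

(** As in the calculus of planar diagrams, each position of [u] and [v] with respect to the arcs
    yields one new matching with a multiplicity. *)
Lemma move1_compat : exists (c : nat) p' S', matching Z p' /\
  forall G1 G2, move1 G1 G2 = (c * compat p' S' G1 G2)%N.
Proof.
have moveE G1 G2 p' : (forall x, x \notin D -> p' x = p x) ->
  move1 G1 G2 = (act G1 * (compat_off D p' S' G1 G2 && all (local_compat p S (mv G1) G2) D) +
    act G2 * (compat_off D p' S' G1 G2 && all (local_compat p S G1 (mv G2)) D))%N.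
  move=> h; rewrite /move1 !(compat_split D) !(@offE p' G1 G2) //; by [left | right].
have [pu|pu] := eqVneq (p u) u; have [pv|pv] := eqVneq (p v) v.
- pose p' x := if x == u then v else if x == v then u else p x.
  (* After the move [u] is in both sets and [v] in neither. Before it, one set contained [v] and the
     other [u], so the two sites have opposite colours and form an arc. *)
  exists ((u \in S) && (v \notin S) : nat), p', S'; split.
    by apply: matching_cup => //; exact: Zuv.
  move=> G1 G2; rewrite (moveE _ _ p'); last first.
    by move=> x; rewrite !inE !negb_or /p' => /and4P[/negPf-> /negPf->].
  rewrite (compat_split D p').
  move: (compat_off _ _ _ _ _) => off.
  rewrite /= /local_compat /act /replaceable !in_replace ?nevu // /S' !inE /p'.
  rewrite ?(pu, pv) ?eqxx ?nevu ?(negPf neuv) ?eqxx ?nevu ?(negPf neuv) /=.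
  by case: (u \in G1); case: (v \in G1); case: (u \in G2); case: (v \in G2);
    case: (u \in S); case: (v \in S); case: off.
- pose w := p v; have pw : p w = v by rewrite pK.
  have wu : w != u by apply: contra_neq neuv => wu; move: pw; rewrite wu pu.
  have wv : w != v by [].
  pose p' x := if x == u then w else if x == w then u else if x == v then v else p x.
  exists (u \in S : nat), p', S'; split.
    by apply: matching_right => //; exact: Zuv.
  move=> G1 G2; rewrite (moveE _ _ p'); last first.
    by move=> x; rewrite !inE !negb_or /p' => /and4P[/negPf-> /negPf-> _ /negPf->].
  rewrite (compat_split D p').
  move: (compat_off _ _ _ _ _) => off.
  rewrite /D -/w /= /local_compat /act /replaceable !in_replace ?nevu // /S' !inE /p' -/w.
  rewrite ?(pu, pw) ?eqxx ?nevu ?(negPf neuv, negPf wu, negPf wv, eqxx, nevu)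
    ?[_ == w]eq_sym ?(negPf neuv, negPf wu, negPf wv, eqxx, nevu) /=.
  by case: (u \in G1); case: (v \in G1); case: (u \in G2); case: (v \in G2);
    case: (w \in G1); case: (w \in G2); case: (u \in S); case: off.
- pose w := p u; have pw : p w = u by rewrite pK.
  have wv : w != v by apply: contra_neq neuv => wv; move: pw; rewrite wv pv.
  have wu : w != u by [].
  pose p' x := if x == v then w else if x == w then v else if x == u then u else p x.
  exists (v \notin S : nat), p', S'; split.
    by apply: matching_left => //; exact: Zuv.
  move=> G1 G2; rewrite (moveE _ _ p'); last first.
    by move=> x; rewrite !inE !negb_or /p' => /and4P[/negPf-> /negPf-> /negPf-> _].
  rewrite (compat_split D p').
  move: (compat_off _ _ _ _ _) => off.
  rewrite /D -/w /= /local_compat /act /replaceable !in_replace ?nevu // /S' !inE /p' -/w.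
  rewrite ?(pv, pw) ?eqxx ?nevu ?(negPf neuv, negPf wu, negPf wv, eqxx, nevu)
    ?[_ == w]eq_sym ?(negPf neuv, negPf wu, negPf wv, eqxx, nevu) /=.
  by case: (u \in G1); case: (v \in G1); case: (u \in G2); case: (v \in G2);
    case: (w \in G1); case: (w \in G2); case: (v \in S); case: off.
have [puv|w1v] := eqVneq (p u) v.
  have pvu : p v = u by rewrite -puv pK.
  pose p' x := if x == u then u else if x == v then v else p x.
  (* If both sets contain [v] and not [u], moving either one of them gives the two ends of the arc
     opposite colours; hence the factor 2. *)
  exists 2, p', S'; split.
    by apply: matching_cap => //; exact: Zuv.
  move=> G1 G2; rewrite (moveE _ _ p'); last first.
    by move=> x; rewrite !inE !negb_or /p' => /and4P[/negPf-> /negPf->].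
  rewrite (compat_split D p').
  move: (compat_off _ _ _ _ _) => off.
  rewrite /= /local_compat /act /replaceable !in_replace ?nevu // /S' !inE /p'.
  rewrite ?(puv, pvu) ?eqxx ?nevu ?(negPf neuv, eqxx, nevu) /=.
  by case: (u \in G1); case: (v \in G1); case: (u \in G2); case: (v \in G2); case: off.
pose w1 := p u; pose w2 := p v.
have pw1 : p w1 = u by rewrite pK.
have pw2 : p w2 = v by rewrite pK.
have w2u : w2 != u by apply: contra_neq w1v => w2u; move: pw2; rewrite w2u.
have w12 : w1 != w2 by apply: contra_neq neuv => w12; move: pw1; rewrite w12 pw2.
pose p' x := if x == u then u else if x == v then v else
             if x == w1 then w2 else if x == w2 then w1 else p x.
exists 1%N, p', S'; split.
  by apply: matching_join => //; exact: Zuv.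
move=> G1 G2; rewrite (moveE _ _ p'); last first.
  by move=> x; rewrite !inE !negb_or /p' => /and4P[/negPf-> /negPf-> /negPf-> /negPf->].
rewrite (compat_split D p').
move: (compat_off _ _ _ _ _) => off.
have w1u : w1 == u = false := negPf pu.
have w2v : w2 == v = false := negPf pv.
have uw1 : u == w1 = false by rewrite eq_sym.
have vw2 : v == w2 = false by rewrite eq_sym.
have w21 : w2 == w1 = false by rewrite eq_sym; exact: negPf.
rewrite /D -/w1 -/w2 /= /local_compat /act /replaceable !in_replace ?nevu // /S' !inE /p' -/w1 -/w2.
have simp := (uw1, vw2, w21, w1u, w2v, negPf neuv, negPf w2u, negPf w12, negPf w1v, nevu, eqxx).
rewrite ?pw1 ?pw2 -/w1 -/w2 ?simp /=.
by case: (u \in G1); case: (v \in G1); case: (u \in G2); case: (v \in G2);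
  case: (w1 \in G1); case: (w1 \in G2); case: (w2 \in G1); case: (w2 \in G2); case: off.
Qed.

End Step.
End Indicators.

(** * Products of two maximal minors as nonnegative combinations of matching indicators *)

Section Cone.
Variables (R : realFieldType) (N : nat).
Implicit Types (p : 'I_N -> 'I_N) (S G H : {set 'I_N}) (Z : pred 'I_N).
Implicit Types T : {set 'I_N} -> {set 'I_N} -> R.

Inductive matching_cone Z : ({set 'I_N} -> {set 'I_N} -> R) -> Prop :=
| MatchingCone0 T : (forall G1 G2, T G1 G2 = 0) -> matching_cone Z T
| MatchingConeAdd c p S T T' : 0 <= c -> matching Z p -> matching_cone Z T ->
    (forall G1 G2, T' G1 G2 = c * (compat p S G1 G2)%:R + T G1 G2) ->
    matching_cone Z T'.

Lemma matching_cone_mono Z T G1 G2 H1 H2 : matching_cone Z T ->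
  (forall p S, matching Z p -> compat p S G1 G2 -> compat p S H1 H2) ->
  T G1 G2 <= T H1 H2.
Proof.
move=> cT GH; elim: cT => [T0 T00|c p S T0 T0' c0 mp _ IH E]; first by rewrite !T00.
rewrite !E; apply: lerD => //; apply: ler_wpM2l => //; rewrite ler_nat.
by case cG: (compat p S G1 G2) => //; rewrite (GH _ _ mp cG).
Qed.

Lemma matching_cone_weaken Z Z' T : (forall x, Z x -> Z' x) ->
  matching_cone Z' T -> matching_cone Z T.
Proof.
move=> ZZ'; elim=> [T0 T00|c p S T0 T0' c0 mp _ IH E]; first exact: MatchingCone0.
apply: (MatchingConeAdd c0 _ IH E); case: mp => pK pZ pN; split=> // z Zz.
by apply: pZ; exact: ZZ'.
Qed.

Section Step.
Variables (Z : pred 'I_N) (u v : 'I_N).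
Hypotheses (ltuv : (u < v)%N) (Zuv : forall x : 'I_N, (u < x < v)%N -> Z x).
Hypotheses (nZu : ~~ Z u) (nZv : ~~ Z v).

Let mv := replace v u.
Let act := replaceable v u.

(** The expression in [a] is linear in [T], so it suffices to treat one indicator, whose two new
    coefficients are [move1] and [move2]. *)
Lemma matching_cone_step a T T' : 0 <= a -> matching_cone Z T ->
  (forall G1 G2, T' G1 G2 =
    T G1 G2 + a * ((act G1)%:R * T (mv G1) G2 + (act G2)%:R * T G1 (mv G2)) +
    a ^+ 2 * ((act G1)%:R * (act G2)%:R * T (mv G1) (mv G2))) ->
  matching_cone Z T'.
Proof.
move=> a0 cT; elim: cT T' => [T0 T00|c p S T0 T0' c0 mp _ IH T0'E] T' T'E.
  by apply: MatchingCone0 => G1 G2; rewrite T'E !T00 !(mulr0, addr0).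
have [c1 [p1 [S1 [mp1 E1]]]] := move1_compat S ltuv Zuv nZu nZv mp.
have [c2 [p2 [S2 [mp2 E2]]]] := move2_compat S ltuv mp.
have := IH _ (fun G1 G2 => erefl); set T1 := fun _ => _ => cT1.
have a1 : 0 <= a * c * c1%:R by rewrite !mulr_ge0.
have a2 : 0 <= a ^+ 2 * c * c2%:R by rewrite !mulr_ge0 ?exprn_ge0.
have cT2 := @MatchingConeAdd Z _ _ S1 _ _ a1 mp1 cT1 (fun G1 G2 => erefl).
have cT3 := @MatchingConeAdd Z _ _ S2 _ _ a2 mp2 cT2 (fun G1 G2 => erefl).
apply: (@MatchingConeAdd Z _ _ S _ _ c0 mp cT3) => G1 G2.
move/(congr1 (fun n => n%:R : R)): (E1 G1 G2); move/(congr1 (fun n => n%:R : R)): (E2 G1 G2).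
rewrite /move1 /move2 !natrD !natrM -/mv -/act => E2' E1'.
rewrite T'E !T0'E /T1.
transitivity (c * (compat p S G1 G2)%:R + (a ^+ 2 * c * (c2%:R * (compat p2 S2 G1 G2)%:R) +
  (a * c * (c1%:R * (compat p1 S1 G1 G2)%:R) + T1 G1 G2))); last first.
  by rewrite /T1 !mulrA.
rewrite -E2' -E1' /T1; ring.
Qed.

End Step.

Variable k : nat.

(** The value 0 at sets of the wrong size makes the expansion hold for all pairs of sets, as the
    cone requires; replacements preserve sizes. *)
Definition plucker_pair (f : 'I_N -> 'rV[R]_k) G1 G2 : R :=
  if (#|G1| == k) && (#|G2| == k) then plucker f G1 * plucker f G2 else 0.

Lemma plucker_pair_cone (f : 'I_N -> 'rV[R]_k) : plucker_ge0 f -> matching_cone (frozen f) (plucker_pair f).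
Proof.
have [n] := ubnP #|[set J | basis f J]|; elim: n f => // n IH f len f_ge0.
have [/existsP[u0 nfu0]|] := boolP [exists x, ~~ frozen f x].
  have [f' [u [v [a [[ltuv a0] [nfu nfv] btwuv [f'_ge0 frz'] [lt fE]]]]]] :=
    bridge_step f_ge0 nfu0.
  have cf' : matching_cone (frozen f) (plucker_pair f').
    by apply: matching_cone_weaken frz' _; apply: IH => //; exact: leq_trans lt _.
  apply: (matching_cone_step ltuv btwuv nfu nfv a0 cf') => G1 G2.
  have card_rep G : #|replace v u G| = #|G|.
    by rewrite /replace; case: ifP => // /andP[vG uG]; rewrite card_exchange.
  rewrite /plucker_pair !card_rep; case: eqP => c1; case: eqP => c2 //=; last 3 first.
  - by rewrite !(mulr0, addr0).
  - by rewrite !(mulr0, addr0).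
  - by rewrite !(mulr0, addr0).
  by rewrite !fE //; ring.
rewrite negb_exists => /forallP frz.
have {}frz x : frozen f x by have := frz x; rewrite negbK.
have [/existsP[J0 bJ0]|] := boolP [exists J, basis f J]; last first.
  rewrite negb_exists => /forallP nb; apply: MatchingCone0 => G1 G2.
  rewrite /plucker_pair; case: andP => // -[c1 _].
  by have := nb G1; rewrite /basis c1 /= negbK => /eqP ->; rewrite mul0r.
have basisE J : basis f J -> J = J0.
  by move=> bJ; apply/setP => x; exact: frozenP (frz x) bJ bJ0.
have [/eqP c0 p0] := andP bJ0.
(* With every row frozen there is one basis [J0]. Its indicator belongs to the matching without
   arcs, whose fixed sites are prescribed by [J0]. *)
have mid : matching (frozen f) id by split=> // x y; rewrite eqxx.
apply: (MatchingConeAdd (sqr_ge0 (plucker f J0)) mid (S := J0) (MatchingCone0 _ (T := fun _ _ => 0) _)) => //.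
move=> G1 G2; rewrite addr0.
have -> : compat id J0 G1 G2 = (G1 == J0) && (G2 == J0).
  apply/forallP/andP => [h|[/eqP -> /eqP ->] x]; last by rewrite /local_compat !eqxx.
  by split; apply/eqP/setP => x; have := h x; rewrite /local_compat eqxx => /andP[/eqP h1 /eqP h2].
have zero G : #|G| = k -> G != J0 -> plucker f G = 0.
  move=> cG; apply: contraNeq => pG; apply/eqP/basisE.
  by rewrite /basis cG eqxx.
rewrite /plucker_pair; have [->|n1] := eqVneq G1 J0; last first.
  by rewrite mulr0; case: andP => // -[/eqP c1 _]; rewrite zero // mul0r.
have [->|n2] := eqVneq G2 J0; last first.
  by rewrite mulr0; case: andP => // -[_ /eqP c2]; rewrite (zero G2) // mulr0.
by rewrite c0 eqxx mulr1 expr2.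
Qed.

Lemma plucker_pair_le (f : 'I_N -> 'rV[R]_k) G1 G2 H1 H2 : plucker_ge0 f ->
  [/\ #|G1| = k, #|G2| = k, #|H1| = k & #|H2| = k] ->
  (forall p S, involutive p -> noncrossing p -> compat p S G1 G2 -> compat p S H1 H2) ->
  plucker f G1 * plucker f G2 <= plucker f H1 * plucker f H2.
Proof.
move=> f_ge0 [g1 g2 h1 h2] GH.
have := matching_cone_mono (plucker_pair_cone f_ge0) (G1 := G1) (G2 := G2) (H1 := H1) (H2 := H2).
rewrite /plucker_pair g1 g2 h1 h2 !eqxx /=; apply=> p S [pK _ pN]; exact: GH.
Qed.

End Cone.

(** * Folding a square matrix *)

Section Transfer.
Variable N : nat.
Implicit Types (p : 'I_N -> 'I_N) (S G H : {set 'I_N}).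

Definition count_in G (a b : nat) : nat := #|[set x in G | (a <= x < b)%N]|.

(** The part of (3) that controls matchings, for which only balanced intervals count. *)
Definition balance_le G1 G2 H1 H2 : Prop := forall a b : nat,
  count_in G1 a b = count_in G2 a b -> count_in H1 a b = count_in H2 a b.

(** On an interval stable under [p], the involution maps the elements of one set onto those of the
    other, since the ends of an arc have opposite colours. *)
Lemma compat_count p S G1 G2 a b : involutive p -> compat p S G1 G2 ->
  (forall x : 'I_N, (a <= x < b)%N -> (a <= p x < b)%N) -> count_in G1 a b = count_in G2 a b.
Proof.
move=> pK /forallP cG ab.
have -> : count_in G2 a b = #|p @^-1: [set x in G1 | (a <= x < b)%N]|.
  apply: eq_card => x; rewrite !inE; congr (_ && _); last first.
    by apply/idP/idP => /ab //; rewrite pK.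
  have := cG x; rewrite /local_compat; case: eqP => [->|_] /andP[/eqP -> /eqP -> //].
by rewrite card_preimset //; exact: inv_inj.
Qed.

Lemma count_in_arc H (x y : 'I_N) : (x < y)%N ->
  count_in H x y.+1 = ((x \in H) + ((y \in H) + count_in H x.+1 y))%N.
Proof.
move=> ltxy; rewrite /count_in (cardsD1 x) (cardsD1 y) !inE leqnn ltnS (ltnW ltxy).
rewrite leqnn !andbT; have -> : y != x by apply: contraTneq ltxy => ->; rewrite ltnn.
congr (_ + (_ + _))%N; apply: eq_card => z; rewrite !inE !ltnS.
case: (z \in H); rewrite ?andbF //= -[z == y]val_eqE -[z == x]val_eqE /=; clear; lia.
Qed.

(** The interval spanned by an arc and its interior are both stable under [p], hence balanced for
    the left pair and so for the right pair. Their difference shows that the two ends contribute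
    equally to [H1] and [H2], which forces opposite colours. *)
Lemma compat_transfer p S G1 G2 H1 H2 : involutive p -> noncrossing p ->
  eq_multiset_union G1 G2 H1 H2 -> balance_le G1 G2 H1 H2 ->
  compat p S G1 G2 -> compat p S H1 H2.
Proof.
move=> pK pN eqm bal cG; have /forallP cGx := cG.
have arc (x : 'I_N) : (x < p x)%N -> ((x \in H1) + (p x \in H1) = (x \in H2) + (p x \in H2))%N.
  move=> ltx.
  have c1 : count_in G1 x (p x).+1 = count_in G2 x (p x).+1.
    apply: (compat_count pK cG) => y /andP[xy yx].
    have [/eqP->|npy] := boolP (p y == y :> nat); first by rewrite xy yx.
    have [yE|nyx] := eqVneq y x; first by rewrite yE leqnn ltnW.
    have [yE|nypx] := eqVneq y (p x); first by rewrite yE pK leqnn ltnW.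
    have : (x < y < p x)%N.
      have n1 : (y != x :> nat) := nyx; have n2 : (y != p x :> nat) := nypx.
      by clear - n1 n2 xy yx; lia.
    by move/(@pN x)=> /(_ npy); clear; lia.
  have c2 : count_in G1 x.+1 (p x) = count_in G2 x.+1 (p x).
    apply: (compat_count pK cG) => y xyx.
    have [/eqP->//|npy] := boolP (p y == y :> nat).
    exact: pN.
  have := bal _ _ c1; have := bal _ _ c2; rewrite !count_in_arc //.
  by move=> ->; rewrite !addnA => /addIn.
apply/forallP => x; have := cGx x; have := eqm x; have := eqm (p x).
have := cGx (p x); rewrite /local_compat pK [x == p x]eq_sym.
case: eqP => [->|/eqP npx].
  by move=> _ _ eqx /andP[/eqP g1 /eqP g2]; move: eqx; rewrite g1 g2;
    case: (x \in S); case: (x \in H1); case: (x \in H2).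
have {}arc : ((x \in H1) + (p x \in H1) = (x \in H2) + (p x \in H2))%N.
  have : (x != p x :> nat) by rewrite eq_sym; exact: npx.
  rewrite neq_ltn => /orP[/arc//|lt].
  by have := arc (p x); rewrite pK => /(_ lt); clear; lia.
move: arc; case: (x \in G1); case: (x \in G2); case: (p x \in G1); case: (p x \in G2);
 case: (x \in H1); case: (x \in H2); case: (p x \in H1); case: (p x \in H2) => //.
Qed.

End Transfer.

(** * Minors of a square matrix as maximal minors of a matrix with twice as many rows *)

Section Fold.
Variables (R : comNzRingType) (m : nat).

Lemma card_ord_gt (z : 'I_m) : #|[pred x : 'I_m | (z < x)%N]| = (m - z.+1)%N.
Proof.
rewrite cardE /enum_mem size_filter -enumT.
transitivity (count (fun i => (z < i)%N) (iota 0 m)).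
  by rewrite -val_enum_ord count_map; apply: eq_count.
have -> : iota 0 m = iota 0 z.+1 ++ iota (0 + z.+1) (m - z.+1) by rewrite -iotaD subnKC.
rewrite count_cat.
have -> : count (fun i => (z < i)%N) (iota 0 z.+1) = 0%N.
  by apply/eqP; rewrite -leqn0 leqNgt -has_count; apply/hasPn => i; rewrite mem_iota /=; clear; lia.
have -> : count (fun i => (z < i)%N) (iota (0 + z.+1) (m - z.+1)) = size (iota (0 + z.+1) (m - z.+1)).
  by apply/eqP; rewrite -all_count; apply/allP => i; rewrite mem_iota /=; clear; lia.
by rewrite size_iota.
Qed.

(** The last entry [z] of [zs] is its smallest. Moving it to its place among [ys] crosses exactly
    the indices greater than [z], and there are [m - z.+1] of them. *)
Lemma row_det_delta (ys zs : seq 'I_m) : sorted (@ord_lt m) ys ->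
  sorted (fun x y => @ord_lt m y x) zs -> (forall y, (y \in ys) (+) (y \in zs)) ->
  row_det [seq (delta_mx 0 y : 'rV[R]_m) | y <- ys ++ zs] =
  \prod_(z <- zs) (-1) ^+ (m - z.+1).
Proof.
have gt_trans : transitive (fun x y => @ord_lt m y x).
  by move=> y x z xy yz; exact: ord_lt_trans yz xy.
elim/last_ind: zs ys => [|zs z IH] ys sy sz yz.
  rewrite big_nil cats0 -(@eq_sorted_enum _ [set: 'I_m] _ sy); last first.
    by move=> y; have := yz y; rewrite in_nil addbF inE => ->.
  rewrite /row_det -[RHS](det1 R m); congr (\det _); apply/matrixP => i j.
  have szE : (i < size (enum 'I_m))%N by rewrite size_enum_ord.
  by rewrite !mxE enum_setT -enumT (nth_map i) // nth_ord_enum mxE eqxx eq_sym.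
have uniq_ys : uniq ys by apply: sorted_uniq sy; [exact: ord_lt_trans | exact: ord_lt_irr].
have uniq_zs : uniq (rcons zs z) by apply: sorted_uniq sz => // x; exact: ord_lt_irr.
have szm : size (ys ++ rcons zs z) = m.
  rewrite -[RHS]size_enum_ord; apply/perm_size/uniq_perm; rewrite ?enum_uniq //.
    rewrite cat_uniq uniq_ys uniq_zs andbT; apply/hasPn => x xz.
    by have := yz x; rewrite xz addbT.
  by move=> x; rewrite mem_cat mem_enum; have := yz x; case: (x \in ys); case: (x \in rcons _ _).
pose s1 := [seq y : 'I_m <- ys | (y < z)%N]; pose s2 := [seq y : 'I_m <- ys | (z < y)%N].
have zys : z \notin ys by have := yz z; rewrite mem_rcons inE eqxx addbT.
have sorted_s P : sorted (@ord_lt m) [seq y <- ys | P y].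
  exact: (sorted_filter (@ord_lt_trans m)).
have ysE : ys = s1 ++ s2.
  apply: irr_sorted_eq (@ord_lt_trans m) (@ord_lt_irr m) _ _ sy _ _.
    apply: sorted_cat_lt; try exact: sorted_s.
    by move=> x y; rewrite !mem_filter => /andP[+ _] /andP[+ _]; clear; lia.
  move=> x; rewrite mem_cat !mem_filter -andb_orl -neq_ltn andbC.
  case xys : (x \in ys) => //=; apply/esym; apply: contraNneq zys => /val_inj <-.
  by rewrite xys.
have sy' : sorted (@ord_lt m) (s1 ++ z :: s2).
  rewrite -cat1s; apply: sorted_cat_lt; [exact: sorted_s|apply: sorted_cat_lt => //; first exact: sorted_s|].
    by move=> x y; rewrite inE mem_filter => /eqP -> /andP[].
  move=> x y; rewrite inE !mem_filter => /andP[xz _] /orP[/eqP -> //|/andP[zy _]].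
  exact: ltn_trans zy.
have sz' : sorted (fun x y => @ord_lt m y x) zs.
  by move: sz; rewrite -cats1 => /cat_sorted2[].
have zzs : z \notin zs by move: uniq_zs; rewrite rcons_uniq => /andP[].
have yz' y : (y \in s1 ++ z :: s2) (+) (y \in zs).
  have := yz y; rewrite {1}ysE !mem_cat mem_rcons !inE.
  have [->|] //= := eqVneq y z.
  by rewrite (negPf zzs) orbT.
have zmin x : x \in zs -> (z < x)%N.
  move: sz; rewrite sorted_pairwise // -cats1 pairwise_cat => /and3P[/allrelP h _ _] xzs.
  by apply: h xzs _; rewrite inE.
have sz2 : size (s2 ++ zs) = (m - z.+1)%N.
  rewrite -card_ord_gt -(card_uniqP _) => [|].
    apply: eq_card => x; rewrite mem_cat mem_filter !inE.
    apply/orP/idP => [[/andP[]//|/zmin//]|zx]; rewrite zx /=.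
    have := yz x; rewrite mem_rcons inE.
    have -> : x == z = false by apply: contraTF zx => /eqP ->; rewrite ltnn.
    by case: (x \in ys); [left | right].
  move: uniq_zs; rewrite rcons_uniq cat_uniq filter_uniq //= => /andP[_ ->]; rewrite andbT.
  apply/hasPn => x xz; rewrite mem_filter negb_and; apply/orP; right.
  by have := yz x; rewrite mem_rcons inE xz orbT addbT.
have E1 : ys ++ rcons zs z = s1 ++ (s2 ++ zs) ++ [:: z] by rewrite -cats1 {1}ysE -!catA.
have E2 : (s1 ++ z :: s2) ++ zs = s1 ++ z :: (s2 ++ zs) ++ [::] by rewrite -catA cats0.
rewrite E1 in szm *; rewrite -cats1 big_cat /= big_seq1 -(IH _ sy' sz' yz') -sz2 E2.
rewrite [in RHS]map_cat /= [in RHS]map_cat row_det_move.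
  by rewrite size_map -map_cons -!map_cat mulrC mulrA -exprD addnn -mul2n exprM sqrrN !expr1n mul1r.
by move: szm; rewrite !size_cat /= !size_cat !size_map !size_cat /=; clear; lia.
Qed.

(** The second determinant belongs to a permutation matrix. Multiplying by its transpose lists the
    columns as [ys ++ zs] and makes the first matrix block triangular. *)
Lemma row_det_block (a b : nat) (em : m = (a + b)%N) (L : seq 'rV[R]_m)
    (ys zs : seq 'I_m) (c : 'I_m -> R) (x0 : 'I_m) :
  size L = a -> size ys = a -> size zs = b -> uniq (ys ++ zs) ->
  row_det (L ++ [seq c z *: delta_mx 0 z | z <- zs]) *
    row_det [seq (delta_mx 0 y : 'rV[R]_m) | y <- ys ++ zs] =
  \det (\matrix_(i < a, j < a) (nth 0 L i) 0 (nth x0 ys j)) * \prod_(z <- zs) c z.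
Proof.
case: m / (esym em) L ys zs c x0 => {em} L ys zs c x0 szL szy szz uq.
rewrite /row_det -(det_tr (\matrix_(i < _) nth 0 [seq delta_mx 0 y | y <- ys ++ zs] i)) -det_mulmx.
set M := (X in X *m _); set P := (X in _ *m X).
have MP i j : (M *m P) i j = (nth 0 (L ++ [seq c z *: delta_mx 0 z | z <- zs]) i) 0 (nth x0 (ys ++ zs) j).
  rewrite !mxE (bigD1 (nth x0 (ys ++ zs) j)) //= big1 ?addr0 => [|l nl]; rewrite !mxE;
    rewrite (nth_map x0) ?size_cat ?szy ?szz // !mxE eqxx.
    by rewrite eqxx mulr1.
  by rewrite (negPf nl) mulr0.
have -> : M *m P = block_mx (\matrix_(i < a, j < a) (nth 0 L i) 0 (nth x0 ys j))
    (\matrix_(i < a, j < b) (nth 0 L i) 0 (nth x0 zs j)) 0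
    (diag_mx (\row_(j < b) c (nth x0 zs j))).
  apply/matrixP => i j; rewrite MP.
  case: (split_ordP i) => i' ->; case: (split_ordP j) => j' ->;
    rewrite ?block_mxEul ?block_mxEur ?block_mxEdl ?block_mxEdr /=
      !nth_cat szL szy ?ltn_ord ?ltnNge ?leq_addr /= ?addKn.
  - by rewrite !mxE.
  - by rewrite !mxE.
  - rewrite (nth_map x0) ?szz // !mxE eqxx.
    have -> : nth x0 ys j' == nth x0 zs i' = false.
      apply: contraTF uq => /eqP eqyz; rewrite cat_uniq !negb_and negbK.
      apply/orP; right; apply/orP; left; apply/hasP.
      exists (nth x0 zs i'); first by rewrite mem_nth ?szz.
      by rewrite -eqyz mem_nth ?szy.
    by rewrite mulr0.
  - rewrite (nth_map x0) ?szz // !mxE eqxx nth_uniq ?szz //; last first.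
      by move: uq; rewrite cat_uniq => /and3P[].
    have -> : (j' == i' :> nat) = (i' == j') by rewrite eq_sym.
    by case: eqVneq => [->|_]; rewrite ?mulr1 ?mulr0.
rewrite det_ublock det_diag; congr (_ * _).
rewrite (big_nth x0) szz big_mkord; apply: eq_bigr => z _; by rewrite mxE.
Qed.

End Fold.

Section Minors.
Variables (R : comNzRingType) (m : nat).

Lemma minorE k (B : 'M[R]_m) (X Y : {set 'I_m}) (x0 : 'I_m) : #|X| = k -> #|Y| = k ->
  minor B X Y = \det (\matrix_(i < k, j < k) B (nth x0 (enum X) i) (nth x0 (enum Y) j)).
Proof.
move=> eX eY; subst k; rewrite /minor.
have detE a b (e : b = a) (M : 'M[R]_(a, b)) :
    \det (conform_mx (0 : 'M[R]_a) M) = \det (castmx (erefl a, e) M).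
  by case: a / e M => M; rewrite conform_mx_id castmx_id.
rewrite (detE _ _ eY); congr (\det _); apply/matrixP => i j.
by rewrite castmxE !mxE !(enum_val_nth x0) cast_ord_id.
Qed.

Lemma in_fold_lshift (X Y : {set 'I_m}) (i : 'I_m) : (lshift m i \in fold_index X Y) = (i \in X).
Proof.
rewrite inE mem_imset; last exact: lshift_inj.
case: (boolP (i \in X)) => //= _; apply/negbTE/imsetP => -[y _ /(congr1 val)] /=.
by have := ltn_ord i; have := ltn_ord y; clear; lia.
Qed.

Lemma rev_lshift (y : 'I_m) : rev_ord (lshift m y) = rshift m (rev_ord y).
Proof. by apply: val_inj => /=; have := ltn_ord y; clear; lia. Qed.

Lemma in_fold_rshift (X Y : {set 'I_m}) (j : 'I_m) :
  (rshift m j \in fold_index X Y) = (rev_ord j \in Y).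
Proof.
rewrite inE; have -> : (rshift m j \in [set lshift m x | x in X]) = false.
  by apply/negbTE/imsetP => -[x _ /eqP]; rewrite eq_rlshift.
have -> : rshift m j = rev_ord (lshift m (rev_ord j)) by rewrite rev_lshift rev_ordK.
by rewrite (mem_imset _ _ (inj_comp rev_ord_inj (@lshift_inj _ _))).
Qed.

Let col_enum (Y : {set 'I_m}) := [seq j <- enum 'I_m | rev_ord j \in Y].

Lemma enum_fold_index (X Y : {set 'I_m}) : enum (fold_index X Y) =
  [seq lshift m i | i <- enum X] ++ [seq rshift m j | j <- col_enum Y].
Proof.
apply: eq_sorted_enum.
  apply: sorted_cat_lt.
  - by rewrite sorted_map; exact: sorted_enum_set.
  - rewrite sorted_map; apply: sub_sorted (sorted_filter_enum _) => i j.
    by rewrite /relpre /ord_lt /= ltn_add2l.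
  by move=> x y /mapP[i _ ->] /mapP[j _ ->] /=; have := ltn_ord i; clear; lia.
move=> x; rewrite mem_cat; case: (split_ordP x) => i ->.
  rewrite in_fold_lshift mem_map ?mem_enum; last exact: lshift_inj.
  by case: (i \in X) => //=; apply/negbTE/mapP => -[j _ /eqP]; rewrite eq_lrshift.
rewrite in_fold_rshift mem_map; last exact: rshift_inj.
rewrite mem_filter mem_enum andbT.
have -> // : (rshift m i \in [seq lshift m j | j <- enum X]) = false.
by apply/negbTE/mapP => -[j _ /eqP]; rewrite eq_rlshift.
Qed.

Lemma size_col_enum (Y : {set 'I_m}) : size (col_enum Y) = #|Y|.
Proof.
rewrite -(card_preimset _ (@rev_ord_inj m)) cardE /enum_mem -enumT; congr size.
by apply: eq_filter => j; rewrite -[RHS]/(j \in _) inE.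
Qed.

Lemma card_fold_index (X Y : {set 'I_m}) : #|fold_index X Y| = (#|X| + #|Y|)%N.
Proof. by rewrite cardE enum_fold_index size_cat !size_map -cardE size_col_enum. Qed.

(* The signs make the maximal minor of [A] stacked over signed unit rows on
   [fold_index X (~: Y)] equal to [det A(X|Y)]. *)
Definition fold_rows (A : 'M[R]_m) (x : 'I_(m + m)) : 'rV[R]_m :=
  match split x with
  | inl i => row i A
  | inr j => (-1) ^+ j *: delta_mx 0 (rev_ord j)
  end.

Lemma minor_fold (A : 'M[R]_m) (X Y : {set 'I_m}) (x0 : 'I_m) : #|X| = #|Y| ->
  minor A X Y = plucker (fold_rows A) (fold_index X (~: Y)).
Proof.
move=> cXY; pose zs := [seq rev_ord j | j <- col_enum (~: Y)].
(* This is the sign that [fold_rows] puts on the unit row of column [z]. The product of these signs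
   is also the sign from [row_det_delta], so the two cancel. *)
pose c (z : 'I_m) : R := (-1) ^+ (m - z.+1).
pose L := [seq row i A | i <- enum X].
have plE : plucker (fold_rows A) (fold_index X (~: Y)) =
    row_det (L ++ [seq c z *: delta_mx 0 z | z <- zs]).
  rewrite /plucker enum_fold_index map_cat -!map_comp; congr (row_det (_ ++ _)).
    apply: eq_map => i; rewrite /= /fold_rows.
    by rewrite -[lshift m i]/(unsplit (inl i)) unsplitK.
  apply: eq_map => j; rewrite /= /fold_rows.
  rewrite -[rshift m j]/(unsplit (inr j)) unsplitK /c /=; congr (_ ^+ _ *: _).
  by have := ltn_ord j; clear; lia.
have inzs y : (y \in zs) = (y \notin Y).
  by rewrite -{1}(rev_ordK y) (mem_map (@rev_ord_inj m)) mem_filter mem_enum andbT rev_ordK inE.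
have zsS : sorted (fun x y => @ord_lt m y x) zs.
  rewrite /zs sorted_map; apply: sub_sorted (sorted_filter_enum _) => i j.
  by rewrite /relpre /ord_lt /=; have := ltn_ord j; clear; lia.
have uq : uniq (enum Y ++ zs).
  rewrite cat_uniq enum_uniq (map_inj_uniq (@rev_ord_inj m)) (filter_uniq _ (enum_uniq _)) andbT /=.
  by apply/hasPn => y; rewrite inzs mem_enum.
have szz : size zs = #|~: Y| by rewrite size_map size_col_enum.
have em : m = (#|Y| + #|~: Y|)%N by rewrite cardsC card_ord.
have szL : size L = #|Y| by rewrite size_map -cardE.
have := (row_det_block em c x0 szL (esym (cardE _)) szz uq).
rewrite row_det_delta ?sorted_enum_set //; last first.
  by move=> y; rewrite mem_enum inzs; case: (y \in Y).
rewrite -plE prodrXr => /(congr1 (fun x => x * (-1) ^+ (\sum_(z <- zs) (m - z.+1)))).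
rewrite -!mulrA -exprD (addnn (\sum_(z <- zs) _)) -mul2n exprM sqrrN !expr1n !mulr1 => ->.
rewrite (minorE A x0 cXY (erefl _)); congr (\det _); apply/matrixP => i j.
have lti : (i < size (enum X))%N by rewrite -cardE cXY.
by rewrite !mxE (nth_map x0) // mxE.
Qed.

End Minors.

Section FoldTN.
Variables (R : realType) (m : nat).

(** With [unfold_cols], the inverse of sending [X] and [Y] to [fold_index X (~: Y)]: every set of
    [m] rows of the folded matrix comes from a minor of [A]. *)
Definition unfold_rows (G : {set 'I_(m + m)}) : {set 'I_m} := [set i | lshift m i \in G].
Definition unfold_cols (G : {set 'I_(m + m)}) : {set 'I_m} :=
  [set y | rev_ord (lshift m y) \notin G].

Lemma unfoldK (G : {set 'I_(m + m)}) : fold_index (unfold_rows G) (~: unfold_cols G) = G.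
Proof.
apply/setP => x; case: (split_ordP x) => i ->; first by rewrite in_fold_lshift inE.
by rewrite in_fold_rshift !inE negbK rev_lshift rev_ordK.
Qed.

Lemma card_unfold (G : {set 'I_(m + m)}) : #|G| = m -> #|unfold_rows G| = #|unfold_cols G|.
Proof.
move=> cG; have := card_fold_index (unfold_rows G) (~: unfold_cols G); rewrite unfoldK cG.
by have := cardsC (unfold_cols G); rewrite card_ord => eC eG; apply/(@addIn #|~: unfold_cols G|); rewrite -eG eC.
Qed.

Lemma fold_rows_ge0 (A : 'M[R]_m) (x0 : 'I_m) : totally_nonnegative A -> plucker_ge0 (fold_rows A).
Proof.
move=> tnA G cG; rewrite -(unfoldK G) -minor_fold ?card_unfold //.
by apply: tnA; rewrite card_unfold.
Qed.

End FoldTN.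

(** * Annihilating neighbouring sites *)

Section Collapse.
Variables (N mid : nat) (V : {set 'I_N} -> {set 'I_N} -> {set 'I_N} -> {set 'I_N} -> Prop).
Implicit Types (G H : {set 'I_N}) (u v x y i j : 'I_N).

Let act2 u v G1 G2 : nat := (replaceable u v G1 + replaceable u v G2)%N.

(* [V] abstracts validity of the inequality for the four sets.  Moving an element
   from [mid] to [mid - 1] is excluded: at the fold of [fold_rows] only the
   opposite move is induced by a deformation preserving total nonnegativity. *)
Hypothesis V_step : forall u v G1 G2 H1 H2,
  consecutive u v -> ~~ ((u == mid :> nat) && (v.+1 == mid :> nat)) ->
  eq_multiset_union G1 G2 H1 H2 -> V G1 G2 H1 H2 ->
  (act2 u v H1 H2 < act2 u v G1 G2)%N = false /\
  (act2 u v G1 G2 = act2 u v H1 H2 ->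
   V (replace u v G1) (replace u v G2) (replace u v H1) (replace u v H2)).

Lemma consecutive_neq u v : consecutive u v -> v != u.
Proof. by apply: contraTneq => ->; rewrite /consecutive; clear; lia. Qed.

Lemma count_in_replace u v G a b : u != v -> (a <= u < b)%N -> (a <= v < b)%N ->
  count_in (replace u v G) a b = count_in G a b.
Proof.
move=> uv ua va; rewrite /count_in.
have -> : [set x in replace u v G | (a <= x < b)%N] = replace u v [set x in G | (a <= x < b)%N].
  apply/setP => x; rewrite inE !in_replace // !inE ua va !andbT.
  by case: eqVneq => [->|_]; rewrite ?va ?andbT //; case: eqVneq => [->|_]; rewrite ?ua ?andbT.
by rewrite /replace; case: ifP => // /andP[uG vG]; rewrite card_exchange.
Qed.

Lemma eqm_replace u v G1 G2 H1 H2 : u != v -> eq_multiset_union G1 G2 H1 H2 ->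
  act2 u v G1 G2 = act2 u v H1 H2 ->
  eq_multiset_union (replace u v G1) (replace u v G2) (replace u v H1) (replace u v H2).
Proof.
move=> uv eqm; rewrite /act2 /replaceable => eqa x; rewrite !in_replace //.
have := eqm x; have [->|_] := eqVneq x v; last have [->|_] := eqVneq x u; move: eqa (eqm u) (eqm v) => //.
all: case: (u \in G1); case: (v \in G1); case: (u \in G2); case: (v \in G2);
  case: (u \in H1); case: (v \in H1); case: (u \in H2); case: (v \in H2) => //.
Qed.

Let diff G1 G2 x : bool := (x \in G1) (+) (x \in G2).

Let ndiff a b G1 G2 : nat := \sum_(x : 'I_N | (a <= x < b)%N) diff G1 G2 x.

Lemma ndiff_replace a b u v G1 G2 : u != v -> (a <= u < b)%N -> (a <= v < b)%N ->
  (ndiff a b (replace u v G1) (replace u v G2) + (diff G1 G2 u + diff G1 G2 v) =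
   ndiff a b G1 G2 + (diff (replace u v G1) (replace u v G2) u +
                      diff (replace u v G1) (replace u v G2) v))%N.
Proof.
move=> uv ua va; have vu : v != u by rewrite eq_sym.
have sumE (F : 'I_N -> nat) : \sum_(x : 'I_N | (a <= x < b)%N) F x =
    (F u + (F v + \sum_(x : 'I_N | (a <= x < b)%N && (x != u) && (x != v)) F x))%N.
  by rewrite (bigD1 u ua) (bigD1 v) ?va.
rewrite /ndiff !sumE.
have -> : (\sum_(x : 'I_N | (a <= x < b)%N && (x != u) && (x != v))
     (diff (replace u v G1) (replace u v G2) x : nat) =
   \sum_(x : 'I_N | (a <= x < b)%N && (x != u) && (x != v)) (diff G1 G2 x : nat))%N.
  apply: eq_bigr => x /andP[/andP[_ xu] xv].
  by rewrite /diff !in_replace // (negPf xu) (negPf xv).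
clear; lia.
Qed.

(** Sites between [i] and [j] lie in both sets or in neither, so one end can be swapped step by step
    towards the other. When they are adjacent, moving [i] to [j] puts [j] in both sets and [i] in
    neither. *)
Lemma collapse_pair a b d i j G1 G2 H1 H2 : V G1 G2 H1 H2 -> eq_multiset_union G1 G2 H1 H2 ->
  (a <= i)%N -> (j < b)%N -> j = (i + d).+1 :> nat ->
  diff G1 G2 i -> diff G1 G2 j -> (i \in G1) != (j \in G1) ->
  (forall x, (i < x < j)%N -> ~~ diff G1 G2 x) ->
  exists G1' G2' H1' H2', [/\ V G1' G2' H1' H2', eq_multiset_union G1' G2' H1' H2',
    count_in G1' a b = count_in G1 a b /\ count_in G2' a b = count_in G2 a b,
    count_in H1' a b = count_in H1 a b /\ count_in H2' a b = count_in H2 a b &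
    (ndiff a b G1' G2' < ndiff a b G1 G2)%N].
Proof.
elim: d i j G1 G2 H1 H2 => [|d IH] i j G1 G2 H1 H2 VGH eqm ai jb jE di dj ij between.
  rewrite addn0 in jE.
  have nij : i != j by apply: contra_eqN jE => /eqP ->; clear; lia.
  have cij : consecutive i j by rewrite /consecutive jE eqxx.
  have ia : (a <= i < b)%N by move: ai jb; rewrite jE; clear; lia.
  have ja : (a <= j < b)%N by move: ai jb; rewrite jE; clear; lia.
  have [|lt VGH'] := V_step cij _ eqm VGH; first by rewrite jE; clear; lia.
  (* If [i] and [j] lay in the same right-hand set, nothing there could move, and [V_step] would be
     violated. *)
  have eqa : act2 i j G1 G2 = act2 i j H1 H2.
    move: lt (eqm i) (eqm j) di dj ij; rewrite /act2 /replaceable /diff.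
    by case: (i \in G1); case: (j \in G1); case: (i \in G2); case: (j \in G2);
      case: (i \in H1); case: (j \in H1); case: (i \in H2); case: (j \in H2).
  exists (replace i j G1), (replace i j G2), (replace i j H1), (replace i j H2).
  split; rewrite ?count_in_replace //; [exact: VGH' | exact: eqm_replace |].
  have := ndiff_replace G1 G2 nij ia ja; rewrite /diff !in_replace // !eqxx (negPf nij).
  move: di dj ij; rewrite /diff.
  by case: (i \in G1); case: (j \in G1); case: (i \in G2); case: (j \in G2) => //= _ _ _; clear; lia.
have key u v (i' j' : 'I_N) : consecutive u v -> ~~ ((u == mid :> nat) && (v.+1 == mid :> nat)) ->
    (a <= u < b)%N -> (a <= v < b)%N -> (a <= i')%N -> (j' < b)%N ->
    act2 u v G1 G2 = act2 u v H1 H2 ->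
    j' = (i' + d).+1 :> nat ->
    diff (replace u v G1) (replace u v G2) i' -> diff (replace u v G1) (replace u v G2) j' ->
    (i' \in replace u v G1) != (j' \in replace u v G1) ->
    (forall x, (i' < x < j')%N -> x != u /\ x != v /\ (i < x < j)%N) ->
    (diff (replace u v G1) (replace u v G2) u + diff (replace u v G1) (replace u v G2) v <=
     diff G1 G2 u + diff G1 G2 v)%N ->
  exists G1' G2' H1' H2', [/\ V G1' G2' H1' H2', eq_multiset_union G1' G2' H1' H2',
    count_in G1' a b = count_in G1 a b /\ count_in G2' a b = count_in G2 a b,
    count_in H1' a b = count_in H1 a b /\ count_in H2' a b = count_in H2 a b &
    (ndiff a b G1' G2' < ndiff a b G1 G2)%N].
  move=> cuv nm ua va i'a j'b eqa j'E di' dj' ij' btw' le.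
  have uv : u != v by rewrite eq_sym consecutive_neq.
  have [_ /(_ eqa) VGH'] := V_step cuv nm eqm VGH.
  have eqm' := eqm_replace uv eqm eqa.
  have [|G1' [G2' [H1' [H2' [V' e' c1 c2 lt]]]]] := IH i' j' _ _ _ _ VGH' eqm' i'a j'b j'E di' dj' ij'.
    move=> x /btw'[xu [xv /between]].
    by rewrite /diff !in_replace // (negPf xu) (negPf xv).
  exists G1', G2', H1', H2'; rewrite !count_in_replace // in c1 c2; split=> //.
  apply: leq_trans lt _.
  have := ndiff_replace G1 G2 uv ua va; move: le; clear; lia.
(* Normally [i] is shifted upwards. If that would cross [mid], then [j] is shifted downwards instead
   and stays above the fold; so the forbidden move never occurs. *)
have [im|im] := boolP (i.+1 == mid).
  have ltx : (j.-1 < N)%N by have := ltn_ord j; clear; lia.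
  pose x := Ordinal ltx.
  have xE : x.+1 = j by rewrite /= jE.
  have nxj : x != j by apply: contra_eqN xE => /eqP ->; clear; lia.
  have njx : j != x by rewrite eq_sym.
  have nix : i != x by apply: contra_eqN jE => /eqP ->; rewrite -xE; clear; lia.
  have nij : i != j by apply: contra_eqN jE => /eqP ->; clear; lia.
  have xa : (a <= x < b)%N by move: ai jb jE xE; clear; lia.
  have ja : (a <= j < b)%N by move: ai jb jE xE; clear; lia.
  have : ~~ diff G1 G2 x by apply: between; move: jE xE; clear; lia.
  have jxE : x = (i + d).+1 :> nat by move: jE xE; clear; lia.
  have btw' y : (i < y < x)%N -> [/\ y != j, y != x & (i < y < j)%N].
    move=> yx; split; last by move: yx xE; clear; lia.
      by apply: contraTneq yx => ->; rewrite -xE; clear; lia.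
    by apply: contraTneq yx => ->; clear; lia.
  have ia : (a <= i < b)%N by move: ai jb jE xE; clear; lia.
  have simp := (eqxx, negPf nxj, negPf njx, negPf nix, negPf nij).
  case xG : (x \in G1) => dx.
    apply: (key x j i x) => //.
    - by rewrite /consecutive xE eqxx ?orbT.
    - by move: im xE jE; clear; lia.
    - by case/andP: xa.
    - by move: (eqm x) (eqm j) dx di dj ij; rewrite /act2 /replaceable /diff xG;
      case: (j \in G1); case: (j \in G2); case: (x \in G2);
      case: (x \in H1); case: (j \in H1); case: (x \in H2); case: (j \in H2).
    - by move: dx di dj ij; rewrite /diff !in_replace // ?simp xG;
        case: (i \in G1); case: (i \in G2); case: (j \in G1); case: (j \in G2); case: (x \in G2).
    - by move: dx di dj ij; rewrite /diff !in_replace // ?simp xG;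
        case: (i \in G1); case: (i \in G2); case: (j \in G1); case: (j \in G2); case: (x \in G2).
    - by move: dx di dj ij; rewrite /diff !in_replace // ?simp xG;
        case: (i \in G1); case: (i \in G2); case: (j \in G1); case: (j \in G2); case: (x \in G2).
    - by move=> y /btw'[].
    - by move: dx di dj ij; rewrite /diff !in_replace // ?simp xG;
        case: (i \in G1); case: (i \in G2); case: (j \in G1); case: (j \in G2); case: (x \in G2).
  apply: (key j x i x) => //.
  - by rewrite /consecutive xE eqxx ?orbT.
  - by move: im xE jE; clear; lia.
  - by case/andP: xa.
  - by move: (eqm x) (eqm j) dx di dj ij; rewrite /act2 /replaceable /diff xG;
      case: (j \in G1); case: (j \in G2); case: (x \in G2);
      case: (x \in H1); case: (j \in H1); case: (x \in H2); case: (j \in H2).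
  - by move: dx di dj ij; rewrite /diff !in_replace // ?simp xG;
        case: (i \in G1); case: (i \in G2); case: (j \in G1); case: (j \in G2); case: (x \in G2).
  - by move: dx di dj ij; rewrite /diff !in_replace // ?simp xG;
        case: (i \in G1); case: (i \in G2); case: (j \in G1); case: (j \in G2); case: (x \in G2).
  - by move: dx di dj ij; rewrite /diff !in_replace // ?simp xG;
        case: (i \in G1); case: (i \in G2); case: (j \in G1); case: (j \in G2); case: (x \in G2).
  - by move=> y /btw'[].
  - by move: dx di dj ij; rewrite /diff !in_replace // ?simp xG;
        case: (i \in G1); case: (i \in G2); case: (j \in G1); case: (j \in G2); case: (x \in G2).
have ltx : (i.+1 < N)%N by have := ltn_ord j; rewrite jE; clear; lia.
pose x := Ordinal ltx.
have xE : i.+1 = x by [].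
have nxi : x != i by apply: contra_eqN xE => /eqP ->; clear; lia.
have nix : i != x by rewrite eq_sym.
have njx : j != x by apply: contra_eqN jE => /eqP ->; rewrite -xE; clear; lia.
have nji : j != i by apply: contra_eqN jE => /eqP ->; clear; lia.
have xa : (a <= x < b)%N by move: ai jb jE xE; clear; lia.
have ja : (a <= j < b)%N by move: ai jb jE xE; clear; lia.
have ia : (a <= i < b)%N by move: ai jb jE xE; clear; lia.
have : ~~ diff G1 G2 x by apply: between; move: jE xE; clear; lia.
have jxE : j = (x + d).+1 :> nat by move: jE xE; clear; lia.
have btw' y : (x < y < j)%N -> [/\ y != i, y != x & (i < y < j)%N].
  move=> yx; split; last by move: yx xE; clear; lia.
    by apply: contraTneq yx => ->; rewrite -xE; clear; lia.
  by apply: contraTneq yx => ->; clear; lia.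
have simp := (eqxx, negPf nxi, negPf njx, negPf nix, negPf nji).
case xG : (x \in G1) => dx.
  apply: (key x i x j) => //.
  - by rewrite /consecutive xE eqxx ?orbT.
  - by move: im xE jE; clear; lia.
  - by case/andP: xa.
  - by move: (eqm x) (eqm i) dx di dj ij; rewrite /act2 /replaceable /diff xG;
    case: (i \in G1); case: (i \in G2); case: (x \in G2);
    case: (x \in H1); case: (i \in H1); case: (x \in H2); case: (i \in H2).
  - by move: dx di dj ij; rewrite /diff !in_replace // ?simp xG;
      case: (i \in G1); case: (i \in G2); case: (j \in G1); case: (j \in G2); case: (x \in G2).
  - by move: dx di dj ij; rewrite /diff !in_replace // ?simp xG;
      case: (i \in G1); case: (i \in G2); case: (j \in G1); case: (j \in G2); case: (x \in G2).
  - by move: dx di dj ij; rewrite /diff !in_replace // ?simp xG;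
      case: (i \in G1); case: (i \in G2); case: (j \in G1); case: (j \in G2); case: (x \in G2).
  - by move=> y /btw'[].
  - by move: dx di dj ij; rewrite /diff !in_replace // ?simp xG;
      case: (i \in G1); case: (i \in G2); case: (j \in G1); case: (j \in G2); case: (x \in G2).
apply: (key i x x j) => //.
- by rewrite /consecutive xE eqxx ?orbT.
- by move: im xE jE; clear; lia.
- by case/andP: xa.
- by move: (eqm x) (eqm i) dx di dj ij; rewrite /act2 /replaceable /diff xG;
      case: (i \in G1); case: (i \in G2); case: (x \in G2);
      case: (x \in H1); case: (i \in H1); case: (x \in H2); case: (i \in H2).
- by move: dx di dj ij; rewrite /diff !in_replace // ?simp xG;
        case: (i \in G1); case: (i \in G2); case: (j \in G1); case: (j \in G2); case: (x \in G2).
- by move: dx di dj ij; rewrite /diff !in_replace // ?simp xG;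
        case: (i \in G1); case: (i \in G2); case: (j \in G1); case: (j \in G2); case: (x \in G2).
- by move: dx di dj ij; rewrite /diff !in_replace // ?simp xG;
        case: (i \in G1); case: (i \in G2); case: (j \in G1); case: (j \in G2); case: (x \in G2).
- by move=> y /btw'[].
- by move: dx di dj ij; rewrite /diff !in_replace // ?simp xG;
        case: (i \in G1); case: (i \in G2); case: (j \in G1); case: (j \in G2); case: (x \in G2).
Qed.

Lemma count_in_sub G H a b : (forall x, (a <= x < b)%N -> x \in G -> x \in H) ->
  (count_in G a b <= count_in H a b)%N.
Proof.
by move=> GH; apply/subset_leq_card/subsetP => x; rewrite !inE => /andP[xG xab]; rewrite xab GH.
Qed.

(** If only one colour is left in the interval, the larger left-hand set contains all elements of
    the union there, and the right-hand pair has the same union. Otherwise a closest pair of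
    opposite colours has no coloured site in between and can be annihilated without changing the
    four counts. *)
Lemma collapse a b G1 G2 H1 H2 : V G1 G2 H1 H2 -> eq_multiset_union G1 G2 H1 H2 ->
  (maxn (count_in H1 a b) (count_in H2 a b) <= maxn (count_in G1 a b) (count_in G2 a b))%N.
Proof.
have [n] := ubnP (ndiff a b G1 G2); elim: n G1 G2 H1 H2 => // n IH G1 G2 H1 H2 len VGH eqm.
pose only1 := [pred x : 'I_N | (a <= x < b)%N && ((x \in G1) && (x \notin G2))].
pose only2 := [pred x : 'I_N | (a <= x < b)%N && ((x \in G2) && (x \notin G1))].
have mono x : (x \in H1) || (x \in H2) = (x \in G1) || (x \in G2).
  by have := eqm x; do 4 case: (_ \in _).
case: (pickP only1) => [x0 x0P|no1]; last first.
  apply: (@leq_trans (count_in G2 a b)); last exact: leq_maxr.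
  have sub x : (a <= x < b)%N -> (x \in G1) || (x \in G2) -> x \in G2.
    by move=> xab; have := no1 x; rewrite /= xab /=; case: (x \in G2); case: (x \in G1).
  rewrite geq_max !count_in_sub // => x xab xH; apply: sub => //; rewrite -mono xH ?orbT //.
case: (pickP only2) => [y0 y0P|no2]; last first.
  apply: (@leq_trans (count_in G1 a b)); last exact: leq_maxl.
  have sub x : (a <= x < b)%N -> (x \in G1) || (x \in G2) -> x \in G1.
    by move=> xab; have := no2 x; rewrite /= xab /=; case: (x \in G2); case: (x \in G1).
  rewrite geq_max !count_in_sub // => x xab xH; apply: sub => //; rewrite -mono xH ?orbT //.
pose dist (q : 'I_N * 'I_N) := ((q.1 - q.2) + (q.2 - q.1))%N.
pose good (q : 'I_N * 'I_N) := only1 q.1 && only2 q.2.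
have g0 : good (x0, y0) by rewrite /good x0P y0P.
case: (arg_minnP dist g0) => -[x y] /andP[/= xP yP] qmin.
case/andP: xP => xab /andP[x1 x2]; case/andP: yP => yab /andP[y2 y1].
have nb (z : 'I_N) : (minn x y < z < maxn x y)%N -> ~~ diff G1 G2 z.
  move=> zb; have zab : (a <= z < b)%N by move: zb xab yab; clear; lia.
  apply/negP; rewrite /diff; case z1 : (z \in G1); case z2 : (z \in G2) => // _.
    have := qmin (z, y); rewrite /good /dist /= zab z1 z2 yab y2 y1 /= => /(_ isT).
    by move: zb; clear; lia.
  have := qmin (x, z); rewrite /good /dist /= zab z1 z2 xab x2 x1 /= => /(_ isT).
  by move: zb; clear; lia.
have [i [j [ltij ij [di dj] [ai jb] between]]] : exists i j : 'I_N, [/\ (i < j)%N,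
    (i \in G1) != (j \in G1), diff G1 G2 i /\ diff G1 G2 j, (a <= i)%N /\ (j < b)%N &
    forall z : 'I_N, (i < z < j)%N -> ~~ diff G1 G2 z].
  case: (ltngtP x y) => [lt|lt|eqxy].
  - exists x, y; rewrite /diff x1 (negPf x2) y2 (negPf y1); split=> //.
      by case/andP: xab; case/andP: yab.
    by move=> z zb; apply: nb; move: zb lt; clear; lia.
  - exists y, x; rewrite /diff x1 (negPf x2) y2 (negPf y1); split=> //.
      by case/andP: xab; case/andP: yab.
    by move=> z zb; apply: nb; move: zb lt; clear; lia.
  by move/val_inj: eqxy x2 => ->; rewrite y2.
have jE : j = (i + (j - i).-1).+1 :> nat by move: ltij; clear; lia.
have [G1' [G2' [H1' [H2' [V' eqm' [c1 c2] [c3 c4] lt]]]]] :=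
  collapse_pair VGH eqm ai jb jE di dj ij between.
have := IH _ _ _ _ (leq_trans lt _) V' eqm'; rewrite c1 c2 c3 c4; apply.
by rewrite -ltnS.
Qed.

End Collapse.

(** * Index operations as leading coefficients *)

Section LeadingCoefficient.
Variable R : realFieldType.

Lemma coef_ge0_of_horner_ge0 (q : {poly R}) d : (size q <= d.+1)%N ->
  (forall t, 0 <= t -> 0 <= q.[t]) -> 0 <= q`_d.
Proof.
case: d => [|d] szq q_ge0.
  by have := q_ge0 0 (lexx 0); rewrite horner_coef0.
rewrite leNgt; apply/negP => qd_lt0.
pose C := \sum_(i < d.+1) `|q`_i|.
have C0 : 0 <= C by apply: sumr_ge0 => i _; exact: normr_ge0.
pose t := 1 + C / - q`_d.+1.
have t1 : 1 <= t by rewrite lerDl divr_ge0 // oppr_ge0 ltW.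
have t0 : 0 <= t by exact: le_trans ler01 t1.
have := q_ge0 t t0; apply/negP; rewrite -ltNge.
have -> : q.[t] = \sum_(i < d.+2) q`_i * t ^+ i by exact: horner_coef_wide.
rewrite big_ord_recr /=.
apply: (@le_lt_trans _ _ (C * t ^+ d + q`_d.+1 * t ^+ d.+1)).
  rewrite lerD2r /C mulr_suml; apply: ler_sum => i _.
  apply: (@le_trans _ _ (`|q`_i| * t ^+ i)); first by rewrite ler_wpM2r ?exprn_ge0 ?ler_norm.
  by rewrite ler_wpM2l // ler_weXn2l // -ltnS.
rewrite exprS mulrA -mulrDl pmulr_llt0; last by rewrite exprn_gt0 // (lt_le_trans ltr01).
by rewrite /t mulrDr mulr1 mulrCA invrN mulrN divff ?lt_eqF // mulrN1 addrC subrK.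
Qed.

Section Deformation.
Variable Sym : Type.
Implicit Types (val : Sym -> R) (l : seq Sym) (o : option (seq Sym)).

(** [None] stands for a product that has been replaced by 0. *)
Definition oval val o : R := if o is Some l then \prod_(s <- l) val s else 0.
Definition oseq o : seq (seq Sym) := if o is Some l then [:: l] else [::].

Variables (act : pred Sym) (mv : Sym -> Sym) (wf : pred Sym).

Definition oop (d : nat) o : option (seq Sym) :=
  if o is Some l then if count act l == d then Some (map mv l) else None else None.

(** The class of valuations is kept abstract to cover index operations on minors, scalings of a row
    or column (with [mv] the identity) and deformations of the folded matrix. *)
Variable Phi : (Sym -> R) -> Prop.
Hypothesis mv_id : forall s, ~~ act s -> mv s = s.
Hypothesis Phi_deform : forall val t, Phi val -> 0 <= t -> exists2 val', Phi val' &
  forall s, wf s -> val' s = val s + t * ((act s)%:R * val (mv s)).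

Let sym_poly val s : {poly R} := (val s)%:P + ((act s)%:R * val (mv s))%:P * 'X.

Let seq_poly val l : {poly R} := \prod_(s <- l) sym_poly val s.

Let size_sym_poly val s : (size (sym_poly val s) <= (act s).+1)%N.
Proof.
rewrite /sym_poly; case: (act s) => /=.
  by rewrite addrC size_MXaddC; case: ifP => // _; rewrite ltnS size_polyC; case: (_ != _).
by rewrite mul0r mul0r addr0 size_polyC; case: (_ != _).
Qed.

Let size_seq_poly val l : (size (seq_poly val l) <= (count act l).+1)%N.
Proof.
elim: l => [|s l IH] /=; first by rewrite /seq_poly big_nil size_poly1.
have -> : seq_poly val (s :: l) = sym_poly val s * seq_poly val l by rewrite /seq_poly big_cons.
rewrite (leq_trans (size_polyMleq _ _)) //.
have := size_sym_poly val s; move: IH.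
set a := size (seq_poly val l); set b := size (sym_poly val s).
by move: (a) (b) (act s : nat) (count _ _) => {}a {}b x y; clear; lia.
Qed.

Let coef_seq_poly val l : (seq_poly val l)`_(count act l) = \prod_(s <- map mv l) val s.
Proof.
elim: l => [|s l IH] /=; first by rewrite /seq_poly !big_nil coef1.
have -> : seq_poly val (s :: l) = sym_poly val s * seq_poly val l by rewrite /seq_poly big_cons.
rewrite big_cons -IH /sym_poly mulrDl coefD coefCM -mulrA coefCM ['X * _]mulrC coefMX.
case: (boolP (act s)) => as_ /=; last by rewrite !mul0r addr0 mv_id.
by rewrite mul1r nth_default ?mulr0 ?add0r //; exact: size_seq_poly.
Qed.

Let opoly val o : {poly R} := if o is Some l then seq_poly val l else 0.

Lemma leading_products o1 o2 : all wf (flatten (oseq o1 ++ oseq o2)) ->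
  (forall val, Phi val -> oval val o1 <= oval val o2) ->
  let d := (\max_(p <- oseq o1 ++ oseq o2) count act p)%N in
  forall val, Phi val -> oval val (oop d o1) <= oval val (oop d o2).
Proof.
move=> wfo le12 d val Pval.
have coefE o : (if o is Some l then count act l <= d else true)%N ->
   (size (opoly val o) <= d.+1)%N /\ (opoly val o)`_d = oval val (oop d o).
  case: o => [l|] /=; last by rewrite size_poly0 coef0.
  move=> led; split; first exact: leq_trans (size_seq_poly val l) _.
  case: eqP => [<-|/eqP ne]; first exact: coef_seq_poly.
  rewrite nth_default // (leq_trans (size_seq_poly val l)) //.
  by rewrite ltn_neqAle ne led.
have hornerE o t val' : all wf (flatten (oseq o)) ->
    (forall s, wf s -> val' s = val s + t * ((act s)%:R * val (mv s))) ->
    (opoly val o).[t] = oval val' o.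
  case: o => [l|] /= wfl E; last by rewrite horner0.
  rewrite cats0 in wfl; rewrite /seq_poly horner_prod.
  elim: l wfl => [|s l IH] /=; first by rewrite !big_nil.
  case/andP=> wfs /IH; rewrite !big_cons => ->; congr (_ * _).
  by rewrite /sym_poly !hornerE E // mulrC.
have wf12 : all wf (flatten (oseq o1)) && all wf (flatten (oseq o2)).
  by rewrite -all_cat -flatten_cat.
have [|sz1 c1] := coefE o1.
  by rewrite /d; case: (o1) => //= l; rewrite big_cons leq_maxl.
have [|sz2 c2] := coefE o2.
  by rewrite /d; case: (o2) => //= l; case: (o1) => [l'|] /=; rewrite !big_cons ?leq_max leqnn ?orbT.
rewrite -subr_ge0 -c1 -c2 -coefB; apply: coef_ge0_of_horner_ge0.
  by rewrite (leq_trans (size_polyD _ _)) // size_polyN geq_max sz1 sz2.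
move=> t t0; have [val' Pval' E] := Phi_deform Pval t0.
case/andP: wf12 => w1 w2; rewrite hornerD hornerN (hornerE _ _ _ w1 E) (hornerE _ _ _ w2 E).
by rewrite subr_ge0; exact: le12.
Qed.

End Deformation.
End LeadingCoefficient.

(** * Elementary row and column additions and their effect on minors *)

Section RowOperations.
Variable R : comNzRingType.

Lemma card_replace N (u v : 'I_N) (J : {set 'I_N}) : #|replace u v J| = #|J|.
Proof. by rewrite /replace; case: ifP => // /andP[uJ vJ]; rewrite card_exchange. Qed.

(** Between consecutive indices there is nothing to cross, so the exchange has sign [+1]. *)
Lemma plucker_row_add N k (f : 'I_N -> 'rV[R]_k) (u v : 'I_N) t (J : {set 'I_N}) :
  consecutive u v -> #|J| = k ->
  plucker (upd f u (t *: f v + f u)) J =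
  plucker f J + t * ((replaceable u v J)%:R * plucker f (replace u v J)).
Proof.
move=> cuv cJ; have vu := consecutive_neq cuv; rewrite /replace /replaceable.
have [uJ|uJ] /= := boolP (u \in J); last first.
  by rewrite plucker_upd_notin // mul0r mulr0 addr0.
rewrite plucker_upd_linear // plucker_upd_id addrC; congr (_ + _ * _).
have [vJ|vJ] /= := boolP (v \in J); first by rewrite plucker_upd_dup // mul0r.
rewrite plucker_exchange // mul1r (_ : [set x in J | btw u v x] = set0) ?cards0 ?mul1r //.
apply/setP => x; rewrite !inE /btw; apply/negbTE.
by move: cuv; rewrite /consecutive negb_and; case: (x \in J) => //=; clear; lia.
Qed.

Variable m : nat.
Implicit Types (B : 'M[R]_m) (X Y : {set 'I_m}).

Lemma minor_plucker k B X Y (x0 : 'I_m) : #|X| = k -> #|Y| = k ->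
  minor B X Y = plucker (fun x => \row_(j < k) B x (nth x0 (enum Y) j)) X.
Proof.
move=> eX eY; rewrite (minorE _ x0 eX eY) /plucker /row_det; congr (\det _).
apply/matrixP => i j; rewrite !mxE (nth_map x0) ?mxE //.
by rewrite -cardE eX.
Qed.

Lemma minor_tr B X Y (x0 : 'I_m) : #|X| = #|Y| -> minor B^T Y X = minor B X Y.
Proof.
move=> eXY; rewrite (minorE _ x0 eXY (erefl _)) (minorE _ x0 (erefl _) eXY) -det_tr.
by congr (\det _); apply/matrixP => i j; rewrite !mxE.
Qed.

Definition row_add (u v : 'I_m) (t : R) B : 'M[R]_m :=
  \matrix_(i, j) (B i j + (i == u)%:R * (t * B v j)).

Let rows B k Y (x0 : 'I_m) : 'I_m -> 'rV[R]_k := fun x => \row_(j < k) B x (nth x0 (enum Y) j).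

Let rows_add u v t B k Y x0 x :
  rows (row_add u v t B) k Y x0 x =
  upd (rows B k Y x0) u (t *: rows B k Y x0 v + rows B k Y x0 u) x.
Proof.
apply/rowP => j; rewrite /upd /rows; case: eqVneq => [->|nxu]; rewrite !mxE.
  by rewrite eqxx mul1r addrC.
by rewrite (negPf nxu) mul0r addr0.
Qed.

Lemma minor_row_add u v t B X Y : consecutive u v -> #|X| = #|Y| ->
  minor (row_add u v t B) X Y =
  minor B X Y + t * ((replaceable u v X)%:R * minor B (replace u v X) Y).
Proof.
move=> cuv eXY; rewrite !(minor_plucker _ u _ (erefl #|Y|)) ?card_replace //.
by rewrite -plucker_row_add //; apply: eq_plucker => x _; exact: rows_add.
Qed.

Lemma minor_row_scale u t B X Y : #|X| = #|Y| ->
  minor (row_add u u t B) X Y = minor B X Y + t * ((u \in X)%:R * minor B X Y).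
Proof.
move=> eXY; rewrite !(minor_plucker _ u eXY (erefl #|Y|)).
rewrite (eq_plucker (fun x _ => rows_add u u t B _ Y u x)).
have [uX|uX] := boolP (u \in X); last by rewrite plucker_upd_notin // mul0r mulr0 addr0.
by rewrite plucker_upd_linear // plucker_upd_id addrC mul1r.
Qed.

Lemma minor_scalar1 X : minor (1%:M : 'M[R]_m) X X = 1.
Proof.
have [->|[x0 _]] := set_0Vmem X.
  by rewrite /minor; move: (conform_mx _ _); rewrite cards0 => A; rewrite det_mx00.
rewrite (minorE _ x0 (erefl _) (erefl _)) -[RHS](det1 R #|X|); congr (\det _).
have lts (l : 'I_#|X|) : (l < size (enum X))%N by rewrite -cardE.
by apply/matrixP => i j; rewrite !mxE nth_uniq ?enum_uniq ?lts.
Qed.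

Lemma minor_scalar0 X Y : #|X| = #|Y| -> X != Y -> minor (1%:M : 'M[R]_m) X Y = 0.
Proof.
move=> eXY nXY; have [x xX xY] : exists2 x, x \in X & x \notin Y.
  apply/subsetPn; apply: contraNN nXY => sXY; rewrite eqEcard sXY.
  by rewrite eXY leqnn.
rewrite (minor_plucker _ x eXY (erefl _)).
set f := (f in plucker f _); rewrite -(plucker_upd_id f x).
have -> : f x = 0.
  apply/rowP => j; rewrite !mxE; case: eqP => // xE; case/negP: xY.
  by rewrite xE -mem_enum mem_nth // -cardE.
exact: plucker_upd0.
Qed.

End RowOperations.

Section TNOperations.
Variables (R : realType) (m : nat).
Implicit Types (s : minor_symbol m) (val : minor_symbol m -> R) (B : 'M[R]_m).

Definition balanced s : bool := #|s.1| == #|s.2|.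

Definition tn_valuation val : Prop := exists2 B : 'M[R]_m, totally_nonnegative B &
  forall s, val s = minor B s.1 s.2.

Definition deforms_TN (act : pred (minor_symbol m)) (mv : minor_symbol m -> minor_symbol m) :=
  forall val t, tn_valuation val -> 0 <= t -> exists2 val', tn_valuation val' &
  forall s, balanced s -> val' s = val s + t * ((act s)%:R * val (mv s)).

(** The deformation formula itself shows that the new matrix is totally nonnegative: each of its
    minors is a sum of nonnegative terms. *)
Lemma deforms_TN_intro (act : pred (minor_symbol m)) mv : (forall s, balanced s -> balanced (mv s)) ->
  (forall B t, exists B', forall s, balanced s ->
     minor B' s.1 s.2 = minor B s.1 s.2 + t * ((act s)%:R * minor B (mv s).1 (mv s).2)) ->
  deforms_TN act mv.
Proof.
move=> bal def val t [B tnB valE] t0; have [B' B'E] := def B t.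
exists (fun s => minor B' s.1 s.2); last by move=> s bs; rewrite B'E // !valE.
exists B' => // X Y eXY; rewrite (B'E (X, Y)); last exact/eqP.
have /eqP b' : balanced (mv (X, Y)) by apply: bal; exact/eqP.
rewrite addr_ge0 ?tnB // mulr_ge0 // mulr_ge0 ?ler0n //; exact: tnB.
Qed.

Lemma balanced_op o s : balanced s -> balanced (op_symbol o s).
Proof. by case: o => u v; rewrite /balanced /= card_replace. Qed.

Lemma op_symbol_id o s : ~~ op_active o s -> op_symbol o s = s.
Proof. by case: o s => u v [X Y] /= /negPf h; rewrite /replace h. Qed.

Lemma deforms_TN_op o : consecutive_op o -> deforms_TN (op_active o) (op_symbol o).
Proof.
case: o => u v cuv; apply: deforms_TN_intro => [s|B t]; try exact: balanced_op.
  by exists (row_add u v t B) => s /eqP bs; rewrite minor_row_add.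
exists (row_add u v t B^T)^T => s /eqP bs /=.
rewrite -[minor _ s.1 s.2](minor_tr _ u) ?card_replace // trmxK.
rewrite -[minor B s.1 s.2](minor_tr _ u) // -[minor B s.1 (replace _ _ _)](minor_tr _ u) ?card_replace //.
by rewrite minor_row_add.
Qed.

Lemma deforms_TN_scale_row (x : 'I_m) : deforms_TN (fun s => x \in s.1) id.
Proof.
apply: deforms_TN_intro => // B t; exists (row_add x x t B) => s /eqP bs.
exact: minor_row_scale.
Qed.

Lemma deforms_TN_scale_col (x : 'I_m) : deforms_TN (fun s => x \in s.2) id.
Proof.
apply: deforms_TN_intro => // B t; exists (row_add x x t B^T)^T => s /eqP bs.
by rewrite -[LHS](minor_tr _ x) // trmxK minor_row_scale // (minor_tr _ x).
Qed.

End TNOperations.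

(** * Validity of inequalities under index operations *)

Section Validity.
Variables (R : realType) (m : nat).
Implicit Types (s : minor_symbol m) (val : minor_symbol m -> R) (p q : minor_product m).
Implicit Types (o : option (minor_product m)) (w : index_op m).

(** An index operation keeps each side a single product or [Zero], so an option describes every side
    that can arise from [principal_ineq]. *)
Definition det_of o : det_sum m := if o is Some p then Product p else Zero.

Lemma valid_TN_option o1 o2 : valid_TN R (Le (det_of o1) (det_of o2)) <->
  forall val, tn_valuation val -> oval val o1 <= oval val o2.
Proof.
have E B val o : (forall s, val s = minor B s.1 s.2) -> eval_sum B (det_of o) = oval val o.
  by move=> valE; case: o => //= p; apply: eq_bigr => s _; rewrite valE.
split=> h => [val [B /h + valE]|B /= tnB]; first by rewrite /= !(E B val).
by rewrite !(E B _ _ (fun s => erefl)); apply: h; exists B.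
Qed.

Let wfo o1 o2 := all (@balanced m) (flatten (oseq o1 ++ oseq o2)).

Lemma all_balanced_op w p : all (@balanced m) p -> all (@balanced m) (map (op_symbol w) p).
Proof. by rewrite all_map; apply: sub_all => s; exact: balanced_op. Qed.

Lemma apply_op_valid w o1 o2 : consecutive_op w -> wfo o1 o2 ->
  valid_TN R (Le (det_of o1) (det_of o2)) -> exists o1' o2',
  [/\ apply_op w (Le (det_of o1) (det_of o2)) = Le (det_of o1') (det_of o2'),
      wfo o1' o2' & valid_TN R (Le (det_of o1') (det_of o2'))].
Proof.
move=> cw wf12 /valid_TN_option le12.
pose d := (\max_(p <- oseq o1 ++ oseq o2) count (op_active w) p)%N.
pose oo := oop (op_active w) (op_symbol w) d.
exists (oo o1), (oo o2); split.
- have E o : subst_sum (fun p => if count (op_active w) p == d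
      then Product (map (op_symbol w) p) else Zero) (det_of o) = det_of (oo o).
    by case: o => //= p; rewrite /oo /=; case: ifP.
  rewrite -!E /apply_op /=; congr (Le (subst_sum _ _) (subst_sum _ _));
    by rewrite /d; case: (o1); case: (o2).
- have wfoo o : all (@balanced m) (flatten (oseq o)) -> all (@balanced m) (flatten (oseq (oo o))).
    by case: o => //= p; rewrite /oo /= cats0; case: ifP => //= _ wp; rewrite cats0 all_balanced_op.
  by move: wf12; rewrite /wfo !flatten_cat !all_cat => /andP[h1 h2]; rewrite !wfoo.
apply/valid_TN_option => val Pval.
exact: (leading_products (@op_symbol_id m w) (deforms_TN_op cw) wf12 le12 Pval).
Qed.

Lemma apply_ops_valid ws o1 o2 : all (@consecutive_op m) ws -> wfo o1 o2 ->
  valid_TN R (Le (det_of o1) (det_of o2)) -> valid_TN R (apply_ops ws (Le (det_of o1) (det_of o2))).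
Proof.
elim: ws o1 o2 => [//|w ws IH] o1 o2 /andP[cw cws] wf12 v12.
have [o1' [o2' [E wf' v']]] := apply_op_valid cw wf12 v12.
by rewrite -[apply_ops _ _]/(apply_ops ws (apply_op w _)) E; exact: IH.
Qed.

Let set_weight (X : {set 'I_m}) : nat := (\sum_(x in X) (x : nat))%N.

Let weight p : nat := (\sum_(s <- p) (set_weight s.1 + set_weight s.2))%N.

Let set_weight_replace (u v : 'I_m) X : u = v.+1 :> nat ->
  (set_weight (replace u v X) + replaceable u v X = set_weight X)%N.
Proof.
move=> uE; rewrite /set_weight /replace; case: ifP => [/andP[uX vX]|_]; last by rewrite addn0.
rewrite big_setU1 ?inE ?(negPf vX) ?andbF //= (big_setD1 u uX) /= uE.
by rewrite addn1 addSn.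
Qed.

Let descend (u v : 'I_m) p w : u = v.+1 :> nat -> w = RowOp u v \/ w = ColOp u v ->
  has (op_active w) p -> (weight (map (op_symbol w) p) < weight p)%N.
Proof.
move=> uE ew; rewrite has_count.
have -> : (weight p = weight (map (op_symbol w) p) + count (op_active w) p)%N.
  rewrite /weight; elim: p => [|[X Y] p IH] /=; first by rewrite !big_nil.
  rewrite !big_cons IH; case: ew => -> /=.
    by rewrite -(set_weight_replace X uE); clear; lia.
  by rewrite -(set_weight_replace Y uE); clear; lia.
by clear; lia.
Qed.

(** A set in which no element can move down is an initial segment, and so is determined by its
    size. *)
Let down_closed_eq (X Y : {set 'I_m}) : #|X| = #|Y| ->
  (forall u v : 'I_m, u = v.+1 :> nat -> ~~ replaceable u v X) ->
  (forall u v : 'I_m, u = v.+1 :> nat -> ~~ replaceable u v Y) -> X = Y.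
Proof.
move=> eXY.
have down (Z : {set 'I_m}) : (forall u v : 'I_m, u = v.+1 :> nat -> ~~ replaceable u v Z) ->
    forall x y : 'I_m, (x <= y)%N -> y \in Z -> x \in Z.
  move=> dZ x y; have [n] := ubnP (y - x)%N; elim: n y => // n IH y len.
  rewrite leq_eqVlt => /orP[/eqP/val_inj->//|lt] yZ.
  have lty : (y.-1 < m)%N by have := ltn_ord y; clear; lia.
  apply: (IH (Ordinal lty)) => /=; [by move: len lt; clear; lia | by move: lt; clear; lia|].
  have := dZ y (Ordinal lty); rewrite /replaceable yZ /= negbK; apply.
  by move: lt; clear; lia.
move=> /down dX /down dY; apply/eqP; rewrite eqEcard eXY leqnn andbT.
apply: contraT => /subsetPn[x xX xY].
have sYX : Y \subset X.
  apply/subsetP => y yY; apply: (dX y x) => //; rewrite leqNgt.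
  by apply: contra xY => lt; apply: dY yY; exact: ltnW.
have YX : Y = X by apply/eqP; rewrite eqEcard sYX eXY leqnn.
by rewrite YX xX in xY.
Qed.

(* Operations pushing all indices down preserve the hypothesis and end with
   principal minors, which are 1 at the identity matrix. *)
Lemma product_not_nonpositive p : all (@balanced m) p ->
  ~ (forall val, tn_valuation val -> \prod_(s <- p) val s <= 0).
Proof.
have [n] := ubnP (weight p); elim: n p => // n IH p len bp le0.
have step w : consecutive_op w -> ~~ (weight (map (op_symbol w) p) < weight p)%N.
  move=> cw; apply/negP => lt; apply: (IH (map (op_symbol w) p)).
  - by rewrite (leq_trans lt).
  - exact: all_balanced_op.
  have wfp : all (@balanced m) (flatten (oseq (Some p) ++ oseq None)) by rewrite /= cats0.
  move=> val Pval.
  have := @leading_products _ _ _ _ _ _ (@op_symbol_id m w) (deforms_TN_op cw) (Some p) None wfp le0 val Pval.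
  by rewrite /= big_seq1 eqxx.
have cons (u v : 'I_m) : u = v.+1 :> nat -> consecutive u v.
  by rewrite /consecutive => ->; rewrite eqxx orbT.
have stuck : all (fun s => s.1 == s.2) p.
  have none w : consecutive_op w -> (exists u v : 'I_m, u = v.+1 :> nat /\ (w = RowOp u v \/ w = ColOp u v)) ->
      all (predC (op_active w)) p.
    move=> cw [u [v [uE ew]]]; rewrite all_predC; apply/negP => h.
    by have /negP := step w cw; apply; exact: descend uE ew h.
  have nrow (u v : 'I_m) : u = v.+1 :> nat -> all (predC (op_active (RowOp u v))) p.
    by move=> uE; apply: none; [exact: cons | exists u, v; split=> //; left].
  have ncol (u v : 'I_m) : u = v.+1 :> nat -> all (predC (op_active (ColOp u v))) p.
    by move=> uE; apply: none; [exact: cons | exists u, v; split=> //; right].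
  elim: p bp {len le0 step none} nrow ncol => [|s p IHp] //= /andP[/eqP es bp] nrow ncol.
  apply/andP; split.
    apply/eqP/down_closed_eq => // u v uE.
      by have /andP[] := nrow u v uE.
    by have /andP[] := ncol u v uE.
  apply: IHp => // u v uE; first by have /andP[] := nrow u v uE.
  by have /andP[] := ncol u v uE.
have tn1 : totally_nonnegative (1%:M : 'M[R]_m).
  move=> X Y eXY; have [<-|nXY] := eqVneq X Y; first by rewrite minor_scalar1.
  by rewrite minor_scalar0.
have prod1 : \prod_(s <- p) minor (1%:M : 'M[R]_m) s.1 s.2 = 1.
  elim: p stuck {bp len le0 step} => [|s p IHp] /=; first by rewrite big_nil.
  by case/andP=> /eqP es /IHp; rewrite big_cons es minor_scalar1 mul1r.
have Phi1 : tn_valuation (fun s => minor (1%:M : 'M[R]_m) s.1 s.2) by exists 1%:M.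
by have := le0 _ Phi1; rewrite prod1 ler10.
Qed.

(** Scaling a row or column by [1 + t] gives degree [count act] to each product. Were the left
    degree larger, the leading coefficient would force a nonpositive product of minors. *)
Lemma count_scaling_le (act : pred (minor_symbol m)) p q : deforms_TN R act id ->
  all (@balanced m) p -> all (@balanced m) q ->
  (forall val, tn_valuation val -> \prod_(s <- p) val s <= \prod_(s <- q) val s) ->
  (count act p <= count act q)%N.
Proof.
move=> def bp bq le12; rewrite leqNgt; apply/negP => lt.
apply: (product_not_nonpositive bp) => val Pval.
have wfpq : all (@balanced m) (flatten (oseq (Some p) ++ oseq (Some q))).
  by rewrite /= cats0 all_cat bp.
have := @leading_products _ _ _ id _ _ (fun s _ => erefl s) def (Some p) (Some q) wfpq le12 val Pval.
rewrite /= !big_cons big_nil maxn0 (maxn_idPl (ltnW lt)) eqxx.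
by rewrite (ltn_eqF lt) map_id.
Qed.

End Validity.

(** * Collapsing by row operations, starting from (5) *)

Section RowOpsCollapse.
Variables (R : realType) (m : nat) (R1 R2 K1 K2 : {set 'I_m}).

Let rowop (uv : 'I_m * 'I_m) := RowOp uv.1 uv.2.

(** Row operations leave the column sets at their original values. Quantifying over all
    continuations makes the predicate stable under one more operation. *)
Let V (X1 X2 X1' X2' : {set 'I_m}) : Prop :=
  [/\ #|X1| = #|R1|, #|X2| = #|R2|, #|X1'| = #|K1| & #|X2'| = #|K2|] /\
  forall s : seq ('I_m * 'I_m), (1 <= size s)%N -> all (fun uv => consecutive uv.1 uv.2) s ->
    valid_TN R (apply_ops (map rowop s)
      (Le (Product [:: (X1, R1); (X2, R2)]) (Product [:: (X1', K1); (X2', K2)]))).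

Lemma row_ops_collapse a b : row_ops_cond R R1 R2 K1 K2 ->
  (maxn (count_in K1 a b) (count_in K2 a b) <= maxn (count_in R1 a b) (count_in R2 a b))%N.
Proof.
(* With [mid = 0] the excluded move would need [v.+1 = 0], so every operation is available. *)
case=> eqm ops; apply: (@collapse _ 0 V) => //.
move=> u v X1 X2 X1' X2' cuv _ _ [[c1 c2 c3 c4] valid].
pose cG := (replaceable u v X1 + replaceable u v X2)%N.
pose cH := (replaceable u v X1' + replaceable u v X2')%N.
set E := Le _ _ in valid.
have opE : apply_op (RowOp u v) E =
  Le (if cG == maxn cG cH then Product [:: (replace u v X1, R1); (replace u v X2, R2)] else Zero)
     (if cH == maxn cG cH then Product [:: (replace u v X1', K1); (replace u v X2', K2)] else Zero).
  by rewrite /apply_op /E /= !big_cons big_nil /= !addn0 maxn0.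
split.
  apply/negbTE; rewrite -leqNgt leqNgt; apply/negP => lt.
  have cs : all (fun uv => consecutive uv.1 uv.2) [:: (u, v)] by rewrite /= cuv.
  have : valid_TN R (apply_op (RowOp u v) E) := valid [:: (u, v)] isT cs.
  rewrite opE (maxn_idPl (ltnW lt)) eqxx (ltn_eqF lt).
  move/(@valid_TN_option R m (Some _) None); apply: product_not_nonpositive.
  by rewrite /= /balanced /= !card_replace c1 c2 !eqxx.
move=> eqc; split; first by rewrite !card_replace.
move=> s szs cs.
have cs' : all (fun uv => consecutive uv.1 uv.2) ((u, v) :: s) by rewrite /= cuv.
have : valid_TN R (apply_ops (map rowop s) (apply_op (RowOp u v) E)) := valid (_ :: s) isT cs'.
rewrite opE; by rewrite /cG eqc -/cH maxnn eqxx.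
Qed.

End RowOpsCollapse.

(** * Collapsing by deformations of the folded matrix, starting from (1) *)

Section FoldCollapse.
Variables (R : realType) (m : nat) (x0 : 'I_m).
Notation N := (m + m)%N.

Definition fold_valuation (val : {set 'I_N} -> R) : Prop :=
  exists2 A : 'M[R]_m, totally_nonnegative A & forall G, val G = plucker (fold_rows A) G.

Lemma fold_deform_exists (u v : 'I_N) (A : 'M[R]_m) t : consecutive u v ->
  ~~ ((u == m :> nat) && (v.+1 == m :> nat)) ->
  exists A', forall G : {set 'I_N}, #|G| = m -> plucker (fold_rows A') G =
    plucker (fold_rows A) G + t * ((replaceable u v G)%:R * plucker (fold_rows A) (replace u v G)).
Proof.
have foldl (B : 'M[R]_m) i : fold_rows B (lshift m i) = row i B.
  by rewrite /fold_rows -[lshift m i]/(unsplit (inl i)) unsplitK.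
have foldr (B : 'M[R]_m) j : fold_rows B (rshift m j) = (-1) ^+ j *: delta_mx 0 (rev_ord j).
  by rewrite /fold_rows -[rshift m j]/(unsplit (inr j)) unsplitK.
have upd_case (A' : 'M[R]_m) : consecutive u v ->
    (fold_rows A' =1 upd (fold_rows A) u (t *: fold_rows A v + fold_rows A u)) ->
    forall G : {set 'I_N}, #|G| = m -> plucker (fold_rows A') G =
    plucker (fold_rows A) G + t * ((replaceable u v G)%:R * plucker (fold_rows A) (replace u v G)).
  move=> cuv E G cG; rewrite -plucker_row_add //.
  by apply: eq_plucker => x _; exact: E.
move=> cuv; move: upd_case (cuv).
case: (split_ordP u) => i ->; case: (split_ordP v) => j -> upd_case c nmid.
- exists (row_add i j t A); apply: upd_case => // x.
  rewrite /upd; case: (split_ordP x) => l ->; last by rewrite eq_rlshift !foldr.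
  rewrite (inj_eq (@lshift_inj _ _)) !foldl; apply/rowP => y; case: eqVneq => [->|nl]; rewrite !mxE.
    by rewrite eqxx mul1r addrC.
  by rewrite (negPf nl) mul0r addr0.
(* The first unit row carries the sign [+1] and is supported in the last column; adding it to the
   last row of [A] changes the last diagonal entry. *)
- have j0 : j = 0%N :> nat by move: c; rewrite /consecutive /=; have := ltn_ord i; clear; lia.
  exists (A + t *: delta_mx i (rev_ord j)); apply: upd_case => // x.
  rewrite /upd; case: (split_ordP x) => l ->; last by rewrite eq_rlshift !foldr.
  rewrite (inj_eq (@lshift_inj _ _)) !foldl foldr j0 expr0 scale1r; apply/rowP => y.
  case: eqVneq => [->|nl]; rewrite !mxE; first by rewrite !eqxx addrC.
  by rewrite (negPf nl) mulr0 addr0.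
(* A unit row would have to absorb the last row of [A]; this is the excluded move. *)
- by move: c nmid; rewrite /consecutive /=; have := ltn_ord j; clear; lia.
(* Unit rows do not depend on [A], so this move is realized by a column addition on [A] and compared
   through minors. Passing to the complementary column set reverses its direction. *)
have crev : consecutive (rev_ord j) (rev_ord i).
  by move: c; rewrite /consecutive /=; have := ltn_ord i; have := ltn_ord j; clear; lia.
exists (row_add (rev_ord j) (rev_ord i) t A^T)^T => G cG.
have nij : rshift m j != rshift m i by exact: consecutive_neq.
have cards := card_unfold cG.
have repE : replaceable (rshift m i) (rshift m j) G = replaceable (rev_ord j) (rev_ord i) (unfold_cols G).
  by rewrite /replaceable !inE !rev_lshift !rev_ordK negbK andbC.
have rowsE : unfold_rows (replace (rshift m i) (rshift m j) G) = unfold_rows G.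
  apply/setP => l; rewrite !inE in_replace; last by rewrite eq_sym.
  by rewrite !eq_lrshift.
have colsE : unfold_cols (replace (rshift m i) (rshift m j) G) = replace (rev_ord j) (rev_ord i) (unfold_cols G).
  apply/setP => l; rewrite [RHS]in_replace; last first.
    by rewrite (inj_eq rev_ord_inj) -(inj_eq (@rshift_inj m m)).
  rewrite !inE in_replace; last by rewrite eq_sym.
  have eqr (l' : 'I_m) : (rshift m (rev_ord l) == rshift m l') = (l == rev_ord l').
    by rewrite (inj_eq (@rshift_inj _ _)) -(inj_eq rev_ord_inj) rev_ordK.
  have nrev : rev_ord j != rev_ord i by rewrite (inj_eq rev_ord_inj) -(inj_eq (@rshift_inj m m)).
  rewrite !rev_lshift !rev_ordK !eqr.
  have [->|nlj] := eqVneq l (rev_ord j).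
    by rewrite (negPf nrev) negb_or andbC.
  by case: eqVneq => // _; rewrite negb_and orbC.
have cG' : #|replace (rshift m i) (rshift m j) G| = m by rewrite card_replace.
have cards' := card_unfold cG'.
have pluckE (B : 'M[R]_m) (H : {set 'I_N}) : #|H| = m ->
    plucker (fold_rows B) H = minor B (unfold_rows H) (unfold_cols H).
  by move=> cH; rewrite minor_fold ?unfoldK ?card_unfold.
rewrite !pluckE // repE rowsE colsE -[LHS](minor_tr _ x0) // trmxK minor_row_add //.
rewrite !(minor_tr _ x0) //.
by rewrite card_replace.
Qed.

Lemma fold_valuation_deform (u v : 'I_N) : consecutive u v ->
  ~~ ((u == m :> nat) && (v.+1 == m :> nat)) ->
  forall val t, fold_valuation val -> 0 <= t -> exists2 val', fold_valuation val' &
  forall G : {set 'I_N}, #|G| == m ->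
    val' G = val G + t * ((replaceable u v G)%:R * val (replace u v G)).
Proof.
move=> cuv nmid val t [A tnA valE] t0.
have [A' A'E] := fold_deform_exists A t cuv nmid.
exists (plucker (fold_rows A')); last by move=> G /eqP cG; rewrite A'E // !valE.
exists A' => // X Y eXY.
have cG : #|fold_index X (~: Y)| = m.
  by rewrite card_fold_index eXY cardsC card_ord.
rewrite (minor_fold A' x0 eXY) A'E // addr_ge0 ?fold_rows_ge0 //.
by rewrite !mulr_ge0 ?ler0n // fold_rows_ge0 // card_replace.
Qed.

Let V (G1 G2 H1 H2 : {set 'I_N}) : Prop :=
  [/\ #|G1| = m, #|G2| = m, #|H1| = m & #|H2| = m] /\
  forall val, fold_valuation val -> val G1 * val G2 <= val H1 * val H2.

Lemma fold_collapse a b (G1 G2 H1 H2 : {set 'I_N}) :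
  [/\ #|G1| = m, #|G2| = m, #|H1| = m & #|H2| = m] ->
  (forall A : 'M[R]_m, totally_nonnegative A ->
     plucker (fold_rows A) G1 * plucker (fold_rows A) G2 <=
     plucker (fold_rows A) H1 * plucker (fold_rows A) H2) ->
  eq_multiset_union G1 G2 H1 H2 ->
  (maxn (count_in H1 a b) (count_in H2 a b) <= maxn (count_in G1 a b) (count_in G2 a b))%N.
Proof.
move=> cards ineq eqm; apply: (@collapse _ m V) => //; last first.
  by split=> // val [A tnA valE]; rewrite !valE; exact: ineq.
move=> u v {cards ineq eqm} {}G1 {}G2 {}H1 {}H2 cuv nmid _ [[c1 c2 c3 c4] le12].
pose cG := (replaceable u v G1 + replaceable u v G2)%N.
pose cH := (replaceable u v H1 + replaceable u v H2)%N.
pose wf (G : {set 'I_N}) := #|G| == m.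
have wf12 : all wf (flatten (oseq (Some [:: G1; G2]) ++ oseq (Some [:: H1; H2]))).
  by rewrite /= /wf c1 c2 c3 c4 eqxx.
have mv_id G : ~~ replaceable u v G -> replace u v G = G by rewrite /replace => /negPf ->.
have le12' val : fold_valuation val -> oval val (Some [:: G1; G2]) <= oval val (Some [:: H1; H2]).
  by move=> Pval; rewrite /= !big_cons !big_nil !mulr1; exact: le12.
have := leading_products mv_id (fold_valuation_deform cuv nmid) wf12 le12'.
rewrite /= !big_cons big_nil /= !addn0 maxn0 -/cG -/cH => lead.
split.
  apply/negbTE; rewrite -leqNgt leqNgt; apply/negP => lt; move: lead.
  rewrite (maxn_idPl (ltnW lt)) eqxx (ltn_eqF lt) => lead.
  (* Unfolding returns to minors of [A], where a product that is always nonpositive has been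
     excluded. *)
  pose sym (G : {set 'I_N}) : minor_symbol m := (unfold_rows G, unfold_cols G).
  apply: (@product_not_nonpositive R m [:: sym (replace u v G1); sym (replace u v G2)]).
    by rewrite /= /balanced /= !card_unfold ?card_replace // !eqxx.
  move=> val [A tnA valE]; have := lead (plucker (fold_rows A)) (ex_intro2 _ _ A tnA (fun=> erefl)).
  rewrite /= !big_cons !big_nil !valE /=.
  by rewrite !(minor_fold A x0) ?card_unfold ?card_replace // !unfoldK.
move=> eqc; split; first by rewrite !card_replace.
move=> val Pval; have := lead val Pval; rewrite (_ : cG = cH) // maxnn eqxx.
by rewrite /= !big_cons !big_nil !mulr1.
Qed.

End FoldCollapse.

(** * The equivalences *)

Section Counting.
Variable N : nat.
Implicit Types (G H K X : {set 'I_N}) (a b : nat).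

Lemma count_in_sum G a b : count_in G a b = (\sum_(x : 'I_N | (a <= x < b)%N) (x \in G))%N.
Proof.
rewrite /count_in -sum1_card big_mkcond [RHS]big_mkcond /=.
by apply: eq_bigr => x _; rewrite inE; case: (x \in G); case: (a <= x < b)%N.
Qed.

Lemma count_in_pointwise G1 G2 H1 H2 a b :
  (forall x, (x \in G1) + (x \in G2) = (x \in H1) + (x \in H2))%N ->
  (count_in G1 a b + count_in G2 a b = count_in H1 a b + count_in H2 a b)%N.
Proof.
by move=> E; rewrite !count_in_sum -!big_split /=; apply: eq_bigr => x _; exact: E.
Qed.

Lemma count_in_prefix G a b : (a <= b)%N -> (count_in G 0 b = count_in G 0 a + count_in G a b)%N.
Proof.
move=> ab; rewrite !count_in_sum [LHS](bigID (fun x : 'I_N => (x < a)%N)) /=.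
congr (_ + _)%N; apply: eq_bigl => x; move: ab; clear; lia.
Qed.

(** Translates between ranks in [M], which define contiguous subsets, and positions, which define
    the intervals used in the counts. *)
Lemma enum_val_ltP (M : {set 'I_N}) (s : 'I_#|M|) a :
  (enum_val s < a)%N = (s < count_in M 0 a)%N.
Proof.
have [x0 _] : exists x0 : 'I_N, true by exists (enum_val s).
pose M1 := [seq x : 'I_N <- enum M | (x < a)%N]; pose M2 := [seq x : 'I_N <- enum M | (a <= x)%N].
have srt P : sorted (@ord_lt N) [seq x <- enum M | P x].
  by apply: sorted_filter (sorted_enum_set M); exact: ord_lt_trans.
have ME : enum M = M1 ++ M2.
  apply: eq_sorted_enum.
    apply: sorted_cat_lt; try exact: srt.
    by move=> x y; rewrite !mem_filter => /andP[+ _] /andP[+ _]; clear; lia.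
  move=> x; rewrite mem_cat !(mem_filter _ _ (enum M)) mem_enum -andb_orl.
  by case: ltnP.
have inM1 y : y \in M1 -> (y < a)%N by rewrite (mem_filter _ _ (enum M)) => /andP[].
have inM2 y : y \in M2 -> (a <= y)%N by rewrite (mem_filter _ _ (enum M)) => /andP[].
have sz1 : size M1 = count_in M 0 a.
  rewrite /count_in -(card_uniqP (filter_uniq _ (enum_uniq _))).
  by apply: eq_card => x; rewrite mem_filter mem_enum !inE andbC.
have lts : (s < size (enum M))%N by rewrite -cardE.
rewrite (enum_val_nth x0) ME nth_cat sz1; rewrite ME size_cat sz1 in lts.
case: (ltnP s (count_in M 0 a)) => lt1.
  by rewrite inM1 // mem_nth ?sz1.
have : (a <= nth x0 M2 (s - count_in M 0 a))%N.
  by apply: inM2; rewrite mem_nth // ltn_subLR.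
by move=> h; apply/negbTE; rewrite -leqNgt.
Qed.

Lemma enum_val_lt (M : {set 'I_N}) (s t : 'I_#|M|) :
  (enum_val s < enum_val t)%N = (s < t)%N.
Proof.
have self (r : 'I_#|M|) : (count_in M 0 (enum_val r) <= r)%N.
  by rewrite leqNgt -enum_val_ltP ltnn.
apply/idP/idP => [|lt]; first by rewrite enum_val_ltP => /leq_trans; apply.
rewrite ltnNge leq_eqVlt negb_or; apply/andP; split.
  by apply: contraTN lt => /eqP/val_inj/enum_val_inj ->; rewrite ltnn.
rewrite enum_val_ltP -leqNgt; exact: leq_trans (self s) (ltnW lt).
Qed.

Lemma contiguous_interval (M : {set 'I_N}) a b :
  contiguous M [set x in M | (a <= x < b)%N].
Proof.
exists (count_in M 0 a), (count_in M 0 b); apply/setP => x; rewrite !inE.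
apply/andP/imsetP => [[xM xab]|[s + ->]].
  exists (enum_rank_in xM x); last by rewrite enum_rankK_in.
  rewrite !inE; move: xab; rewrite -{1 2}(enum_rankK_in xM xM).
  by rewrite leqNgt !enum_val_ltP -leqNgt.
by rewrite inE leqNgt -!enum_val_ltP -leqNgt; split; first exact: enum_valP.
Qed.

Lemma contiguousP (M S : {set 'I_N}) : contiguous M S ->
  exists a b, S = [set x in M | (a <= x < b)%N].
Proof.
move=> [a [b ->]].
have pos c : exists c', forall s : 'I_#|M|, (s < c)%N = (enum_val s < c')%N.
  have [lt|ge] := ltnP c #|M|; last first.
    by exists N => s; rewrite ltn_ord (leq_trans (ltn_ord s) ge).
  by exists (enum_val (Ordinal lt)) => s; rewrite enum_val_lt.
have [a' aE] := pos a; have [b' bE] := pos b; exists a', b'.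
apply/setP => x; rewrite inE; apply/imsetP/andP => [[s + ->]|[xM xab]].
  by rewrite inE leqNgt aE bE -leqNgt; split; first exact: enum_valP.
exists (enum_rank_in xM x); last by rewrite enum_rankK_in.
by rewrite inE leqNgt aE bE enum_rankK_in // -leqNgt.
Qed.
End Counting.

Section MaxCondition.
Variables (N : nat) (R1 R2 K1 K2 : {set 'I_N}).
Hypothesis eqm : eq_multiset_union R1 R2 K1 K2.

Let M := (R1 :\: R2) :|: (R2 :\: R1).

(** Equality of multisets makes the elements common to [R1] and [R2] those common to [K1] and [K2].
    Their number [c] is thus the same correction in all four counts. *)
Let interval_counts a b (S := [set x in M | (a <= x < b)%N]) :
  exists c, [/\ count_in R1 a b = (#|S :&: R1| + c)%N, count_in R2 a b = (#|S :&: R2| + c)%N,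
    count_in K1 a b = (#|S :&: K1| + c)%N, count_in K2 a b = (#|S :&: K2| + c)%N &
    #|S| = (#|S :&: R1| + #|S :&: R2|)%N /\ #|S| = (#|S :&: K1| + #|S :&: K2|)%N].
Proof.
have SE (G : {set 'I_N}) : #|S :&: G| = count_in (M :&: G) a b.
  by apply: eq_card => x; rewrite !inE; case: (x \in G); rewrite ?andbT ?andbF.
have S0 : #|S| = count_in M a b by [].
have count0 : count_in (set0 : {set 'I_N}) a b = 0%N.
  by apply/eqP; rewrite cards_eq0; apply/eqP/setP => x; rewrite !inE.
exists (count_in (R1 :&: R2) a b); rewrite !SE S0; split; last split.
all: try (rewrite -[LHS]addn0 -count0; apply: count_in_pointwise => x;
  move: (eqm x); rewrite !inE; case: (x \in R1); case: (x \in R2);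
  case: (x \in K1); case: (x \in K2) => //).
Qed.

(** A balanced interval meets [M] in an even set, so (3) applies to it. Both right-hand counts are
    then at most half of [#|S|], and they add up to [#|S|]. *)
Lemma max_cond_balance : contiguous_max_cond R1 R2 K1 K2 -> balance_le R1 R2 K1 K2.
Proof.
case=> _ maxc a b; pose S := [set x in M | (a <= x < b)%N].
have [c [-> -> -> -> []]] := interval_counts a b; rewrite -/S => e1 e2.
move/addIn => eqs; have evenS : ~~ odd #|S| by rewrite e1 eqs addnn odd_double.
have : (maxn #|S :&: K1| #|S :&: K2| <= maxn #|S :&: R1| #|S :&: R2|)%N.
  by apply: maxc evenS; exact: contiguous_interval.
rewrite eqs maxnn geq_max => /andP[le1 le2]; congr (_ + _)%N.
move: e1; rewrite e2 eqs; move: le1 le2; clear.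
by move: #|_| #|_| #|_| => t2 s t1; lia.
Qed.

Lemma max_cond_intro :
  (forall a b, (maxn (count_in K1 a b) (count_in K2 a b) <= maxn (count_in R1 a b) (count_in R2 a b))%N) ->
  contiguous_max_cond R1 R2 K1 K2.
Proof.
move=> le; split=> // S /contiguousP[a [b ->]] _; have := le a b.
have [c [-> -> -> -> _]] := interval_counts a b.
by rewrite -!addn_maxl leq_add2r.
Qed.

End MaxCondition.

(** * Counts in folded sets *)

Section FoldSets.
Variable n : nat.
Implicit Types P Q I J K R X : {set 'I_n}.

(** Past the fold, complementing both sets changes the sign of the difference of indicators, and
    interchanging them does the same. Sums replace differences to stay in [nat]. *)
Lemma fold_skew P1 P2 Q1 Q2 x :
  ((x \in fold_index P1 (~: Q1)) + (x \in fold_index P2 Q1) =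
   (x \in fold_index P1 Q2) + (x \in fold_index P2 (~: Q2)))%N.
Proof.
case: (split_ordP x) => i ->; rewrite ?in_fold_lshift ?in_fold_rshift ?inE //.
by case: (_ \in Q1); case: (_ \in Q2).
Qed.

Lemma fold_eqm P1 P2 Q1 Q2 I1 I2 J1 J2 :
  eq_multiset_union P1 P2 I1 I2 -> eq_multiset_union Q1 Q2 J1 J2 ->
  eq_multiset_union (fold_index P1 Q2) (fold_index P2 Q1) (fold_index I1 J2) (fold_index I2 J1).
Proof.
move=> eP eQ x; case: (split_ordP x) => i ->; rewrite ?in_fold_lshift ?in_fold_rshift //.
by rewrite addnC eQ addnC.
Qed.

Lemma fold_compl_eqm P1 P2 Q1 Q2 I1 I2 J1 J2 :
  eq_multiset_union (fold_index P1 Q2) (fold_index P2 Q1) (fold_index I1 J2) (fold_index I2 J1) ->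
  eq_multiset_union (fold_index P1 (~: Q1)) (fold_index P2 (~: Q2))
                    (fold_index I1 (~: J1)) (fold_index I2 (~: J2)).
Proof.
move=> e x; have := e x; case: (split_ordP x) => i ->; rewrite ?in_fold_lshift ?in_fold_rshift ?inE //.
by case: (_ \in Q1); case: (_ \in Q2); case: (_ \in J1); case: (_ \in J2).
Qed.

Lemma fold_skew_count P1 P2 Q1 Q2 a b :
  (count_in (fold_index P1 (~: Q1)) a b + count_in (fold_index P2 Q1) a b =
   count_in (fold_index P1 Q2) a b + count_in (fold_index P2 (~: Q2)) a b)%N.
Proof. by apply: count_in_pointwise => x; exact: fold_skew. Qed.

(* Reading past the middle of [fold_index X (~: X)] undoes what was read before it. *)
Lemma fold_compl_prefix a : exists c, forall X,
  count_in (fold_index X (~: X)) 0 a = (c + count_in X 0 (minn a (n + n - a)))%N.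
Proof.
(* The number of reflected positions below [a]: index [y] sits at position [n + n - y.+1]. It is
   occupied when [y] is outside [X], so together with the original position of [y] it contributes 1
   whatever [X] is. *)
exists (\sum_(y < n) (n + n <= a + y : nat))%N => X.
rewrite !count_in_sum big_mkcond big_split_ord /=.
rewrite [X in (_ + X)%N](reindex_inj rev_ord_inj) [X in (_ = _ + X)%N]big_mkcond -!big_split /=.
apply: eq_bigr => y _; rewrite in_fold_lshift in_fold_rshift rev_ordK inE.
have := ltn_ord y; case: (y \in X) => /=; case: ifP; case: ifP; case: ifP; case: leqP; clear; lia.
Qed.

(** A count over an interval is a difference of two prefix counts. By the folding of prefixes it
    becomes, up to sign and a common constant, a count over one interval of the unfolded indices. *)
Lemma fold_compl_balance R1 R2 K1 K2 : balance_le R1 R2 K1 K2 ->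
  balance_le (fold_index R1 (~: R1)) (fold_index R2 (~: R2))
             (fold_index K1 (~: K1)) (fold_index K2 (~: K2)).
Proof.
move=> bal a b; have [leab|ltba] := leqP a b; last first.
  have count0 (G : {set 'I_(n + n)}) : count_in G a b = 0%N.
    by apply/eqP; rewrite cards_eq0; apply/eqP/setP => x; rewrite !inE; move: ltba; clear; lia.
  by rewrite !count0.
have [ca caE] := fold_compl_prefix a; have [cb cbE] := fold_compl_prefix b.
have pre (X : {set 'I_n}) := count_in_prefix (fold_index X (~: X)) leab.
move: (pre R1) (pre R2) (pre K1) (pre K2); rewrite !caE !cbE.
set al := minn a _; set be := minn b _.
have [le|lt] := leqP al be.
  rewrite !(count_in_prefix _ le); have := bal al be.
  by move: (count_in _ _ _) => *; lia.
rewrite !(count_in_prefix _ (ltnW lt)); have := bal be al.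
by move: (count_in _ _ _) => *; lia.
Qed.

End FoldSets.

Section Inequalities.
Variables (R : realType) (m : nat).
Implicit Types (X Y P Q I J : {set 'I_m}).

Lemma ineq_TN_balance P1 P2 Q1 Q2 I1 I2 J1 J2 : (0 < m)%N ->
  [/\ #|P1| = #|Q1|, #|P2| = #|Q2|, #|I1| = #|J1| & #|I2| = #|J2|] ->
  eq_multiset_union (fold_index P1 (~: Q1)) (fold_index P2 (~: Q2))
                    (fold_index I1 (~: J1)) (fold_index I2 (~: J2)) ->
  balance_le (fold_index P1 (~: Q1)) (fold_index P2 (~: Q2))
             (fold_index I1 (~: J1)) (fold_index I2 (~: J2)) ->
  ineq_TN R P1 P2 Q1 Q2 I1 I2 J1 J2.
Proof.
move=> m_gt0 [c1 c2 c3 c4] eqm bal A tnA; pose x0 := Ordinal m_gt0.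
rewrite !(minor_fold A x0) //; apply: plucker_pair_le.
- exact: (fold_rows_ge0 x0 tnA).
- by split; rewrite card_fold_index ?c1 ?c2 ?c3 ?c4 cardsC card_ord.
by move=> p S pK pN; exact: compat_transfer pK pN eqm bal.
Qed.

Let eq_of_leq_sum (f g : 'I_m -> nat) : (forall x, (f x <= g x)%N) ->
  (\sum_x f x = \sum_x g x)%N -> forall x, f x = g x.
Proof.
move=> le eqs x; apply/eqP; rewrite eqn_leq le leqNgt; apply/negP => lt.
have : (\sum_x f x < \sum_x g x)%N; last by rewrite eqs ltnn.
rewrite (bigD1 x) // [X in (_ < X)%N](bigD1 x) //= -addSn.
by apply: leq_add => //; apply: leq_sum.
Qed.

(** Scaling one row or column shows that each index occurs at most as often on the left as on the
    right; since the totals agree, all these inequalities are equalities. *)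
Lemma ineq_TN_multiset P1 P2 Q1 Q2 I1 I2 J1 J2 :
  [/\ #|P1| = #|Q1|, #|P2| = #|Q2|, #|I1| = #|J1| & #|I2| = #|J2|] ->
  (#|P1| + #|P2| = #|I1| + #|I2|)%N ->
  ineq_TN R P1 P2 Q1 Q2 I1 I2 J1 J2 ->
  eq_multiset_union P1 P2 I1 I2 /\ eq_multiset_union Q1 Q2 J1 J2.
Proof.
move=> [c1 c2 c3 c4] cs ineq.
pose p : minor_product m := [:: (P1, Q1); (P2, Q2)].
pose q : minor_product m := [:: (I1, J1); (I2, J2)].
have bp : all (@balanced m) p by rewrite /= /balanced /= c1 c2 !eqxx.
have bq : all (@balanced m) q by rewrite /= /balanced /= c3 c4 !eqxx.
have le (val : minor_symbol m -> R) : tn_valuation val ->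
    \prod_(s <- p) val s <= \prod_(s <- q) val s.
  move=> [A tnA valE]; rewrite !big_cons !big_nil !mulr1 !valE; exact: ineq.
have sumE (X1 X2 : {set 'I_m}) : (\sum_x ((x \in X1) + (x \in X2)) = #|X1| + #|X2|)%N.
  by rewrite big_split /= -!sum1_card; congr (_ + _)%N;
    rewrite [RHS]big_mkcond; apply: eq_bigr => x _; case: (x \in _).
split; apply: eq_of_leq_sum.
- move=> x; have := count_scaling_le (@deforms_TN_scale_row R m x) bp bq le.
  by rewrite /= !addn0.
- by rewrite !sumE.
- move=> x; have := count_scaling_le (@deforms_TN_scale_col R m x) bp bq le.
  by rewrite /= !addn0.
by rewrite !sumE -c1 -c2 -c3 -c4.
Qed.

Lemma ineq_TN_mixed_ops (R1 R2 K1 K2 : {set 'I_m}) : (#|R1| + #|R2| = #|K1| + #|K2|)%N ->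
  ineq_TN R R1 R2 R1 R2 K1 K2 K1 K2 -> mixed_ops_cond R R1 R2 K1 K2.
Proof.
move=> cs ineq; have [eqm _] := ineq_TN_multiset (And4 erefl erefl erefl erefl) cs ineq.
split=> // os _ cos; apply: (@apply_ops_valid R m os (Some _) (Some _)) => //.
  by rewrite /= /balanced !eqxx.
by move=> A tnA /=; rewrite /eval_product !big_cons !big_nil !mulr1; exact: ineq.
Qed.

Lemma mixed_ops_row_ops (R1 R2 K1 K2 : {set 'I_m}) :
  mixed_ops_cond R R1 R2 K1 K2 -> row_ops_cond R R1 R2 K1 K2.
Proof.
case=> eqm ops; split=> // s szs cs; apply: ops; first by rewrite size_map.
by rewrite all_map.
Qed.

Lemma row_ops_max_cond (R1 R2 K1 K2 : {set 'I_m}) :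
  row_ops_cond R R1 R2 K1 K2 -> contiguous_max_cond R1 R2 K1 K2.
Proof.
move=> ops; apply: max_cond_intro; first by case: ops.
by move=> a b; exact: row_ops_collapse ops.
Qed.

(** For principal minors the folded sets are symmetric about the fold, so balance of all their
    intervals reduces to balance for the given sets. *)
Lemma max_cond_ineq_TN (R1 R2 K1 K2 : {set 'I_m}) : (0 < m)%N ->
  contiguous_max_cond R1 R2 K1 K2 -> ineq_TN R R1 R2 R1 R2 K1 K2 K1 K2.
Proof.
move=> m_gt0 maxc; have eqm := maxc.1; apply: ineq_TN_balance => //.
  exact/fold_compl_eqm/fold_eqm.
exact/fold_compl_balance/max_cond_balance.
Qed.

Lemma max_cond_fold_ineq_TN P1 P2 Q1 Q2 I1 I2 J1 J2 : (0 < m)%N ->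
  [/\ #|P1| = #|Q1|, #|P2| = #|Q2|, #|I1| = #|J1| & #|I2| = #|J2|] ->
  contiguous_max_cond (fold_index P1 Q2) (fold_index P2 Q1)
                      (fold_index I1 J2) (fold_index I2 J1) ->
  ineq_TN R P1 P2 Q1 Q2 I1 I2 J1 J2.
Proof.
move=> m_gt0 cards maxc; have eqm := maxc.1.
apply: ineq_TN_balance => //; first exact: fold_compl_eqm.
move=> a b; have := max_cond_balance eqm maxc (a := a) (b := b).
have := fold_skew_count P1 P2 Q1 Q2 a b; have := fold_skew_count I1 I2 J1 J2 a b.
by do 8 move: (count_in _ _ _) => ?; lia.
Qed.

Lemma ineq_TN_fold_max_cond P1 P2 Q1 Q2 I1 I2 J1 J2 : (0 < m)%N ->
  [/\ #|P1| = #|Q1|, #|P2| = #|Q2|, #|I1| = #|J1| & #|I2| = #|J2|] ->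
  (#|P1| + #|P2| = #|I1| + #|I2|)%N ->
  ineq_TN R P1 P2 Q1 Q2 I1 I2 J1 J2 ->
  contiguous_max_cond (fold_index P1 Q2) (fold_index P2 Q1)
                      (fold_index I1 J2) (fold_index I2 J1).
Proof.
move=> m_gt0 cards cs ineq; pose x0 := Ordinal m_gt0.
have [eP eQ] := ineq_TN_multiset cards cs ineq.
have eqm := fold_eqm eP eQ; have eqmG := fold_compl_eqm eqm.
have [c1 c2 c3 c4] := cards.
apply: max_cond_intro => // a b.
have cardsG : [/\ #|fold_index P1 (~: Q1)| = m, #|fold_index P2 (~: Q2)| = m,
    #|fold_index I1 (~: J1)| = m & #|fold_index I2 (~: J2)| = m].
  by split; rewrite card_fold_index ?c1 ?c2 ?c3 ?c4 cardsC card_ord.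
have ineqG (A : 'M[R]_m) : totally_nonnegative A ->
    plucker (fold_rows A) (fold_index P1 (~: Q1)) * plucker (fold_rows A) (fold_index P2 (~: Q2)) <=
    plucker (fold_rows A) (fold_index I1 (~: J1)) * plucker (fold_rows A) (fold_index I2 (~: J2)).
  by move=> tnA; rewrite -!(minor_fold A x0) //; exact: ineq.
(* With equal totals, comparing maxima amounts to comparing absolute imbalances, and by the skew
   identity these agree for the two pairs of folded sets. *)
have := fold_collapse x0 a b cardsG ineqG eqmG.
have := fold_skew_count P1 P2 Q1 Q2 a b; have := fold_skew_count I1 I2 J1 J2 a b.
have := count_in_pointwise a b eqm; have := count_in_pointwise a b eqmG.
by do 8 move: (count_in _ _ _) => ?; lia.
Qed.

End Inequalities.

Theorem theoremJ (R : realType) (n : nat)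
    (P1 P2 Q1 Q2 I1 I2 J1 J2 : {set 'I_n}) :
  (1 <= n)%N ->
  [/\ P1 != set0, P2 != set0, Q1 != set0 & Q2 != set0] ->
  [/\ I1 != set0, I2 != set0, J1 != set0 & J2 != set0] ->
  [/\ #|P1| = #|Q1|, #|P2| = #|Q2|, #|I1| = #|J1| & #|I2| = #|J2|] ->
  (#|P1| + #|P2| = n)%N -> (#|I1| + #|I2| = n)%N ->
  let R1 := fold_index P1 Q2 in
  let R2 := fold_index P2 Q1 in
  let K1 := fold_index I1 J2 in
  let K2 := fold_index I2 J1 in
  let stmt1 := ineq_TN R P1 P2 Q1 Q2 I1 I2 J1 J2 in
  let stmt2 := ineq_TN R R1 R2 R1 R2 K1 K2 K1 K2 in
  let stmt3 := contiguous_max_cond R1 R2 K1 K2 in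
  let stmt5 := row_ops_cond R R1 R2 K1 K2 in
  let stmt5_mixed := mixed_ops_cond R R1 R2 K1 K2 in
  [/\ stmt5 <-> stmt1, stmt5 <-> stmt2 & stmt5 <-> stmt3] /\
  [/\ stmt5_mixed <-> stmt1, stmt5_mixed <-> stmt2 & stmt5_mixed <-> stmt3].
Proof.
move=> n_gt0 _ _ cards cP cI R1 R2 K1 K2 stmt1 stmt2 stmt3 stmt5 stmt5_mixed.
have n2_gt0 : (0 < n + n)%N by rewrite addn_gt0 n_gt0.
have cRK : (#|R1| + #|R2| = #|K1| + #|K2|)%N.
  by case: cards => c1 c2 c3 c4; rewrite !card_fold_index -c1 -c2 -c3 -c4;
    move: cP cI; clear; lia.
(* The mixed condition contains the row condition, so a cycle through both settles the variant
   together with (5). *)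
have s2m : stmt2 -> stmt5_mixed by exact: ineq_TN_mixed_ops.
have sm5 : stmt5_mixed -> stmt5 by exact: mixed_ops_row_ops.
have s53 : stmt5 -> stmt3 by exact: row_ops_max_cond.
have s32 : stmt3 -> stmt2 by exact: max_cond_ineq_TN.
have s31 : stmt3 -> stmt1 by exact: max_cond_fold_ineq_TN.
have s13 : stmt1 -> stmt3 by apply: ineq_TN_fold_max_cond; rewrite // cP cI.
by split; split; tauto.
Qed.
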